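(* Let $\phi=\tilde p/p$ be a bidegree $(m,n)$ rational inner function on $\mathbb{D}^2$, and let $\alpha\in\mathbb{T}$ be exceptional for $\phi$. Then, for every $f\in C(\mathbb{T}^2)$, the Clark measure $\sigma_\alpha$ of $\phi$ satisfies $$\int_{\mathbb{T}^2} f(\zeta)\,d\sigma_\alpha(\zeta)=\sum_{j=1}^n\int_{\mathbb{T}} f(\zeta,g_j^\alpha(\zeta))\,\frac{dm(\zeta)}{\left|\frac{\partial\phi}{\partial z_2}(\zeta,g_j^\alpha(\zeta))\right|}+\sum_{k=1}^{\ell}c_k^\alpha\int_{\mathbb{T}} f(\tau_k,\zeta)\,dm(\zeta),$$ where $g_1^\alpha,\dots,g_n^\alpha$ are the parametrizing functions of $\mathcal{C}_\alpha(\phi)$, $\zeta_1=\tau_1,\dots,\zeta_1=\tau_\ell$ are the vertical lines in $\mathcal{C}_\alpha(\phi)$, and the $c_k^\alpha=\left|\frac{\partial\phi}{\partial z_1}(\tau_k,z_2)\right|^{-1}>0$ are constants (independent of $z_2$).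
   Context: $\mathbb{D}$ is the open unit disk and $\mathbb{T}$ the unit circle; $m$ in $dm$ is normalized Lebesgue measure on $\mathbb{T}$. Rational inner functions. A rational inner function (RIF) on $\mathbb{D}^2$ is a bounded holomorphic rational function on $\mathbb{D}^2$ whose non-tangential boundary values have modulus $1$ almost everywhere on $\mathbb{T}^2$. Here $\phi=\tilde p/p$ where $p\in\mathbb{C}[z_1,z_2]$ has no zeros in $\mathbb{D}^2$, has degree $m$ in $z_1$ and degree $n$ in $z_2$, $\tilde p(z)=z_1^m z_2^n\,\overline{p(1/\bar z_1,1/\bar z_2)}$, and $p,\tilde p$ have no common factor. Then $\phi$ is said to have bidegree $(m,n)$. Standing assumption: $m>0$ and $n>0$. (The function $\phi$ is analytic at every point of $\mathbb{T}\times\mathbb{D}$.) Clark measures. For $\alpha\in\mathbb{T}$, $\sigma_\alpha$ is the unique positive Borel measure on $\mathbb{T}^2$ with $\frac{1-|\phi(z)|^2}{|\alpha-\phi(z)|^2}=\int_{\mathbb{T}^2}P_{z}(\zeta)\,d\sigma_\alpha(\zeta)$ for $z\in\mathbb{D}^2$, where $P_z(\zeta)=\prod_{j=1}^2\frac{1-|z_j|^2}{|\zeta_j-z_j|^2}$. Level sets. $\mathcal{C}_\alpha(\phi)$ is the closure of $\{\zeta\in\mathbb{T}^2:\lim_{r\to1^-}\phi(r\zeta)=\alpha\}$. Exceptional values. $\alpha\in\mathbb{T}$ is exceptional if $\phi(\tau,z_2)\equiv\alpha$ or $\phi(z_1,\tau)\equiv\alpha$ for some $\tau\in\mathbb{T}$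 (equivalently, one of the lines $\{\zeta_1=\tau\}$, $\{\zeta_2=\tau\}$ in $\mathbb{T}^2$ is contained in $\mathcal{C}_\alpha(\phi)$). Parametrizing functions. For each $\alpha\in\mathbb{T}$ and any choice of base point $\tau_0\in\mathbb{T}$ there are functions $g_1^\alpha,\dots,g_n^\alpha:\mathbb{T}\to\mathbb{T}$, analytic on $\mathbb{T}\setminus\{\tau_0\}$, such that $\mathcal{C}_\alpha(\phi)$ is the union of the graphs $\{(\zeta,g_j^\alpha(\zeta)):\zeta\in\mathbb{T}\}$, $j=1,\dots,n$, together with a finite number $\ell\ge0$ of vertical lines $\{\zeta\in\mathbb{T}^2:\zeta_1=\tau_k\}$, $\tau_k\in\mathbb{T}$. Such a choice is fixed; $\tau_1,\dots,\tau_\ell$ are distinct and list all the vertical lines contained in $\mathcal{C}_\alpha(\phi)$ (there may be none, in which case the second sum is empty). *)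

(* Defs.v *)
From mathcomp Require Import all_boot all_order all_algebra.
From mathcomp Require Import complex.
From mathcomp Require Import all_classical all_reals all_analysis.

Set Implicit Arguments.
Unset Strict Implicit.
Unset Printing Implicit Defensive.

Import Order.TTheory GRing.Theory Num.Theory.
Import numFieldNormedType.Exports.

Local Open Scope classical_set_scope.
Local Open Scope ring_scope.

(* A polynomial in z1, z2 is an element p of {poly {poly K}}, z1 being the outer
   variable: its value is p.[z1, z2], its degree in z1 is (size p).-1 and its
   degree in z2 is (sizeY p).-1. *)
Section Reflection.
Variable K : numClosedFieldType.
Implicit Types p : {poly {poly K}}.

Definition reflection (m n : nat) p : {poly {poly K}} :=
  \poly_(i < m.+1) \poly_(j < n.+1) (p`_(m - i)`_(n - j))^*.

Lemma horner2E p k h (x y : K) :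
    (size p <= k)%N -> (sizeY p <= h)%N ->
  p.[x, y] = \sum_(i < k) \sum_(j < h) p`_i`_j * x ^+ i * y ^+ j.
Proof.
move=> sp sYp; rewrite (horner_coef_wide _ sp) horner_sum; apply: eq_bigr => i _.
rewrite -polyC_exp hornerM hornerC.
rewrite (horner_coef_wide _ (leq_trans (max_size_coefXY p i) sYp)) mulr_suml.
by apply: eq_bigr => j _; rewrite mulrAC.
Qed.

Lemma reflectionE m n p (z1 z2 : K) :
    (size p <= m.+1)%N -> (sizeY p <= n.+1)%N -> z1 != 0 -> z2 != 0 ->
  (reflection m n p).[z1, z2] =
  z1 ^+ m * z2 ^+ n * (p.[(z1^*)^-1, (z2^*)^-1])^*.
Proof.
move=> sp sYp z1_neq0 z2_neq0.
rewrite (@horner2E _ m.+1 n.+1); first last.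
- apply/bigmax_leqP => i _; rewrite coef_poly; case: ifP => _.
    exact: size_poly.
  by rewrite size_poly0.
- exact: size_poly.
rewrite (@horner2E p m.+1 n.+1)// rmorph_sum mulr_sumr (reindex_inj rev_ord_inj).
apply: eq_bigr => i _; rewrite rmorph_sum mulr_sumr (reindex_inj rev_ord_inj).
apply: eq_bigr => j _.
have le_im : (i <= m)%N by rewrite -ltnS.
have le_jn : (j <= n)%N by rewrite -ltnS.
rewrite /= !subSS coef_poly ltnS leq_subr coef_poly ltnS leq_subr !subKn //.
rewrite !rmorphM !rmorphXn !fmorphV /= !conjCK !exprVn.
rewrite !expfB_cond ?(negPf z1_neq0) ?(negPf z2_neq0)//.
by rewrite -!mulrA [in RHS](mulrCA (z2 ^+ n)) [RHS]mulrCA [in RHS](mulrCA (z2 ^+ n)).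
Qed.

End Reflection.

Local Open Scope complex_scope.
Local Open Scope ring_scope.

(* R[i], packaged as a numClosedFieldType so that the norm topology declared by
   numFieldNormedType applies to it; derive1 over (C R) is thus the complex
   derivative. Norms `|z| take their values in C R itself; the real-valued
   modulus is Normc.normc. *)
Definition C (R : realType) : numClosedFieldType := R[i].

Section Clark.
Variable R : realType.
Local Notation C := (C R).
Local Notation normc := ComplexField.Normc.normc.
Implicit Types (m n : nat) (p : {poly {poly C}}) (alpha : C).

Definition T2 : set (C * C) := [set z | `|z.1| = 1 /\ `|z.2| = 1].

(* Borel measures on the torus are represented by Borel measures on C * C that are
   carried by T2. *)
Definition borelC2 := g_sigma_algebraType (@open (C * C)%type).

Definition expi (t : R) : C := cos t +i* sin t.

Definition cintegral d (T : measurableType d)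
    (mu : {measure set T -> \bar R}) (D : set T) (f : T -> C) : C :=
  (\int[mu]_(x in D) complex.Re (f x)) +i* (\int[mu]_(x in D) complex.Im (f x)).

Definition cintegrable d (T : measurableType d)
    (mu : {measure set T -> \bar R}) (D : set T) (f : T -> C) : Prop :=
  mu.-integrable D (fun x => (complex.Re (f x))%:E) /\
  mu.-integrable D (fun x => (complex.Im (f x))%:E).

(* dm is normalized: total mass 1 on the unit circle. *)
Definition circle_integral (f : C -> C) : C :=
  ((2 * pi)^-1)%:C *
  cintegral lebesgue_measure `[0, 2 * pi]%classic (fun t => f (expi t)).

Definition circle_integrable (f : C -> C) : Prop :=
  cintegrable lebesgue_measure `[0, 2 * pi]%classic (fun t => f (expi t)).

Definition rif m n p (z1 z2 : C) : C :=
  (reflection m n p).[z1, z2] / p.[z1, z2].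

(* The factorizations are written out because %| on {poly {poly C}} is
   pseudo-divisibility, i.e. divisibility up to a factor in {poly C}. *)
Definition no_common_factor (p q : {poly {poly C}}) : Prop :=
  forall d a b : {poly {poly C}}, p = d * a -> q = d * b -> d \is a GRing.unit.

Definition rif_bidegree m n p : Prop :=
  [/\ size p = m.+1, sizeY p = n.+1,
      forall z1 z2 : C, `|z1| < 1 -> `|z2| < 1 -> p.[z1, z2] != 0 &
      no_common_factor p (reflection m n p)].

Definition drif1 m n p (z1 z2 : C) : C := derive1 (fun w : C => rif m n p w z2) z1.

Definition drif2 m n p (z1 z2 : C) : C := derive1 (fun w : C => rif m n p z1 w) z2.

Definition poisson (z zeta : C) : R :=
  (1 - normc z ^+ 2) / normc (zeta - z) ^+ 2.

Definition clark_measure m n p alpha (sigma : {measure set borelC2 -> \bar R}) :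
    Prop :=
  sigma (~` T2) = 0%E /\
  forall z1 z2 : C, `|z1| < 1 -> `|z2| < 1 ->
    (((1 - normc (rif m n p z1 z2) ^+ 2) /
       normc (alpha - rif m n p z1 z2) ^+ 2)%:E =
     \int[sigma]_(zeta in T2) (poisson z1 zeta.1 * poisson z2 zeta.2)%:E)%E.

Definition level_set m n p alpha : set (C * C) :=
  closure [set z : C * C | T2 z /\
    (fun r : R => rif m n p (r%:C * z.1) (r%:C * z.2)) @ 1^'- --> alpha].

Definition exceptional m n p alpha : Prop :=
  exists tau : C, `|tau| = 1 /\
    ((forall z2 : C, `|z2| < 1 -> rif m n p tau z2 = alpha) \/
     (forall z1 : C, `|z1| < 1 -> rif m n p z1 tau = alpha)).

(* Only the values of g on the unit circle matter: near z they must be those of a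
   function h that is complex differentiable on a neighborhood of z. *)
Definition circle_analytic_at (g : C -> C) (z : C) : Prop :=
  exists h : C -> C,
    (\forall w \near z, derivable h w 1) /\
    (\forall w \near z, `|w| = 1 -> g w = h w).

Definition parametrization m n p alpha (tau0 : C) (g : 'I_n -> C -> C)
    (l : nat) (tau : 'I_l -> C) : Prop :=
  [/\ forall j zeta, `|zeta| = 1 -> `|g j zeta| = 1,
      forall j zeta, `|zeta| = 1 -> zeta <> tau0 -> circle_analytic_at (g j) zeta,
      injective tau,
      forall t : C,
        `|t| = 1 /\ [set z | z.1 = t /\ `|z.2| = 1] `<=` level_set m n p alpha <->
        exists k, t = tau k &
      level_set m n p alpha =
        [set z | T2 z /\ ((exists j, z.2 = g j z.1) \/ (exists k, z.1 = tau k))]].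

End Clark.

Arguments T2 : clear implicits.
Arguments exceptional {R} m n p alpha.
Arguments parametrization {R} m n p alpha tau0 g {l} tau.

(* Main.v *)
Require Import Defs.
From mathcomp Require Import all_boot all_order all_algebra.
From mathcomp Require Import complex polyXY.
From mathcomp Require Import all_classical all_reals all_analysis.
From mathcomp Require Import measurable_realfun ring lra.

Set Implicit Arguments.
Unset Strict Implicit.
Unset Printing Implicit Defensive.

Import Order.TTheory GRing.Theory Num.Theory.
Import numFieldNormedType.Exports.

Local Open Scope classical_set_scope.
Local Open Scope complex_scope.
Local Open Scope ring_scope.

Local Notation Re := (@complex.Re _).
Local Notation Im := (@complex.Im _).
Local Notation normc := ComplexField.Normc.normc.

(* For fixed z2 in the disc, z1 |-> rif z1 z2 is bounded by 1 on the disc, so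
   (alpha + rif) / (alpha - rif) has nonnegative real part there. Its poles on the
   circle are exactly the tau_k, because by the Schwarz lemma rif(tau, .) takes the
   value alpha inside the disc only if it is constant; they are simple, and the
   Julia-Caratheodory derivative at tau_k, which is positive and equal to
   |drif1 (tau_k) z2|, is the inverse of the mass carried by that line. It is a
   quotient of polynomials in z2 that is real on the disc, hence constant. What
   remains after removing the poles is the Poisson integral of its boundary values.
   For all but finitely many zeta on the circle, rif(zeta, .) is a finite Blaschke
   product, and the same partial fractions in z2 express these boundary values by
   the g_j(zeta), weighted by 1 / |drif2|. So both sides of the formula agree on
   products of Poisson kernels, which span a dense subspace of C(T^2). *)

(** No theory of holomorphic functions is used: the functions on the disc that occur are all
    quotients of polynomials. The Schwarz lemma comes from Blaschke factors, Hurwitz's theorem from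
    a Harnack inequality proved factor by factor, and the Poisson formula, which in turn yields the
    maximum principle, from uniform polynomial approximation on the closed disc. The obstacle is
    that [p] may vanish on the torus. A slice in [z1] with [z2] in the open disc does not see these
    zeros. A fiber over a point of the circle may, but coprimality confines the bad base points to
    the roots of one polynomial, to which [tau0] and the [tau k] are added. Near these points the
    densities [1 / |drif2|] cannot be bounded by continuity; the bound is read off the fiber formula
    at [z2 = 0], where all Poisson kernels equal 1. Density is explicit too: over roots of unity,
    sums of Poisson kernels are computable geometric series. *)

(** * Roots of polynomials over an algebraically closed field *)

Section ClosedFieldPolynomials.
Variable K : numClosedFieldType.
Implicit Types (q : {poly K}) (z w rho : K).

Definition zero_free_disc q := forall z, `|z| < 1 -> q.[z] != 0.
Definition zero_free_cdisc q := forall z, `|z| <= 1 -> q.[z] != 0.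

Lemma poly_split q :
  exists rs : seq K, q = lead_coef q *: \prod_(r <- rs) ('X - r%:P) /\
    (forall r, r \in rs -> root q r) /\ (q != 0 -> size q = (size rs).+1).
Proof.
have [rs q_rs] := closed_field_poly_normal q.
exists rs; split=> //; split=> [r r_rs|q_neq0].
  rewrite q_rs rootE hornerZ horner_prod (big_rem r)//=.
  by rewrite hornerXsubC subrr mul0r mulr0.
by rewrite q_rs size_scale ?lead_coef_eq0// size_prod_XsubC.
Qed.

Lemma disc_roots_ge1 q (rs : seq K) : zero_free_disc q ->
  (forall r, r \in rs -> root q r) -> forall r, r \in rs -> 1 <= `|r|.
Proof.
move=> zfq rs_root r /rs_root; rewrite real_leNgt ?normr_real ?real1// => qr.
by apply/negP => /zfq; rewrite -rootE qr.
Qed.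

Lemma zero_free_neq0 q : zero_free_disc q -> q != 0.
Proof.
move=> zfq; apply: contraNneq (zfq 0 _) => [->|]; rewrite ?horner0//.
by rewrite normr0.
Qed.

Lemma poly_eq0_seq q (f : nat -> K) :
  injective f -> (forall k, root q (f k)) -> q = 0.
Proof.
move=> f_inj qf; apply/eqP; apply: contraT => q_neq0.
have := @max_poly_roots _ q [seq f k | k <- iota 0 (size q)] q_neq0.
rewrite size_map size_iota ltnn; apply.
  by apply/allP => _ /mapP[k _ ->].
by rewrite map_inj_uniq// iota_uniq.
Qed.

Lemma poly_eq0_disc q : (forall z, `|z| < 1 -> q.[z] = 0) -> q = 0.
Proof.
move=> q0; apply: (@poly_eq0_seq q (fun k => (k.+2%:R)^-1)) => [i j|k].
  by move=> /invr_inj/eqP; rewrite eqr_nat => /eqP[].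
by apply/rootP/q0; rewrite normfV normr_nat invf_lt1 ?ltr0n// ltr1n.
Qed.

(** The denominator of the Cayley transform [(k + i) / (k - i)], which supplies infinitely many
    points of the unit circle of an abstract [K]. *)
Lemma circle_param_neq0 (k : nat) : (k%:R - 'i : K) != 0.
Proof.
apply/negP => /eqP/(congr1 (fun z => 'Im z)); rewrite raddfB /= Im_i raddf0.
by rewrite (Creal_ImP _ (realn K k)) sub0r => /eqP; rewrite oppr_eq0 oner_eq0.
Qed.

Lemma poly_eq0_circle q : (forall z, `|z| = 1 -> q.[z] = 0) -> q = 0.
Proof.
move=> q0; apply: (@poly_eq0_seq q (fun k => (k%:R + 'i) / (k%:R - 'i))).
  move=> i j /eqP; rewrite eqr_div ?circle_param_neq0// => /eqP ij.
  have : 2 * 'i * (j%:R - i%:R) = 0 :> K.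
    move/eqP: ij; rewrite -subr_eq0 => /eqP; set lhs := (X in X = 0).
    by move=> ij; rewrite -ij /lhs; ring.
  move/eqP; rewrite !mulf_eq0 pnatr_eq0 (negPf (neq0Ci _)) /= subr_eq0 eqr_nat.
  by move=> /eqP.
move=> k; apply/rootP/q0; rewrite normf_div.
have -> : k%:R + 'i = (k%:R - 'i : K)^*.
  by rewrite rmorphB /= conjCi conjC_nat opprK.
by rewrite norm_conjC divff// normr_eq0 circle_param_neq0.
Qed.

(* A zero-free polynomial satisfies a Harnack inequality factor by factor, since
   [|z - rho| <= |w - rho| + 2] and [|w - rho| >= 1 - |w|]. *)
Lemma harnack_disc (N : nat) q z w : zero_free_disc q -> (size q <= N.+1)%N ->
  `|z| <= 1 -> `|w| < 1 ->
  `|q.[z]| <= `|q.[w]| * (1 + 2 / (1 - `|w|)) ^+ N.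
Proof.
move=> zfq szq z1 w1.
have q_neq0 := zero_free_neq0 zfq.
have [rs [q_rs [rs_root /(_ q_neq0) szrs]]] := poly_split q.
have w1' : 0 < 1 - `|w| by rewrite subr_gt0.
set c := 1 + 2 / _.
have c1 : 1 <= c by rewrite lerDl divr_ge0 ?ltW.
(* As [c >= 1], the number of roots can be raised to [N]; [hurwitz] needs one exponent for
   polynomials whose degree may vary. *)
apply: (@le_trans _ _ (`|q.[w]| * c ^+ size rs)); last first.
  by rewrite ler_wpM2l// ler_weXn2l// -ltnS -szrs.
have rs1 := disc_roots_ge1 zfq rs_root.
rewrite q_rs !hornerZ !normrM -mulrA ler_wpM2l// !horner_prod.
elim: rs rs1 {q_rs rs_root szrs} => [|r rs IH] rs1.
  by rewrite !big_nil mulr1.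
rewrite !big_cons !normrM !hornerXsubC /= exprS mulrACA ler_pM//; last first.
  by apply: IH => x xrs; rewrite rs1// inE xrs orbT.
have wr : 1 - `|w| <= `|w - r|.
  by rewrite distrC (le_trans _ (lerB_dist _ _))// lerB// rs1// mem_head.
have -> : z - r = (z - w) + (w - r) by rewrite addrA subrK.
rewrite (le_trans (ler_normD _ _))// mulrDr mulr1 addrC lerD2l.
rewrite (@le_trans _ _ 2)//.
  by rewrite (le_trans (ler_normB _ _))// -[2]/(1 + 1) lerD// ltW.
by rewrite mulrCA ler_peMr// ler_pdivlMr ?mul1r.
Qed.

End ClosedFieldPolynomials.

(** * Reflection in one variable and the Schwarz lemma *)

Section ReflectedPolynomial.
Variable K : numClosedFieldType.
Implicit Types (q : {poly K}) (z w rho : K).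

(** [reflE] inverts [z], so identities between reflections are first obtained at nonzero points
    only. *)
Lemma poly_eq_off0 q1 q2 : (forall z, z != 0 -> q1.[z] = q2.[z]) -> q1 = q2.
Proof.
move=> q12; apply/eqP; rewrite -subr_eq0; apply/eqP.
apply: (@poly_eq0_seq _ _ (fun k => k.+1%:R)) => [i j|k].
  by move=> /eqP; rewrite eqr_nat => /eqP[].
by apply/rootP; rewrite hornerD hornerN q12 ?subrr// pnatr_eq0.
Qed.

(** [n] is a formal degree: a fiber of [p] may have smaller degree than [p], and its reflection then
    vanishes at 0. *)
Definition refl (n : nat) q := \poly_(j < n.+1) (q`_(n - j))^*.

Lemma reflE n q z : (size q <= n.+1)%N -> z != 0 ->
  (refl n q).[z] = z ^+ n * (q.[(z^*)^-1])^*.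
Proof.
move=> szq z_neq0; rewrite (horner_coef_wide _ (size_poly _ _)).
rewrite (horner_coef_wide _ szq) rmorph_sum mulr_sumr.
rewrite (reindex_inj rev_ord_inj); apply: eq_bigr => j _.
have le_jn : (j <= n)%N by rewrite -ltnS.
rewrite /= subSS coef_poly ltnS leq_subr subKn// rmorphM rmorphXn fmorphV /=.
by rewrite conjCK exprVn expfB_cond ?(negPf z_neq0)// [RHS]mulrCA.
Qed.

Lemma invC_circle z : `|z| = 1 -> (z^*)^-1 = z.
Proof.
by move=> z1; rewrite invC_norm norm_conjC z1 conjCK expr1n invr1 mul1r.
Qed.

Lemma circle_neq0 z : `|z| = 1 -> z != 0.
Proof. by move=> z1; rewrite -normr_eq0 z1 oner_eq0. Qed.

Lemma refl_circle n q z : (size q <= n.+1)%N -> `|z| = 1 ->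
  (refl n q).[z] = z ^+ n * (q.[z])^*.
Proof.
by move=> szq z1; rewrite reflE ?circle_neq0// invC_circle.
Qed.

Lemma normr_refl_circle n q z : (size q <= n.+1)%N -> `|z| = 1 ->
  `|(refl n q).[z]| = `|q.[z]|.
Proof.
by move=> szq z1; rewrite refl_circle// normrM normrX z1 expr1n mul1r norm_conjC.
Qed.

(** Divided by the polynomial itself, this exhibits the reflection quotient as a power of ['X] times
    Blaschke factors, up to a constant. *)
Lemma refl_split n c (rs : seq K) : (size rs <= n)%N ->
  refl n (c *: \prod_(r <- rs) ('X - r%:P)) =
  'X^(n - size rs) * (c^* *: \prod_(r <- rs) (1 - r^* *: 'X)).
Proof.
move=> szrs; apply: poly_eq_off0 => z z_neq0; rewrite reflE//; last first.
  by rewrite (leq_trans (size_scale_leq _ _))// size_prod_XsubC.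
rewrite hornerM !hornerZ hornerXn !horner_prod rmorphM /= rmorph_prod /=.
rewrite mulrCA [RHS]mulrCA; congr (_ * _).
rewrite -{1}(subnK szrs) exprD -mulrA; congr (_ * _).
elim: rs {szrs} => [|r rs IH]; first by rewrite !big_nil mulr1.
rewrite !big_cons exprS mulrACA IH; congr (_ * _).
rewrite !hornerE /= rmorphB fmorphV /= conjCK mulrBr divff//.
by rewrite [r^* * z]mulrC.
Qed.

(* [|z - rho|^2 - |1 - rho^* z|^2 = (1 - |z|^2) (|rho|^2 - 1)] *)
Lemma blaschke_id z rho : `|z - rho| ^+ 2 - `|1 - rho^* * z| ^+ 2 =
  (1 - `|z| ^+ 2) * (`|rho| ^+ 2 - 1).
Proof.
rewrite !normCK !rmorphB !rmorphM /= conjCK rmorph1; ring.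
Qed.

Lemma blaschke_le z rho : `|z| < 1 -> 1 <= `|rho| ->
  `|1 - rho^* * z| <= `|z - rho| /\
  (`|1 - rho^* * z| = `|z - rho| -> `|rho| = 1).
Proof.
move=> z1 rho1.
have z2 : 0 < 1 - `|z| ^+ 2 by rewrite subr_gt0 expr_lt1.
have r2 : 0 <= `|rho| ^+ 2 - 1 by rewrite subr_ge0 exprn_ege1.
split.
  rewrite -(@ler_pXn2r _ 2)// ?nnegrE// -subr_ge0 blaschke_id.
  by rewrite mulr_ge0// ltW.
move=> E; have := blaschke_id z rho; rewrite E subrr => /esym/eqP.
by rewrite mulf_eq0 (gt_eqF z2) /= subr_eq0 pexpr_eq1//= => /eqP.
Qed.

(** The factorwise bounds multiply, and since all factors on the larger side are positive, equality
    of the products forces equality in each factor. *)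
Lemma prod_blaschke_le z (rs : seq K) : `|z| < 1 ->
  (forall r, r \in rs -> 1 <= `|r|) ->
  [/\ 0 < \prod_(r <- rs) `|z - r|,
   \prod_(r <- rs) `|1 - r^* * z| <= \prod_(r <- rs) `|z - r| &
   \prod_(r <- rs) `|1 - r^* * z| = \prod_(r <- rs) `|z - r| ->
   forall r, r \in rs -> `|r| = 1].
Proof.
move=> z1; elim: rs => [|r rs IH] rs1; first by rewrite !big_nil.
have {IH} [|pos le eq] := IH.
  by move=> x xrs; rewrite rs1// inE xrs orbT.
have [ler eqr] := blaschke_le z1 (rs1 _ (mem_head _ _)).
have posr : 0 < `|z - r|.
  rewrite normr_gt0 subr_eq0; apply: contraTneq z1 => ->.
  by rewrite -real_leNgt ?normr_real ?real1// rs1// mem_head.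
rewrite !big_cons; split; first by rewrite mulr_gt0.
  by rewrite ler_pM// prodr_ge0.
move=> E.
have E1 : `|1 - r^* * z| = `|z - r|.
  apply/le_anti; rewrite ler/= -(ler_pM2r pos) -E ler_wpM2l//.
have E2 : \prod_(r <- rs) `|1 - r^* * z| = \prod_(r <- rs) `|z - r|.
  by move: E; rewrite E1; apply: mulfI; rewrite gt_eqF.
move=> x; rewrite inE => /orP[/eqP ->|]; last exact: eq.
exact: eqr.
Qed.

Lemma refl_schwarz n q z : zero_free_disc q -> (size q <= n.+1)%N ->
  `|z| < 1 -> `|(refl n q).[z]| <= `|q.[z]|.
Proof.
move=> zfq szq z1; have q_neq0 := zero_free_neq0 zfq.
have [rs [q_rs [rs_root /(_ q_neq0) szrs]]] := poly_split q.
have rs1 := disc_roots_ge1 zfq rs_root.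
have [pos le _] := prod_blaschke_le z1 rs1.
rewrite szrs ltnS in szq.
rewrite q_rs refl_split// !(hornerM, hornerZ) hornerXn !horner_prod.
rewrite !normrM norm_conjC normrX !normr_prod mulrCA ler_wpM2l//.
under eq_bigr do rewrite !hornerE.
under [leRHS]eq_bigr do rewrite !hornerE.
by rewrite (le_trans _ le)// ler_piMl ?prodr_ge0// exprn_ile1// ltW.
Qed.

(** Equality at one interior point leaves no room in any Blaschke factor: all roots lie on the
    circle, where [1 - r^* *: 'X] is a multiple of ['X - r%:P], and no power of ['X] remains. *)
Lemma refl_schwarz_eq n q z : zero_free_disc q -> (size q <= n.+1)%N ->
  `|z| < 1 -> `|(refl n q).[z]| = `|q.[z]| -> exists u, refl n q = u *: q.
Proof.
move=> zfq szq z1; have q_neq0 := zero_free_neq0 zfq.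
have [rs [q_rs [rs_root /(_ q_neq0) szrs]]] := poly_split q.
have rs1 := disc_roots_ge1 zfq rs_root.
have c_neq0 : lead_coef q != 0 by rewrite lead_coef_eq0.
move: q_rs c_neq0; move: (lead_coef q) => c q_rs c_neq0.
have [pos le eq] := prod_blaschke_le z1 rs1.
rewrite szrs ltnS in szq.
rewrite {1 2}q_rs refl_split// !(hornerM, hornerZ) hornerXn !horner_prod.
rewrite !normrM norm_conjC normrX !normr_prod mulrCA.
under eq_bigr do rewrite !hornerE.
under [in X in _ = X -> _]eq_bigr do rewrite !hornerE.
move=> /(mulfI _); rewrite normr_eq0 => /(_ c_neq0) E.
have E1 : `|z| ^+ (n - size rs) = 1.
  apply/le_anti; rewrite exprn_ile1 ?(ltW z1)//=.
  by rewrite -(ler_pM2r pos) mul1r -{1}E ler_wpM2l// exprn_ge0.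
have n_rs : (n - size rs)%N = 0%N.
  by apply/eqP; move/eqP: E1; rewrite pexprn_eq1// (lt_eqF z1) orbF.
rewrite n_rs expr0 mul1r in E; have {}eq := eq E.
exists (c^* * (\prod_(r <- rs) (- r^*)) / c).
rewrite {1}q_rs refl_split// n_rs expr0 mul1r [in RHS]q_rs scalerA.
rewrite divfK// -scalerA; congr (_ *: _).
elim: rs eq {q_rs rs_root szrs rs1 pos le szq E E1 n_rs} => [|r rs IH] eq.
  by rewrite !big_nil scale1r.
rewrite !big_cons IH; last by move=> x xrs; rewrite eq// inE xrs orbT.
have r1 : r^* * r = 1 by rewrite mulrC -normCK eq ?mem_head// expr1n.
have -> : 1 - r^* *: 'X = - r^* *: ('X - r%:P).
  rewrite scalerBr scaleNr -[_ *: r%:P]mul_polyC -polyCM mulNr r1 polyCN opprK.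
  by rewrite addrC.
by rewrite -scalerAl -scalerAr scalerA.
Qed.

End ReflectedPolynomial.

(** * Points where a reflection quotient takes a unimodular value *)

Section BoundaryRoots.
Variable K : numClosedFieldType.
Implicit Types (q : {poly K}) (z w rho : K).

(** No root lies inside, since a value of modulus 1 in the disc makes the quotient constant;
    [z -> 1 / z^*] sends a root outside to one inside. The degree cannot drop, because the
    coefficient of index [n] vanishes only together with the value at 0. *)
Lemma boundary_roots n q alpha : zero_free_disc q -> (size q <= n.+1)%N ->
    `|alpha| = 1 -> refl n q <> alpha *: q ->
  [/\ zero_free_disc (alpha *: q - refl n q),
      forall z, (alpha *: q - refl n q).[z] = 0 -> `|z| = 1 &
      size (alpha *: q - refl n q) = n.+1].
Proof.
move=> zfq szq alpha1 q_alpha; set D := _ - _.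
have alphaV : alpha^* * alpha = 1 by rewrite mulrC -normCK alpha1 expr1n.
have DE z : D.[z] = 0 -> (refl n q).[z] = alpha * q.[z].
  by move=> /eqP; rewrite hornerD hornerN hornerZ subr_eq0 => /eqP.
have D_disc : zero_free_disc D.
  move=> z z1; apply/eqP => /DE E.
  have [|u qu] := refl_schwarz_eq zfq szq z1.
    by rewrite E normrM alpha1 mul1r.
  apply: q_alpha; rewrite qu; congr (_ *: _); apply: (mulIf (zfq _ z1)).
  by rewrite -E qu hornerZ.
split=> //.
  move=> z Dz; case: (real_ltgtP (normr_real z) (@real1 K)) => // z1.
    by have := D_disc _ z1; rewrite Dz eqxx.
  have z_neq0 : z != 0 by rewrite -normr_gt0 (lt_trans _ z1).
  have [w wC] : exists w, w^* = z^-1 by exists (z^-1)^*; rewrite conjCK.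
  have zw : (z^*)^-1 = w by rewrite -[w]conjCK wC fmorphV.
  have w1 : `|w| < 1 by rewrite -norm_conjC wC normfV invf_lt1// normr_gt0.
  have w_neq0 : w != 0 by rewrite -conjC_eq0 wC invr_eq0.
  have := reflE szq z_neq0; rewrite (DE _ Dz) zw => E1.
  have := reflE szq w_neq0; rewrite wC invrK => E2.
  have := D_disc _ w1; rewrite hornerD hornerN hornerZ E2 subr_eq0 => /negP[].
  apply/eqP/(inv_inj conjCK); rewrite !rmorphM rmorphXn /= conjCK wC.
  apply: (mulfI (expf_neq0 n z_neq0)); rewrite mulrCA -E1 !mulrA alphaV mul1r.
  by rewrite exprVn divff ?expf_neq0// mul1r.
apply/eqP; rewrite eqn_leq; apply/andP; split.
  rewrite (leq_trans (size_polyD _ _))// geq_max size_polyN size_poly andbT.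
  exact: leq_trans (size_scale_leq _ _) szq.
rewrite ltnNge; apply/negP => szD.
have Dn : D`_n = 0 by rewrite nth_default.
have := D_disc 0; rewrite normr0 ltr01 => /(_ isT) /negP[]; apply/eqP.
move: Dn; rewrite horner_coef0 !coefB !coefZ !coef_poly ltnSn subnn subn0.
move=> /eqP; rewrite subr_eq0 => /eqP/(congr1 (fun x => x^*)).
rewrite rmorphM /= conjCK => <-.
by rewrite mulrA [alpha * _]mulrC alphaV mul1r subrr.
Qed.

Lemma uniq_simple_roots (rs : seq K) :
  (forall r, r \in rs -> (\prod_(x <- rs) ('X - x%:P))^`().[r] != 0) -> uniq rs.
Proof.
elim: rs => //= r rs IH; rewrite !big_cons => simple.
have deriv_cons x : (('X - r%:P) * \prod_(y <- rs) ('X - y%:P))^`().[x] =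
    (\prod_(y <- rs) ('X - y%:P)).[x] +
    (x - r) * (\prod_(y <- rs) ('X - y%:P))^`().[x].
  by rewrite derivM derivXsubC mul1r hornerD hornerM hornerXsubC.
have rsroot x : x \in rs -> (\prod_(y <- rs) ('X - y%:P)).[x] = 0.
  by move=> xrs; apply/eqP; rewrite -rootE root_prod_XsubC.
apply/andP; split.
  apply/negP => rrs; have := simple r (mem_head _ _).
  by rewrite deriv_cons rsroot// subrr mul0r addr0 eqxx.
apply: IH => x xrs; have := simple x; rewrite inE xrs orbT => /(_ isT).
by rewrite deriv_cons rsroot// add0r mulf_eq0 negb_or => /andP[].
Qed.

End BoundaryRoots.

(** * Common zeros of two bivariate polynomials *)

Section GenericFibers.
Variable K : numClosedFieldType.
Implicit Types (d p q b : {poly {poly K}}) (c : {poly K}) (t : K).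

(** Sets the inner variable to [t]. If [ev t d] is never 0 then [d] is primitive: no ['X - t%:P]
    divides all its coefficients. *)
Let ev t d := map_poly (horner_eval t) d.

Lemma ev_eq0_factor t d : ev t d = 0 -> exists d', d = ('X - t%:P) *: d'.
Proof.
move=> d0; exists (map_poly (fun c => c %/ ('X - t%:P)) d).
apply/polyP => i; rewrite coefZ coef_map_id0 ?div0p//.
rewrite mulrC divpK// dvdp_XsubCl; apply/rootP.
by have /(congr1 (fun r : {poly K} => r`_i)) := d0; rewrite coef0 coef_map.
Qed.

(** Each linear factor taken out lowers the degree of the leading coefficient, so finitely many
    exhaust the content. *)
Lemma content_strip d : d != 0 ->
  exists c d', [/\ c != 0, d = c *: d' & forall t, ev t d' != 0].
Proof.
have [N] := ubnP (size (lead_coef d)); elim: N d => // N IH d szd d_neq0.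
have [prim|] := pselect (forall t, ev t d != 0).
  by exists 1, d; rewrite oner_neq0 scale1r; split.
move=> /existsNP[t /negP]; rewrite negbK => /eqP /ev_eq0_factor[d' d'E].
have d'_neq0 : d' != 0.
  by apply: contraNneq d_neq0 => d'0; rewrite d'E d'0 scaler0.
have [||c [e [c_neq0 eE prim]]] := IH d'; last 1 first.
- exists (('X - t%:P) * c), e; split=> //.
    by rewrite mulf_neq0// polyXsubC_eq0.
  by rewrite d'E eE scalerA.
- move: szd; rewrite d'E lead_coefZ size_monicM ?monicXsubC ?lead_coef_eq0//.
  by rewrite size_XsubC.
- by [].
Qed.

(* [%|] over [{poly {poly K}}] only provides [c *: p = b * d]; the factor [c] is
   removed one root at a time. *)
Lemma content_cancel c p b d : c != 0 -> c *: p = b * d ->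
  (forall t, ev t d != 0) -> exists b', p = b' * d.
Proof.
move=> + + prim; have [N] := ubnP (size c); elim: N c b => // N IH c b.
move=> szc c_neq0 cp.
have [c1|c1] := eqVneq (size c) 1.
  have /size_poly1P[k k_neq0 ck] : size c == 1 by rewrite c1.
  exists (k^-1%:P *: b); rewrite -scalerAl -cp ck scalerA -polyCM mulVf//.
  by rewrite scale1r.
have [t ct] := closed_rootP _ c1.
(* Gauss's lemma at one root [t] of [c]: the left side vanishes at [t], [d] does not, hence [b]
   does. *)
have evp : ev t b * ev t d = 0.
  rewrite -rmorphM /= -cp; apply/polyP => i; rewrite coef_map coefZ coef0.
  by rewrite /= /horner_eval hornerM (rootP ct) mul0r.
have /eqP := evp; rewrite mulf_eq0 (negPf (prim t)) orbF => /eqP.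
move=> /ev_eq0_factor[b' bE].
have /factor_theorem[c' c'E] := ct.
have c'_neq0 : c' != 0.
  by apply: contraNneq c_neq0 => c'0; rewrite c'E c'0 mul0r.
apply: (IH c' b') => //.
  by move: szc; rewrite c'E mulrC size_monicM ?monicXsubC// size_XsubC.
apply/eqP; rewrite -subr_eq0; apply/eqP.
have : ('X - t%:P) *: (c' *: p - b' * d) = 0.
  by rewrite scalerBr scalerA mulrC -c'E cp bE scalerAl subrr.
by move=> /eqP; rewrite -mul_polyC mulf_eq0 polyC_eq0 polyXsubC_eq0 => /eqP.
Qed.

(** The swap makes the coefficients polynomials in [z1]. If the gcd is constant in [z2], a Bezout
    combination is a nonzero polynomial in [z1] alone, which vanishes at every common zero;
    otherwise the primitive part of the gcd is a genuine common factor. *)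
Lemma common_zeros_finite p q : p != 0 ->
    (forall d a b, p = d * a -> q = d * b -> d \is a GRing.unit) ->
  exists2 r : {poly K}, r != 0 &
    forall x y, p.[x, y] = 0 -> q.[x, y] = 0 -> r.[x] = 0.
Proof.
move=> p_neq0 ncf; pose P := swapXY p; pose Q := swapXY q.
have [/Bezout_coprimepP[[u v]]|] := boolP (coprimep P Q).
  move=> /eqpP[[c1 c2] /andP[/= c1_neq0 c2_neq0]] E.
  exists c2 => // x y pxy qxy.
  have /(congr1 (fun e : {poly {poly K}} => e.[y, x])) := E.
  rewrite /= alg_polyC hornerC hornerZ hornerM => <-.
  rewrite hornerD !hornerM hornerD !hornerM /P /Q !horner2_swapXY pxy qxy.
  by rewrite !mulr0 addr0 mulr0.
rewrite coprimep_def => szd.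
have P_neq0 : P != 0 by rewrite swapXY_eq0.
have d_neq0 : gcdp P Q != 0 by rewrite gcdp_eq0 (negPf P_neq0).
have [c [d [c_neq0 dE prim]]] := content_strip d_neq0.
have cancel_d A : gcdp P Q %| A -> exists b, A = b * d.
  move=> /Pdiv.Idomain.dvdpP[[e B] /= e_neq0 E].
  apply: (content_cancel e_neq0 _ prim).
  by rewrite E dE -scalerAr scalerAl.
have [a aE] := cancel_d _ (dvdp_gcdl P Q).
have [b bE] := cancel_d _ (dvdp_gcdr P Q).
have d_unit : swapXY d \is a GRing.unit.
  apply: (ncf _ (swapXY a) (swapXY b)); rewrite -rmorphM /= mulrC.
    by rewrite -aE swapXYK.
  by rewrite -bE swapXYK.
(* A unit divides 1, hence has size 1, against [szd]. *)
have : d %| swapXY (swapXY d)^-1 * d by rewrite dvdp_mull.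
have /(congr1 swapXY) := mulVr d_unit; rewrite rmorphM rmorph1 /= swapXYK => ->.
by rewrite dvdp1 => szd1; move: szd; rewrite dE size_scale// szd1.
Qed.

End GenericFibers.

(** * Real parts, imaginary parts and moduli *)

Section ComplexBasics.
Variable R : realType.
Local Notation C := (C R).
Implicit Types (z w : C) (x y : R).

Lemma norm_normc z : `|z| = (normc z)%:C.
Proof. by []. Qed.

Lemma normc_Re z : normc z = Re `|z|.
Proof. by []. Qed.

Lemma normc_ge0 z : 0 <= normc z.
Proof. by rewrite -ler0c -norm_normc. Qed.

Lemma normc_sqr z : normc z ^+ 2 = Re z ^+ 2 + Im z ^+ 2.
Proof. by case: z => a b /=; rewrite sqr_sqrtr// addr_ge0// sqr_ge0. Qed.

Lemma normcM z w : normc (z * w) = normc z * normc w.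
Proof. exact: ComplexField.Normc.normcM. Qed.

Lemma normcV z : normc z^-1 = (normc z)^-1.
Proof. exact: ComplexField.Normc.normcV. Qed.

Lemma normc_lt1 z : `|z| < 1 -> normc z < 1.
Proof. by rewrite norm_normc -(rmorph1 (real_complex R)) ltcR. Qed.

Lemma normc_eq1 z : `|z| = 1 -> normc z = 1.
Proof. by rewrite normc_Re => ->. Qed.

Lemma normc_eq0 z : (normc z == 0) = (z == 0).
Proof. by rewrite -[RHS]normr_eq0 norm_normc eq_complex /= eqxx andbT. Qed.

Lemma cReD z w : Re (z + w) = Re z + Re w.
Proof. by case: z w => [a b] [c d]. Qed.

Lemma cImD z w : Im (z + w) = Im z + Im w.
Proof. by case: z w => [a b] [c d]. Qed.

Lemma cReN z : Re (- z) = - Re z.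
Proof. by case: z. Qed.

Lemma cImN z : Im (- z) = - Im z.
Proof. by case: z. Qed.

Lemma cReM z w : Re (z * w) = Re z * Re w - Im z * Im w.
Proof. by case: z w => [a b] [c d]. Qed.

Lemma cImM z w : Im (z * w) = Re z * Im w + Im z * Re w.
Proof. by case: z w => [a b] [c d] /=; rewrite [b * c]mulrC. Qed.

Lemma cReMr x z : Re (x%:C * z) = x * Re z.
Proof. by rewrite cReM /= mul0r subr0. Qed.

Lemma cImMr x z : Im (x%:C * z) = x * Im z.
Proof. by rewrite cImM /= mul0r addr0. Qed.

Lemma Re_sum (I : Type) (r : seq I) (P : pred I) (F : I -> C) :
  Re (\sum_(i <- r | P i) F i) = \sum_(i <- r | P i) Re (F i).
Proof. exact: (big_morph Re cReD (erefl _)). Qed.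

Lemma Im_sum (I : Type) (r : seq I) (P : pred I) (F : I -> C) :
  Im (\sum_(i <- r | P i) F i) = \sum_(i <- r | P i) Im (F i).
Proof. exact: (big_morph Im cImD (erefl _)). Qed.

Lemma Re_ge_normc z : `|Re z| <= normc z.
Proof. by rewrite -lecR -norm_normc; exact: normc_ge_Re. Qed.

Lemma cReJ z : Re z^*%R = Re z.
Proof. by case: z. Qed.

Lemma cImJ z : Im z^*%R = - Im z.
Proof. by case: z. Qed.

Lemma normr_ltR z x : (`|z| < x%:C) = (normc z < x).
Proof. by rewrite -ltcR. Qed.

Lemma normr_leR z x : (`|z| <= x%:C) = (normc z <= x).
Proof. by rewrite -lecR. Qed.

Lemma normcD_le z w : normc (z + w) <= normc z + normc w.
Proof. by rewrite -normr_leR rmorphD /= -!norm_normc ler_normD. Qed.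

Lemma gt0_RRe z : 0 < z -> z = (Re z)%:C /\ 0 < Re z.
Proof.
move=> z0; have zE : z = (Re z)%:C by rewrite RRe_real// gtr0_real.
by split=> //; move: z0; rewrite [in X in X -> _]zE -(rmorph0 (real_complex R)) ltcR.
Qed.

End ComplexBasics.

(** * Derivatives of polynomials and of their quotients *)

Section PolynomialCalculus.
Variable K : numFieldType.
Implicit Types (p q : {poly K}) (x : K).

Lemma is_derive_hornerK p x : is_derive x (1 : K) (horner p) p^`().[x].
Proof.
elim/poly_ind: p => [|p c IH].
  rewrite deriv0 horner0 (_ : horner 0 = cst 0); first exact: is_derive_cst.
  by apply/funext => y; rewrite horner0.
rewrite (_ : horner _ = (horner p) * id + cst c); last first.
  by apply/funext => y; rewrite !fctE !hornerE.
apply: is_derive_eq.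
rewrite derivD derivM derivX derivC !hornerE /=.
by rewrite /GRing.scale /= mulr1 addrC mulrC.
Qed.

Lemma continuous_hornerK p : continuous (horner p).
Proof.
move=> x; apply/differentiable_continuous/derivable1_diffP.
by have [] := is_derive_hornerK p x.
Qed.

Lemma derive1_ratio p q x : q.[x] != 0 ->
  derive1 (fun w => p.[w] / q.[w]) x =
  (p^`().[x] * q.[x] - p.[x] * q^`().[x]) / q.[x] ^+ 2.
Proof.
move=> qx; rewrite derive1E (_ : (fun w => _) = horner p * (fun w => (q.[w])^-1))//.
have [dp pE] := is_derive_hornerK p x; have [dq qE] := is_derive_hornerK q x.
have dqV : derivable (fun w => (q.[w])^-1) x 1 by exact: derivableV.
rewrite (deriveM dp dqV) deriveV// pE qE /GRing.scale /=; field; exact: qx.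
Qed.

End PolynomialCalculus.

(** * Topology of the complex plane and the angle parametrization *)

Section ComplexTopology.
Variable R : realType.
Local Notation C := (C R).
Implicit Types (z w : C) (x y : R).

#[global] Instance nbhs_C_filter z : ProperFilter (nbhs z).
Proof. exact: nbhs_pfilter. Qed.

Lemma continuous_Re : continuous (Re : C -> R).
Proof.
move=> z; apply/cvgrPdist_lt => e e0; near=> w.
rewrite -cReN -cReD (le_lt_trans (Re_ge_normc _))// -normr_ltR.
near: w; apply: (nbhsx_ballx z e%:C).
by rewrite -(rmorph0 (real_complex R)) ltcR.
Unshelve. all: by end_near. Qed.

Lemma continuous_Im : continuous (Im : C -> R).
Proof.
have ImE : (Im : C -> R) = (Re : C -> R) \o ( *%R (- 'i%C)).
  by apply/funext => -[a b] /=; rewrite oppr0 mul0r mulN1r opprK add0r.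
rewrite ImE => z; apply: continuous_comp; last exact: continuous_Re.
exact: mulrl_continuous.
Qed.

Lemma continuous_real_complex : continuous (fun x => x%:C : C).
Proof.
move=> x; apply/cvgrPdist_lt => e e0.
have [eE Re0] := gt0_RRe e0.
near=> y; rewrite -rmorphB eE normr_ltR.
rewrite /= expr0n addr0 sqrtr_sqr.
by near: y; exact: (nbhsx_ballx x (Re e)).
Unshelve. all: by end_near. Qed.

Lemma cvg_complex (T : Type) (F : set_system T) {FF : Filter F} (f g : T -> R) x y :
  f @ F --> x -> g @ F --> y -> (f t +i* g t : C) @[t --> F] --> (x +i* y : C).
Proof.
move=> fx gy.
have E a b : (a +i* b : C) = a%:C + 'i%C * b%:C.
  by apply/eqP; rewrite eq_complex /= !(mul0r,mulr0,mul1r,subr0,addr0,add0r) !eqxx.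
rewrite E (_ : (fun t => _) = (fun t => (f t)%:C + 'i%C * (g t)%:C : C)); last first.
  by apply/funext => t; rewrite E.
apply: cvgD; first by apply: continuous_cvg => //; exact: continuous_real_complex.
apply: cvgMr; apply: continuous_cvg => //; exact: continuous_real_complex.
Qed.

Lemma continuous_expi : continuous (@expi R).
Proof.
by move=> t; apply: cvg_complex; [exact: continuous_cos|exact: continuous_sin].
Qed.

Lemma normr_expi t : `|expi t : C| = 1.
Proof. by rewrite norm_normc /= cos2Dsin2 sqrtr1. Qed.

Lemma expi_surj z : `|z| = 1 -> exists2 t, t \in `[0, 2 * pi] & z = expi t.
Proof.
case: z => a b z1.
have ab : a ^+ 2 + b ^+ 2 = 1.
  by have := normc_sqr (a +i* b : C); rewrite (normc_eq1 z1) expr1n => <-.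
have a1 : -1 <= a <= 1.
  by rewrite -ler_norml -(@expr_le1 _ 2)// real_normK ?num_real// -ab lerDl sqr_ge0.
have cosa : cos (acos a) = a by rewrite acosK.
have sina : sin (acos a) = `|b|.
  by rewrite sin_acos// -ab addrC addKr sqrtr_sqr.
have [b0|b0] := leP 0 b.
  exists (acos a).
    rewrite in_itv /= acos_ge0//= (le_trans (acos_lepi a1))// ler_peMl ?pi_ge0//.
    by rewrite ler1n.
  by rewrite /expi cosa sina ger0_norm.
exists (2 * pi - acos a).
  rewrite in_itv /= subr_ge0 gerBl acos_ge0// andbT.
  by rewrite (le_trans (acos_lepi a1))// ler_peMl ?pi_ge0// ler1n.
rewrite /expi -[2 * pi - _]/(2 * pi + - acos a) addrC mulr_natl.
by rewrite cosD2pi sinD2pi cosN sinN cosa sina ltr0_norm// opprK.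
Qed.

Section Limits.
Context {T : Type} {F : set_system T} {FF : Filter F}.

Lemma cvg_real_complex (f : T -> R) x :
  f @ F --> x -> ((f t)%:C : C) @[t --> F] --> (x%:C : C).
Proof. by move=> fx; apply: continuous_cvg fx; exact: continuous_real_complex. Qed.

Lemma cvg_Re (f : T -> C) z : f @ F --> z -> Re (f t) @[t --> F] --> Re z.
Proof. by move=> fz; apply: continuous_cvg fz; exact: continuous_Re. Qed.

Lemma cvg_Im (f : T -> C) z : f @ F --> z -> Im (f t) @[t --> F] --> Im z.
Proof. by move=> fz; apply: continuous_cvg fz; exact: continuous_Im. Qed.

Lemma cvg_normc (f : T -> C) z : f @ F --> z -> normc (f t) @[t --> F] --> normc z.
Proof. by move=> fz; exact: (cvg_Re (cvg_norm fz)). Qed.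

Lemma cvg_horner (p : {poly C}) (f : T -> C) z :
  f @ F --> z -> p.[f t] @[t --> F] --> p.[z].
Proof. by move=> fz; apply: continuous_cvg fz; exact: continuous_hornerK. Qed.

Lemma cvg_horner2 (P : {poly {poly C}}) (f g : T -> C) z w :
  f @ F --> z -> g @ F --> w -> P.[f t, g t] @[t --> F] --> P.[z, w].
Proof.
move=> fz gw; elim/poly_ind: P => [|P c IH].
  by under eq_fun do rewrite !horner0; rewrite !horner0; exact: cvg_cst.
have E (x y : C) : (P * 'X + c%:P).[x, y] = P.[x, y] * x + c.[y] :> C.
  by rewrite hornerMXaddC hornerD hornerM hornerC.
rewrite E (_ : (fun t => _) = (fun t => P.[f t, g t] * f t + c.[g t])); last first.
  by apply/funext => t; rewrite E.
exact: (cvgD (cvgM IH fz) (cvg_horner (p := c) gw)).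
Qed.

End Limits.

Lemma continuous_horner2l (P : {poly {poly C}}) w :
  continuous (fun z : C => P.[z, w] : C).
Proof.
move=> z; apply: (@cvg_horner2 C (nbhs z) _ P id (cst w)).
  exact: cvg_id.
exact: cvg_cst.
Qed.

End ComplexTopology.

(** * Limits of zero-free polynomials *)

Section Hurwitz.
Variable R : realType.
Local Notation C := (C R).
Implicit Types (z w t : C) (P : {poly {poly C}}).

Lemma closure_path (T : topologicalType) (A : set T) (f : R -> T) (a : R) :
  {for a, continuous f} -> (\forall e \near a^'+, A (f e)) -> closure A (f a).
Proof.
move=> fa Af B /fa; rewrite nbhs_filterE /= => Bf.
have {}Bf : \forall e \near a^'+, B (f e) by exact: cvg_within Bf.
near a^'+ => e; exists (f e); split; near: e; [exact: Af|exact: Bf].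
Unshelve. all: by end_near. Qed.

Lemma closure_disc t : `|t| = 1 -> closure [set x : C | `|x| < 1] t.
Proof.
move=> t1.
have ft : {for 0%R, continuous (fun e : R => ((1 - e)%:C : C) * t)}.
  apply: cvgMl; apply: cvg_real_complex.
  by apply: cvgB; [exact: cvg_cst|exact: cvg_id].
have := @closure_path _ [set x : C | `|x| < 1] _ _ ft; rewrite subr0 mul1r; apply.
near=> e; rewrite /= normrM t1 mulr1 -(rmorph1 (real_complex R)) normr_ltR /=.
rewrite expr0n addr0 sqrtr_sqr ger0_norm ?subr_ge0; last first.
  by near: e; apply: nbhs_right_le; exact: ltr01.
by rewrite ltrBlDr ltrDl; near: e; exact: nbhs_right_gt.
Unshelve. all: by end_near. Qed.

Lemma ge0_closure (T : topologicalType) (A : set T) (g : T -> R) (t : T) :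
  closure A t -> {for t, continuous g} -> (forall x, A x -> 0 <= g x) -> 0 <= g t.
Proof.
move=> At gt gA; rewrite leNgt; apply/negP => gt0.
have : \forall x \near t, g x < 0 by exact: (cvgr_lt _ gt).
by move=> /At[x [/gA Ax /=]]; rewrite ltNge Ax.
Qed.

(* Hurwitz's theorem, with the Harnack inequality passed to the limit. *)
Lemma hurwitz P t w : closure [set x : C | zero_free_disc P.[x%:P]] t ->
  `|w| < 1 -> P.[t, w] = 0 -> P.[t%:P] = 0.
Proof.
move=> tP w1 Ptw; apply: poly_eq0_disc => z z1.
(* [sizeY P] bounds the size of every [P.[x%:P]], so that [c] does not depend on [x]. *)
pose c := (1 + 2 / (1 - `|w|)) ^+ sizeY P.
(* Harnack's inequality reads [0 <= g x] where [P.[x%:P]] is zero-free; by continuity it holds at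
   [t], where the first term is 0. *)
pose g x := Re c * normc P.[x, w] - normc P.[x, z].
have w1' : 0 < 1 - `|w| by rewrite subr_gt0.
have cE : c = (Re c)%:C.
  rewrite RRe_real// ger0_real// exprn_ge0// addr_ge0// divr_ge0//; exact: ltW.
have gt : {for t, continuous g}.
  rewrite /g; apply: cvgB; last first.
    by apply: cvg_normc; exact: continuous_horner2l.
  by apply: cvgMr; apply: cvg_normc; exact: continuous_horner2l.
have : 0 <= g t.
  apply: ge0_closure tP gt _ => x /= Px; rewrite subr_ge0 -normr_leR rmorphM /=.
  rewrite -norm_normc -cE mulrC harnack_disc// ?(ltW z1)//.
  by rewrite (leq_trans (max_size_evalC _ _)).
rewrite /g Ptw normc_Re normr0 /= mulr0 sub0r oppr_ge0 => Ptz.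
by apply/eqP; rewrite -normc_eq0 eq_le Ptz normc_ge0.
Qed.

End Hurwitz.

(** * Integration of complex-valued functions *)

Section ComplexIntegral.
Context d (T : measurableType d) (R : realType).
Variables (mu : {measure set T -> \bar R}) (D : set T).
Hypothesis mD : measurable D.
Local Notation C := (C R).
Implicit Types (f g : T -> C) (c : C).

Lemma cintegrableD f g : cintegrable mu D f -> cintegrable mu D g ->
  cintegrable mu D (fun x => f x + g x).
Proof.
move=> [rf jf] [rg jg]; split.
  under eq_fun do rewrite cReD EFinD; exact: integrableD.
under eq_fun do rewrite cImD EFinD; exact: integrableD.
Qed.

Lemma cintegralD f g : cintegrable mu D f -> cintegrable mu D g ->
  cintegral mu D (fun x => f x + g x) = cintegral mu D f + cintegral mu D g.
Proof.
move=> [rf jf] [rg jg]; apply/eqP; rewrite eq_complex /=; apply/andP; split.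
  under eq_Rintegral do rewrite cReD; apply/eqP; exact: RintegralD.
under eq_Rintegral do rewrite cImD; apply/eqP; exact: RintegralD.
Qed.

Lemma integrable_lincomb (h k : T -> R) a b :
  mu.-integrable D (EFin \o h) -> mu.-integrable D (EFin \o k) ->
  mu.-integrable D (EFin \o (fun x => a * h x + b * k x)).
Proof.
move=> ih ik.
rewrite (_ : _ \o _ = (fun x => a%:E * (EFin \o h) x + b%:E * (EFin \o k) x)%E)//.
by apply: integrableD => //; exact: integrableZl.
Qed.

Lemma Rintegral_lincomb (h k : T -> R) a b :
  mu.-integrable D (EFin \o h) -> mu.-integrable D (EFin \o k) ->
  \int[mu]_(x in D) (a * h x + b * k x) =
  a * \int[mu]_(x in D) h x + b * \int[mu]_(x in D) k x.
Proof.
move=> ih ik; rewrite RintegralD//; first by rewrite !RintegralZl.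
  rewrite (_ : _ \o _ = (fun x => a%:E * (EFin \o h) x)%E)//; exact: integrableZl.
rewrite (_ : _ \o _ = (fun x => b%:E * (EFin \o k) x)%E)//; exact: integrableZl.
Qed.

Lemma ReZ c f x : Re (c * f x) = Re c * Re (f x) + (- Im c) * Im (f x).
Proof. by rewrite cReM mulNr. Qed.

Lemma ImZ c f x : Im (c * f x) = Im c * Re (f x) + Re c * Im (f x).
Proof. by rewrite cImM addrC. Qed.

Lemma cintegrableZ c f : cintegrable mu D f ->
  cintegrable mu D (fun x => c * f x).
Proof.
move=> [rf jf]; split.
  under eq_fun do rewrite ReZ; exact: integrable_lincomb.
under eq_fun do rewrite ImZ; exact: integrable_lincomb.
Qed.

Lemma cintegralZ c f : cintegrable mu D f ->
  cintegral mu D (fun x => c * f x) = c * cintegral mu D f.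
Proof.
move=> [rf jf]; apply/eqP; rewrite eq_complex cReM cImM /=; apply/andP; split.
  under eq_Rintegral do rewrite ReZ.
  by apply/eqP; rewrite Rintegral_lincomb// mulNr.
under eq_Rintegral do rewrite ImZ.
by apply/eqP; rewrite Rintegral_lincomb// addrC.
Qed.

Lemma cintegrable_conj f : cintegrable mu D f ->
  cintegrable mu D (fun x => (f x)^*).
Proof.
move=> [rf jf]; split; first by under eq_fun do rewrite cReJ.
by under eq_fun do rewrite cImJ EFinN; exact: integrableN.
Qed.

Lemma cintegral_conj f : cintegrable mu D f ->
  cintegral mu D (fun x => (f x)^*) = (cintegral mu D f)^*.
Proof.
move=> [rf jf]; apply/eqP; rewrite eq_complex cReJ cImJ /=; apply/andP; split.
  by under eq_Rintegral do rewrite cReJ.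
under eq_Rintegral do rewrite cImJ -mulN1r.
by rewrite RintegralZl// mulN1r.
Qed.

Lemma eq_cintegral f g : (forall x, D x -> f x = g x) ->
  cintegral mu D f = cintegral mu D g.
Proof.
move=> fg; rewrite /cintegral; congr Complex;
  by apply: eq_Rintegral => x /set_mem Dx; rewrite fg.
Qed.

End ComplexIntegral.

(** * Means over the circle *)

Section CircleIntegral.
Variable R : realType.
Local Notation C := (C R).
Local Notation leb := (@lebesgue_measure R).
Implicit Types (f g : C -> C) (c z : C) (h k : R -> R).

(** [circle_integral] splits into two such means, to which order and almost-everywhere arguments
    apply. *)
Definition avg h : R := (2 * pi)^-1 * \int[leb]_(t in `[0, 2 * pi]%classic) h t.

Definition avg_integrable h := leb.-integrable `[0, 2 * pi]%classic (EFin \o h).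

Lemma pi2_gt0 : 0 < 2 * pi :> R.
Proof. by rewrite mulr_gt0// pi_gt0. Qed.

Lemma avg_cst a : avg (fun=> a) = a.
Proof.
rewrite /avg Rintegral_cst//= lebesgue_measure_itv /= lte_fin pi2_gt0 /=.
by rewrite subr0 mulrCA mulVf ?mulr1// gt_eqF// pi2_gt0.
Qed.

Lemma avg_lincomb a b h k : avg_integrable h -> avg_integrable k ->
  avg (fun t => a * h t + b * k t) = a * avg h + b * avg k.
Proof.
move=> ih ik; rewrite /avg Rintegral_lincomb// mulrDr.
by congr (_ + _); rewrite mulrCA.
Qed.

Lemma avg_integrable_lincomb a b h k : avg_integrable h -> avg_integrable k ->
  avg_integrable (fun t => a * h t + b * k t).
Proof. by move=> ih ik; exact: integrable_lincomb. Qed.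

Lemma avgZ a h : avg_integrable h -> avg (fun t => a * h t) = a * avg h.
Proof. by move=> ih; rewrite /avg RintegralZl// mulrCA. Qed.

Lemma eq_avg h k : (forall t, h t = k t) -> avg h = avg k.
Proof. by move=> hk; congr (_ * _); apply: eq_Rintegral => t _. Qed.

Lemma le_avg h k : avg_integrable h -> avg_integrable k ->
  (forall t, h t <= k t) -> avg h <= avg k.
Proof.
move=> ih ik hk; rewrite /avg ler_pM2l ?invr_gt0 ?pi2_gt0//.
exact: le_Rintegral.
Qed.

Lemma avg_integrable_cst a : avg_integrable (fun=> a).
Proof.
apply: continuous_compact_integrable; first exact: segment_compact.
by apply: continuous_subspaceT => t; exact: cvg_cst.
Qed.

Lemma continuous_avg_integrable h : continuous h -> avg_integrable h.
Proof.
move=> ch; apply: continuous_compact_integrable; first exact: segment_compact.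
by apply: continuous_subspaceT => t; exact: ch.
Qed.

Lemma avg_dist_le h k e : avg_integrable h -> avg_integrable k ->
  (forall t, `|h t - k t| <= e) -> `|avg h - avg k| <= e.
Proof.
move=> ih ik hk.
have ihk : avg_integrable (fun t => 1 * h t + -1 * k t).
  exact: avg_integrable_lincomb.
have -> : avg h - avg k = avg (fun t => 1 * h t + -1 * k t).
  by rewrite avg_lincomb// mul1r mulN1r.
rewrite ler_norml -[X in - X]avg_cst -[X in _ && (_ <= X)]avg_cst.
have -> : - avg (fun=> e) = avg (fun=> - e) by rewrite !avg_cst.
by apply/andP; split; apply: le_avg => //; try exact: avg_integrable_cst;
  move=> t; have := hk t; rewrite mul1r mulN1r ler_norml => /andP[].
Qed.

(** Continuity in the angle only, so that nothing is asked of [f] off the circle. *)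
Definition circle_continuous f := continuous (fun t : R => f (expi t)).

Lemma circle_continuous_integrable f :
  circle_continuous f -> circle_integrable f.
Proof.
move=> cf; split; apply: continuous_avg_integrable => t.
  by apply: cvg_Re; exact: cf.
by apply: cvg_Im; exact: cf.
Qed.

Lemma Re_circle_integral f : Re (circle_integral f) = avg (fun t => Re (f (expi t))).
Proof. by rewrite /circle_integral cReMr. Qed.

Lemma Im_circle_integral f : Im (circle_integral f) = avg (fun t => Im (f (expi t))).
Proof. by rewrite /circle_integral cImMr. Qed.

Lemma circle_integralD f g : circle_integrable f -> circle_integrable g ->
  circle_integral (fun z => f z + g z) = circle_integral f + circle_integral g.
Proof. by move=> fi gi; rewrite /circle_integral cintegralD// mulrDr. Qed.

Lemma circle_integrableD f g : circle_integrable f -> circle_integrable g ->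
  circle_integrable (fun z => f z + g z).
Proof. by move=> fi gi; apply: cintegrableD. Qed.

Lemma circle_integrableZ c f : circle_integrable f ->
  circle_integrable (fun z => c * f z).
Proof. by move=> fi; exact: (@cintegrableZ _ _ _ _ _ _ c _ fi). Qed.

Lemma circle_integralZ c f : circle_integrable f ->
  circle_integral (fun z => c * f z) = c * circle_integral f.
Proof. by move=> fi; rewrite /circle_integral cintegralZ// mulrCA. Qed.

Lemma eq_circle_integral f g : (forall z, `|z| = 1 -> f z = g z) ->
  circle_integral f = circle_integral g.
Proof.
move=> fg; congr (_ * _); apply: eq_cintegral => t _.
by rewrite fg// normr_expi.
Qed.

Lemma circle_integral_conj f : circle_integrable f ->
  circle_integral (fun z => (f z)^*) = (circle_integral f)^*.
Proof.
move=> fi; rewrite /circle_integral cintegral_conj// rmorphM /=.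
congr (_ * _); apply/eqP; rewrite eq_complex cReJ cImJ /=.
by rewrite oppr0 !eqxx.
Qed.

Lemma expiD x y : expi (x + y) = expi x * expi y :> C.
Proof.
apply/eqP; rewrite eq_complex cReM cImM /= cosD sinD.
by rewrite [sin x * _ + _]addrC !eqxx.
Qed.

Lemma expi0 : expi 0 = 1 :> C.
Proof. by rewrite /expi cos0 sin0. Qed.

Lemma expi_pow (x : R) n : expi x ^+ n = expi (n%:R * x) :> C.
Proof.
elim: n => [|n IH]; first by rewrite expr0 mul0r expi0.
by rewrite exprS IH -expiD -natr1 mulrDl mul1r addrC.
Qed.

Lemma sin_2pi_nat n : sin (n%:R * (2 * pi)) = 0 :> R.
Proof.
elim: n => [|n IH]; first by rewrite mul0r sin0.
by rewrite -natr1 mulrDl mul1r [X in sin (_ + X)]mulr_natl sinD2pi IH.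
Qed.

Lemma cos_2pi_nat n : cos (n%:R * (2 * pi)) = 1 :> R.
Proof.
elim: n => [|n IH]; first by rewrite mul0r cos0.
by rewrite -natr1 mulrDl mul1r [X in cos (_ + X)]mulr_natl cosD2pi IH.
Qed.

Lemma avg_deriv (F f : R -> R) : (forall t, is_derive t (1 : R) F (f t)) ->
  continuous f -> F 0 = F (2 * pi) -> avg f = 0.
Proof.
move=> dF cf F0.
have cF : continuous F.
  by move=> t; apply/differentiable_continuous/derivable1_diffP; case: (dF t).
rewrite /avg /Rintegral (@continuous_FTC2 _ f F)//.
- by rewrite F0 subee// mulr0.
- exact: pi2_gt0.
- by apply: continuous_subspaceT => t; exact: cf.
- split=> [t _| |]; first by case: (dF t).
    by apply: cvg_at_right_filter; exact: cF.
  by apply: cvg_at_left_filter; exact: cF.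
- by move=> t _; rewrite derive1E; case: (dF t).
Qed.

Lemma is_derive_natmul n (t : R) : is_derive t 1 (fun x => n%:R * x) (n%:R : R).
Proof.
have := @is_deriveZ _ _ _ (@id R) n%:R t 1 1 (is_derive_id t 1).
by rewrite /GRing.scale /= mulr1.
Qed.

Lemma continuous_natmul n : continuous (fun t : R => n%:R * t).
Proof. exact: mulrl_continuous. Qed.

Lemma avg_cos n : avg (fun t => cos (n.+1%:R * t)) = 0.
Proof.
have n0 : n.+1%:R != 0 :> R by rewrite pnatr_eq0.
apply: (@avg_deriv (fun t => n.+1%:R^-1 * sin (n.+1%:R * t))).
- move=> t; have := is_deriveZ n.+1%:R^-1
    (is_derive1_comp (is_derive_sin (n.+1%:R * t)) (is_derive_natmul n.+1 t)).
  move=> /is_derive_eq; apply; rewrite /GRing.scale /=; field.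
  by rewrite nat1r.
- move=> t; apply: continuous_comp; first exact: continuous_natmul.
  exact: continuous_cos.
- by rewrite sin_2pi_nat mulr0 sin0.
Qed.

Lemma avg_sin n : avg (fun t => sin (n.+1%:R * t)) = 0.
Proof.
have n0 : n.+1%:R != 0 :> R by rewrite pnatr_eq0.
apply: (@avg_deriv (fun t => - n.+1%:R^-1 * cos (n.+1%:R * t))).
- move=> t; have := is_deriveZ (- n.+1%:R^-1)
    (is_derive1_comp (is_derive_cos (n.+1%:R * t)) (is_derive_natmul n.+1 t)).
  move=> /is_derive_eq; apply; rewrite /GRing.scale /=; field.
  by rewrite nat1r.
- move=> t; apply: continuous_comp; first exact: continuous_natmul.
  exact: continuous_sin.
- by rewrite cos_2pi_nat mulr0 cos0.
Qed.

Lemma circle_continuous_horner (p : {poly C}) : circle_continuous (horner p).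
Proof. by move=> t; apply: cvg_horner; exact: continuous_expi. Qed.

Lemma circle_integral_Xn n : circle_integral (fun z : C => z ^+ n.+1) = 0.
Proof.
apply/eqP; rewrite eq_complex Re_circle_integral Im_circle_integral.
under eq_avg do rewrite expi_pow.
under [avg (fun t => Im _)]eq_avg do rewrite expi_pow.
by rewrite /= avg_cos avg_sin eqxx.
Qed.

Lemma circle_integrable_sum n (F : 'I_n -> C -> C) :
  (forall i, circle_integrable (F i)) ->
  circle_integrable (fun z => \sum_(i < n) F i z).
Proof.
elim: n F => [|n IH] F iF.
  apply: circle_continuous_integrable => t.
  by under eq_fun do rewrite big_ord0; exact: cvg_cst.
pose G z := \sum_(i < n) F (widen_ord (leqnSn n) i) z.
rewrite (_ : (fun z => _) = (fun z => G z + F ord_max z)); last first.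
  by apply/funext => z; rewrite big_ord_recr.
apply: circle_integrableD; last exact: iF.
by apply: (IH (fun i => F (widen_ord (leqnSn n) i))) => i; exact: iF.
Qed.

Lemma circle_integral_sum n (F : 'I_n -> C -> C) :
  (forall i, circle_integrable (F i)) ->
  circle_integral (fun z => \sum_(i < n) F i z) =
  \sum_(i < n) circle_integral (F i).
Proof.
elim: n F => [|n IH] F iF.
  rewrite big_ord0; apply/eqP; rewrite eq_complex.
  rewrite Re_circle_integral Im_circle_integral.
  under eq_avg do rewrite big_ord0.
  under [avg (fun t => Im _)]eq_avg do rewrite big_ord0.
  by rewrite /= !avg_cst eqxx.
pose G z := \sum_(i < n) F (widen_ord (leqnSn n) i) z.
rewrite (@eq_circle_integral _ (fun z => G z + F ord_max z)); last first.
  by move=> z _; rewrite big_ord_recr.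
rewrite circle_integralD; last exact: iF.
  rewrite big_ord_recr /=; congr (_ + _).
  by apply: (IH (fun i => F (widen_ord (leqnSn n) i))) => i; exact: iF.
by apply: circle_integrable_sum => i; exact: iF.
Qed.

(** Positive powers have mean 0, which leaves the constant coefficient. *)
Lemma circle_integral_horner (p : {poly C}) :
  circle_integral (horner p) = p.[0].
Proof.
have iX n : circle_integrable (fun z : C => z ^+ n).
  apply: circle_continuous_integrable => t; under eq_fun do rewrite -hornerXn.
  by rewrite -hornerXn; exact: circle_continuous_horner.
under eq_circle_integral => z _ do rewrite horner_coef.
rewrite circle_integral_sum => [|i]; last exact: circle_integrableZ.
rewrite horner_coef; apply: eq_bigr => i _; rewrite circle_integralZ//.
congr (_ * _); case: (nat_of_ord i) => [|k] /=; last first.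
  by rewrite circle_integral_Xn expr0n.
apply/eqP; rewrite eq_complex Re_circle_integral Im_circle_integral.
under eq_avg do rewrite expr0.
under [avg (fun t => Im _)]eq_avg do rewrite expr0.
by rewrite /= !avg_cst !eqxx.
Qed.

End CircleIntegral.

(** * Polynomial approximation of quotients on the closed disc *)

Section RationalApproximation.
Variable R : realType.
Local Notation C := (C R).
Implicit Types (z w rho : C) (p q : {poly C}).

Lemma horner_bounded p :
  exists M : C, 0 <= M /\ forall z, `|z| <= 1 -> `|p.[z]| <= M.
Proof.
exists (\sum_(i < size p) `|p`_i|); split; first exact: sumr_ge0.
move=> z z1; rewrite horner_coef (le_trans (ler_norm_sum _ _ _))// ler_sum// => i _.
by rewrite normrM normrX ler_piMr// exprn_ile1.
Qed.

Lemma geometric_small z (e : C) : `|z| < 1 -> 0 < e -> exists k, `|z| ^+ k <= e.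
Proof.
move=> z1 /gt0_RRe[eE e0].
have /cvgrPdist_lt/(_ _ e0)[k _ kP] : (fun n => normc z ^+ n) @ \oo --> (0 : R).
  by apply: cvg_expr; rewrite ger0_norm ?normc_ge0// normc_lt1.
exists k; have := kP k (leqnn k); rewrite /= sub0r normrN.
rewrite ger0_norm ?exprn_ge0 ?normc_ge0// => /ltW.
by rewrite eE norm_normc -rmorphXn /= lecR.
Qed.

(** The approximant truncates the geometric series of [(z - rho)^-1] in powers of [z / rho], which
    converges uniformly on the closed disc. *)
Lemma approx_XsubC_inv rho (e : C) : 1 < `|rho| -> 0 < e ->
  exists B : {poly C}, forall z, `|z| <= 1 -> `|(z - rho)^-1 - B.[z]| <= e.
Proof.
move=> rho1 e0.
have rho_neq0 : rho != 0 by rewrite -normr_gt0 (lt_trans ltr01 rho1).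
have m0 : 0 < `|rho| - 1 by rewrite subr_gt0.
have rhoV : `|rho^-1| < 1 by rewrite normfV invf_lt1// (lt_trans ltr01 rho1).
(* The remainder is [(z / rho) ^+ k / (z - rho)], and [|z - rho|] is at least [|rho| - 1]. *)
have [k kP] := geometric_small rhoV (mulr_gt0 e0 m0).
exists (- rho^-1 *: \sum_(i < k) (rho^-1 *: 'X) ^+ i) => z z1.
have zrho : `|rho| - 1 <= `|z - rho|.
  by rewrite distrC (le_trans _ (lerB_dist _ _))// lerB.
have zrho0 : z - rho != 0 by rewrite -normr_gt0 (lt_le_trans m0).
have -> : (- rho^-1 *: \sum_(i < k) (rho^-1 *: 'X) ^+ i).[z] =
    (1 - (rho^-1 * z) ^+ k) / (z - rho).
  rewrite hornerZ horner_sum; under eq_bigr do rewrite horner_exp hornerZ hornerX.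
  rewrite -[1 - _]opprB subrX1; apply: (mulIf zrho0); rewrite divfK// mulrAC.
  by rewrite -mulNr; congr (_ * _); field.
rewrite -{1}[(z - rho)^-1]mul1r -mulrBl subKr normf_div normrX normrM exprMn.
rewrite ler_pdivrMr ?normr_gt0//.
apply: (@le_trans _ _ (`|rho^-1| ^+ k)).
  by rewrite ler_piMr ?exprn_ge0// exprn_ile1.
by rewrite (le_trans kP)// ler_wpM2l// ltW.
Qed.

Lemma approx_prod p (rs : seq C) (e : C) : (forall r, r \in rs -> 1 < `|r|) ->
  0 < e -> exists P : {poly C}, forall z, `|z| <= 1 ->
    `|p.[z] / \prod_(r <- rs) (z - r) - P.[z]| <= e.
Proof.
elim: rs e => [|r rs IH] e rs1 e0.
  by exists p => z _; rewrite big_nil divr1 subrr normr0 ltW.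
have r1 : 1 < `|r| by rewrite rs1// mem_head.
have m0 : 0 < `|r| - 1 by rewrite subr_gt0.
(* This error gets multiplied by [(z - r)^-1], of modulus at most [1 / (|r| - 1)]. *)
have [||P PP] := IH (e / 2 * (`|r| - 1)).
- by move=> x xrs; rewrite rs1// inE xrs orbT.
- by rewrite mulr_gt0// divr_gt0.
have [M [M0 MP]] := horner_bounded P.
have M1 : 0 < M + 1 by rewrite ltr_wpDl.
(* This error gets multiplied by [P.[z]], bounded by [M]; adding 1 keeps the divisor positive. *)
have [|B BP] := approx_XsubC_inv r1 (e := e / 2 / (M + 1)).
  by rewrite !divr_gt0.
exists (P * B) => z z1; rewrite big_cons invfM hornerM.
set f := (\prod_(_ <- _) _)^-1.
have -> : p.[z] * ((z - r)^-1 * f) - P.[z] * B.[z] =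
  (z - r)^-1 * (p.[z] * f - P.[z]) + P.[z] * ((z - r)^-1 - B.[z]) by ring.
have zr : `|r| - 1 <= `|z - r|.
  by rewrite distrC (le_trans _ (lerB_dist _ _))// lerB.
have zr0 : 0 < `|z - r| by rewrite (lt_le_trans m0).
rewrite (le_trans (ler_normD _ _))// [e]splitr lerD// normrM.
  rewrite normfV mulrC ler_pdivrMr// (le_trans (PP _ z1))// ler_wpM2l//.
  by rewrite ltW// divr_gt0.
apply: (@le_trans _ _ ((M + 1) * (e / 2 / (M + 1)))).
  by rewrite ler_pM ?BP// (le_trans (MP _ z1))// lerDl.
by rewrite mulrC divfK// gt_eqF.
Qed.

(** In place of Cauchy's theorem: mean values of quotients without poles in the closed disc reduce
    to mean values of polynomials. *)
Lemma approx_ratio p q (e : C) : zero_free_cdisc q -> 0 < e ->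
  exists P : {poly C}, forall z, `|z| <= 1 -> `|p.[z] / q.[z] - P.[z]| <= e.
Proof.
move=> zfq e0; have [rs [q_rs [rs_root _]]] := poly_split q.
have rs1 r : r \in rs -> 1 < `|r|.
  move=> /rs_root; rewrite real_ltNge ?normr_real ?real1// => qr.
  by apply/negP => /zfq; rewrite -rootE qr.
have [P PP] := approx_prod ((lead_coef q)^-1 *: p) rs1 e0.
exists P => z z1; have := PP z z1; rewrite [in X in _ -> X]q_rs !hornerZ horner_prod.
under [in X in _ -> X]eq_bigr do rewrite hornerXsubC.
by rewrite invfM mulrA [p.[z] * _]mulrC.
Qed.

End RationalApproximation.

(** * Mean value and Poisson formulas for quotients of polynomials *)

Section PoissonFormula.
Variable R : realType.
Local Notation C := (C R).
Implicit Types (z w zeta : C) (p q : {poly C}).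

Lemma circle_continuous_ratio p q : (forall z, `|z| = 1 -> q.[z] != 0) ->
  circle_continuous (fun z => p.[z] / q.[z]).
Proof.
move=> q0 t; have cp := @circle_continuous_horner R p t.
have cq := @circle_continuous_horner R q t.
by apply: (cvgM cp); apply: (cvgV _ cq); rewrite q0// normr_expi.
Qed.

(** Replacing the quotient by a polynomial uniformly within [e / 2] changes the mean and the value
    at 0 by at most [e / 2] each. *)
Lemma Re_mean_value p q : zero_free_cdisc q ->
  Re (circle_integral (fun z => p.[z] / q.[z])) = Re (p.[0] / q.[0]).
Proof.
move=> zfq; apply/eqP; rewrite -subr_eq0 -normr_le0; apply/ler_addgt0Pr => e e0.
rewrite add0r.
have e20 : 0 < (e / 2)%:C :> C.
  by rewrite -(rmorph0 (real_complex R)) ltcR divr_gt0.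
have [P PP] := approx_ratio p zfq e20.
set I := circle_integral _.
have -> : Re I - Re (p.[0] / q.[0]) = (Re I - Re (circle_integral (horner P))) -
    Re (p.[0] / q.[0] - P.[0]).
  by rewrite circle_integral_horner cReD cReN; ring.
rewrite (le_trans (ler_normB _ _))// [e]splitr lerD//.
  rewrite !Re_circle_integral; apply: avg_dist_le.
  - have [] // := circle_continuous_integrable (@circle_continuous_ratio p q _).
    by move=> z z1; rewrite zfq ?z1.
  - by have [] // := circle_continuous_integrable (@circle_continuous_horner R P).
  - move=> t; rewrite -cReN -cReD (le_trans (Re_ge_normc _))// -normr_leR.
    by rewrite PP// normr_expi.
by rewrite (le_trans (Re_ge_normc _))// -normr_leR PP// normr0.
Qed.

Lemma mean_value p q : zero_free_cdisc q ->
  circle_integral (fun z => p.[z] / q.[z]) = p.[0] / q.[0].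
Proof.
move=> zfq; apply/eqP; rewrite eq_complex Re_mean_value// eqxx andTb.
(* The imaginary part is the real part after multiplication by [- i], which can be absorbed into
   [p]. *)
have [c ImE] : exists c : C, forall w : C, Im w = Re (c * w).
  by exists (- 'i%C) => w; rewrite cReM /=; ring.
have ip : circle_integrable (fun z => p.[z] / q.[z]).
  apply: circle_continuous_integrable; apply: circle_continuous_ratio => z z1.
  by rewrite zfq ?z1.
rewrite !ImE -circle_integralZ//.
rewrite (@eq_circle_integral _ _ (fun z => (c *: p).[z] / q.[z])); last first.
  by move=> z _; rewrite hornerZ mulrA.
by rewrite Re_mean_value// hornerZ -mulrA.
Qed.

Lemma conj_circle z : `|z| = 1 -> z^* = z^-1.
Proof. by move=> z1; rewrite -{2}(invC_circle z1) invrK. Qed.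

Lemma circle_sub_neq0 z zeta : `|z| < 1 -> `|zeta| = 1 -> zeta - z != 0.
Proof.
by move=> z1 zeta1; rewrite subr_eq0; apply: contraTneq z1 => <-; rewrite zeta1 ltxx.
Qed.

Lemma one_sub_neq0 z zeta : `|z| < 1 -> `|zeta| <= 1 -> 1 - z^* * zeta != 0.
Proof.
move=> z1 zeta1; rewrite subr_eq0; apply: contraTneq z1 => /(congr1 Num.norm).
rewrite normr1 normrM norm_conjC => E; rewrite -real_leNgt ?real1 ?normr_real//.
by rewrite E ler_piMr.
Qed.

Lemma poissonC z zeta : `|zeta| = 1 ->
  (poisson z zeta)%:C = (1 - z * z^*) / ((zeta - z) * (zeta^-1 - z^*)) :> C.
Proof.
move=> zeta1; rewrite /poisson rmorphM fmorphV rmorphB rmorph1 !rmorphXn /=.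
by rewrite -!norm_normc !normCK rmorphB /= (conj_circle zeta1).
Qed.

(* The first term is the conjugate of a function holomorphic on the disc, and the
   second one is holomorphic and vanishes at 0. *)
Lemma poisson_split z zeta : `|z| < 1 -> `|zeta| = 1 ->
  (poisson z zeta)%:C = (1 - z^* * zeta)^-1^* + z^* * zeta / (1 - z^* * zeta) :> C.
Proof.
move=> z1 zeta1; rewrite poissonC// fmorphV rmorphB rmorphM rmorph1 /= conjCK.
rewrite (conj_circle zeta1).
have h1 : zeta != 0 by exact: circle_neq0.
have h2 := circle_sub_neq0 z1 zeta1.
have h3 : 1 - z^* * zeta != 0 by rewrite one_sub_neq0// zeta1.
by field; rewrite h1 h2 h3.
Qed.

(** On the circle, with [f = p / q], [poisson_split] writes [f] times the kernel as
    [x (f(x) - G) / (x - z) + G F2 + F3]. The first and last terms are holomorphic and vanish at 0,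
    and the conjugate of [F2] is holomorphic with value 1 at 0, so the mean is [G]. *)
Lemma poisson_formula p q z : zero_free_cdisc q -> `|z| < 1 ->
  circle_integral (fun zeta => (poisson z zeta)%:C * (p.[zeta] / q.[zeta])) =
  p.[z] / q.[z].
Proof.
move=> zfq z1; set G := p.[z] / q.[z].
have qz : q.[z] != 0 by rewrite zfq// ltW.
(* Dividing out the root [z] turns [(f(x) - G) / (x - z)] into [k / q], which has no pole in the
   closed disc. *)
have /factor_theorem[k kE] : root (p - G *: q) z.
  by rewrite rootE hornerD hornerN hornerZ divfK// subrr.
pose r := 1 - z^* *: 'X : {poly C}.
have rE x : r.[x] = 1 - z^* * x by rewrite !hornerE.
have zfr : zero_free_cdisc r by move=> x x1; rewrite rE one_sub_neq0.
have zfrq : zero_free_cdisc (r * q).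
  by move=> x x1; rewrite hornerM mulf_neq0 ?zfr ?zfq.
have circle_le (s : {poly C}) : zero_free_cdisc s ->
    forall x, `|x| = 1 -> s.[x] != 0 by move=> zfs x x1; rewrite zfs ?x1.
have ratio_int (s t : {poly C}) : zero_free_cdisc t ->
    circle_integrable (fun x => s.[x] / t.[x]).
  move=> zft; apply: circle_continuous_integrable; apply: circle_continuous_ratio.
  exact: circle_le.
pose F1 x := ('X * k).[x] / q.[x].
pose F2 x := ((1 : {poly C}).[x] / r.[x])^*.
pose F3 x := (z^* *: 'X * p).[x] / (r * q).[x].
rewrite (@eq_circle_integral _ _ (fun x => F1 x + (G * F2 x + F3 x))); last first.
  move=> x x1.
  have h1 : x - z != 0 by exact: circle_sub_neq0.
  have h2 : 1 - z^* * x != 0 by rewrite one_sub_neq0// x1.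
  have h3 : q.[x] != 0 by exact: circle_le.
  have h4 : x != 0 by exact: circle_neq0.
  have := congr1 (fun s : {poly C} => s.[x]) kE.
  rewrite /= hornerD hornerN hornerZ hornerM hornerXsubC => kx.
  have {}kx : k.[x] = (p.[x] - G * q.[x]) / (x - z) by rewrite kx mulfK.
  rewrite poisson_split// /F1 /F2 /F3 !hornerM hornerZ hornerX hornerC rE kx.
  rewrite div1r fmorphV rmorphB rmorphM rmorph1 /= conjCK (conj_circle x1).
  by field; rewrite h1 h2 h3 h4.
have i2 : circle_integrable F2 by apply: cintegrable_conj; exact: ratio_int.
rewrite circle_integralD; [|exact: ratio_int|]; last first.
  apply: circle_integrableD; last exact: ratio_int.
  exact: circle_integrableZ.
rewrite circle_integralD; [|exact: circle_integrableZ|exact: ratio_int].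
rewrite circle_integralZ// circle_integral_conj; last exact: ratio_int.
rewrite !mean_value// !hornerM hornerZ !hornerX mul0r mulr0 mul0r !mul0r.
by rewrite rE mulr0 subr0 hornerC divr1 rmorph1 mulr1 add0r addr0.
Qed.

Lemma cvg_poisson (T : Type) (F : set_system T) {FF : Filter F} (f : T -> C) z zeta :
  f @ F --> zeta -> zeta != z -> poisson z (f t) @[t --> F] --> poisson z zeta.
Proof.
move=> fz zz; apply: cvgM; first exact: cvg_cst.
apply: cvgV; first by rewrite expf_neq0// normc_eq0 subr_eq0.
have cn : normc (f t - z) @[t --> F] --> normc (zeta - z).
  by apply: cvg_normc; apply: cvgB; [exact: fz|exact: cvg_cst].
by under eq_fun do rewrite expr2; rewrite expr2; exact: cvgM.
Qed.

Lemma continuous_poisson z : `|z| < 1 -> continuous (fun t => poisson z (expi t)).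
Proof.
move=> z1 t; apply: cvg_poisson; first exact: continuous_expi.
by rewrite -subr_eq0 circle_sub_neq0// normr_expi.
Qed.

Lemma poisson_ge0 z zeta : `|z| < 1 -> 0 <= poisson z zeta.
Proof.
move=> z1; rewrite divr_ge0 ?exprn_ge0 ?normc_ge0// subr_ge0.
by rewrite exprn_ile1 ?normc_ge0// ltW// normc_lt1.
Qed.

Lemma poisson_formula_Re p q z : zero_free_cdisc q -> `|z| < 1 ->
  avg (fun t => poisson z (expi t) * Re (p.[expi t] / q.[expi t])) =
  Re (p.[z] / q.[z]).
Proof.
move=> zfq z1; rewrite -(poisson_formula p zfq z1) Re_circle_integral.
by apply: eq_avg => t; rewrite cReMr.
Qed.

Lemma avg_poisson z : `|z| < 1 -> avg (fun t => poisson z (expi t)) = 1.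
Proof.
move=> z1; have zf1 : zero_free_cdisc (1 : {poly C}).
  by move=> x _; rewrite hornerC oner_neq0.
rewrite -[RHS]/(Re (1 : C)); have := poisson_formula_Re 1 zf1 z1.
rewrite hornerC divr1 => <-.
by apply: eq_avg => t; rewrite hornerC divr1 /= mulr1.
Qed.

End PoissonFormula.

(** * Quotients bounded by 1 and their boundary slopes *)

Section SchurFunction.
Variable R : realType.
Local Notation C := (C R).
Implicit Types (z w zeta eta v : C) (x e : R).

Lemma ge_right_limit (f : R -> R) a c : {for a, continuous f} ->
  (\forall e \near a^'+, c <= f e) -> c <= f a.
Proof.
move=> fa cf; rewrite leNgt; apply/negP => fc.
have nf : \forall e \near a^'+, f e < c.
  by apply: (cvgr_lt _ (cvg_at_right_filter fa)).
suff : False by [].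
near a^'+ => e.
have : f e < c by near: e.
by rewrite ltNge; apply/negP; rewrite negbK; near: e.
Unshelve. all: by end_near. Qed.

Lemma Re_div z w : Re (z / w) = (Re z * Re w + Im z * Im w) / normc w ^+ 2.
Proof. by rewrite normc_sqr; case: z w => [a b] [c d] /=; ring. Qed.

(** Used to read simple poles on the circle as Poisson kernels, that is, as point masses. *)
Lemma poisson_herglotz z zeta : `|zeta| = 1 ->
  poisson z zeta = Re ((zeta + z) / (zeta - z)).
Proof.
move=> zeta1; rewrite Re_div /poisson; congr (_ / _).
rewrite !(cReD, cImD, cReN, cImN) -[1](expr1n _ 2) -(normc_eq1 zeta1) !normc_sqr.
ring.
Qed.

Lemma poisson_circle z zeta : `|zeta| = 1 -> `|z| = 1 -> poisson z zeta = 0.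
Proof. by move=> zeta1 z1; rewrite /poisson (normc_eq1 z1) expr1n subrr mul0r. Qed.

(** For [u = w^* / |w|] the product [u * w] is the modulus. Bounds on moduli thus reduce to bounds
    on real parts, which can be averaged. *)
Lemma normr_le1_Re w : (forall u, `|u| = 1 -> Re (u * w) <= 1) -> `|w| <= 1.
Proof.
move=> wu; have [->|w_neq0] := eqVneq w 0; first by rewrite normr0 ler01.
have u1 : `|w^* / `|w| | = 1.
  by rewrite normf_div normr_id norm_conjC divff// normr_eq0.
have := wu _ u1; rewrite mulrAC [_ * w]mulrC -normCK expr2 mulfK ?normr_eq0//.
by rewrite -normc_Re -normr_leR.
Qed.

(** [|zeta - z| <= 1 + |z|] bounds the kernel below by [(1 - |z|) / (1 + |z|)]. *)
Lemma poisson_lower z zeta : `|z| < 1 -> `|zeta| = 1 ->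
  (1 - normc z) / 2 <= poisson z zeta.
Proof.
move=> z1 zeta1; have z0 := normc_ge0 z; have z1' := normc_lt1 z1.
have h : normc (zeta - z) <= 1 + normc z.
  rewrite -normr_leR rmorphD /= -norm_normc (le_trans (ler_normB _ _))//.
  by rewrite zeta1 rmorph1.
have h0 : 0 < normc (zeta - z).
  by rewrite lt_neqAle normc_ge0 eq_sym normc_eq0 circle_sub_neq0.
rewrite /poisson ler_pdivlMr ?exprn_gt0//.
have h2 : normc (zeta - z) ^+ 2 <= (1 + normc z) ^+ 2.
  by rewrite ler_pXn2r ?nnegrE// ?addr_ge0// ltW.
have -> : 1 - normc z ^+ 2 = (1 - normc z) / 2 * (2 * (1 + normc z)) by field.
rewrite ler_wpM2l//; first by rewrite divr_ge0// subr_ge0 ltW.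
by rewrite (le_trans h2)// expr2 ler_wpM2r ?addr_ge0// -[2]/(1 + 1) lerD2l ltW.
Qed.

Variables (Q S : {poly C}) (alpha : C).
Hypotheses (zfQ : zero_free_cdisc Q) (alpha1 : `|alpha| = 1).
Hypothesis SQ : forall z, `|z| = 1 -> `|S.[z]| <= `|Q.[z]|.
Hypothesis S_alphaQ : S <> alpha *: Q.

Let D := alpha *: Q - S.

(** Maximum principle: inside the disc each [Re (u S / Q)] with [|u| = 1] is a Poisson average of
    boundary values at most 1. *)
Lemma schur_le z : `|z| < 1 -> `|S.[z]| <= `|Q.[z]|.
Proof.
move=> z1; have Qz : 0 < `|Q.[z]| by rewrite normr_gt0 zfQ// ltW.
rewrite -[leRHS]mul1r -ler_pdivrMr// -normf_div; apply: normr_le1_Re => u u1.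
have := poisson_formula_Re (u *: S) zfQ z1; rewrite hornerZ -mulrA => <-.
rewrite -(avg_poisson z1).
have cP := continuous_poisson z1.
have cG : continuous (fun t => Re ((u *: S).[expi t] / Q.[expi t])).
  move=> t; apply: cvg_Re; apply: (@circle_continuous_ratio _ (u *: S)) => x x1.
  by rewrite zfQ ?x1.
apply: le_avg; [|exact: continuous_avg_integrable|].
  by apply: continuous_avg_integrable => t; exact: (cvgM (cP t) (cG t)).
move=> t; rewrite ler_piMr ?poisson_ge0// (le_trans (ler_norm _))//.
rewrite (le_trans (Re_ge_normc _))// -normr_leR rmorph1.
have t1 : `|expi t : C| = 1 by exact: normr_expi.
rewrite hornerZ normf_div normrM u1 mul1r ler_pdivrMr ?mul1r ?SQ//.
by rewrite normr_gt0 zfQ ?t1.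
Qed.

Lemma schur_cle z : `|z| <= 1 -> `|S.[z]| <= `|Q.[z]|.
Proof. by rewrite le_eqVlt => /orP[/eqP/SQ|/schur_le]. Qed.

(** Strong maximum principle. For [e > 0] the polynomial [(1 + e) alpha Q - S] has no zero in the
    disc, as [|S| <= |Q|] there; by [hurwitz], a zero of the limit [D] would force [D = 0]. *)
Lemma schur_zero_free : zero_free_disc D.
Proof.
move=> w w1; apply/eqP => Dw.
pose P : {poly {poly C}} := (alpha *: Q)%:P * 'X - S%:P.
have PE (x : C) : P.[x%:P] = x *: (alpha *: Q) - S.
  by rewrite hornerD hornerN hornerM !hornerC hornerX mulrC mul_polyC.
have PD : P.[1%:P] = D by rewrite PE scale1r.
apply: S_alphaQ; apply/eqP; rewrite eq_sym -subr_eq0 -/D -PD; apply/eqP.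
apply: (@hurwitz _ P 1 w) => //; last by rewrite PD.
have f0 : {for 0%R, continuous (fun e : R => (1 + e)%:C : C)}.
  by apply: cvg_real_complex; apply: cvgD; [exact: cvg_cst|exact: cvg_id].
have := @closure_path _ _ [set x | zero_free_disc P.[x%:P]] _ _ f0.
rewrite addr0; apply.
near=> e => z z1 /=; rewrite PE hornerD hornerN !hornerZ subr_eq0.
have e0 : 0 < e by near: e; exact: nbhs_right_gt.
apply/eqP => /(congr1 Num.norm); rewrite !normrM alpha1 mul1r => E.
have := schur_le z1; rewrite -E ger_pMl ?normr_gt0 ?zfQ ?(ltW z1)//.
rewrite -(rmorph1 (real_complex R)) normr_leR /= expr0n addr0 sqrtr_sqr.
by rewrite ger0_norm ?addr_ge0 ?(ltW e0)// gerDl leNgt e0.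
Unshelve. all: by end_near. Qed.

(** Equal to [1 - S / (alpha Q)], hence of nonnegative real part on the closed disc. *)
Let G z : C := D.[z] / (alpha *: Q).[z].

Lemma aQ_zero_free : zero_free_cdisc (alpha *: Q).
Proof.
by move=> z z1; rewrite hornerZ mulf_neq0 ?zfQ// circle_neq0.
Qed.

Lemma schur_quotE z : `|z| <= 1 -> G z = 1 - S.[z] / (alpha *: Q).[z].
Proof.
by move=> z1; rewrite /G hornerD hornerN mulrBl divff// aQ_zero_free.
Qed.

Lemma schur_quot_norm z : `|z| <= 1 -> `|S.[z] / (alpha *: Q).[z]| <= 1.
Proof.
move=> z1; rewrite normf_div hornerZ normrM alpha1 mul1r ler_pdivrMr ?mul1r.
  exact: schur_cle.
by rewrite normr_gt0 zfQ.
Qed.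

Lemma Re_schur_quot_ge0 z : `|z| <= 1 -> 0 <= Re (G z).
Proof.
move=> z1; rewrite schur_quotE// cReD cReN subr_ge0.
rewrite (le_trans (ler_norm _))// (le_trans (Re_ge_normc _))// -normr_leR rmorph1.
exact: schur_quot_norm.
Qed.

(** With real part 0, [1 - G 0] would be some [1 - i y] of modulus at most 1, so [y = 0] and [D]
    would vanish at 0. *)
Lemma Re_schur_quot0_gt0 : 0 < Re (G 0).
Proof.
have n0 : `|0 : C| <= 1 by rewrite normr0.
rewrite lt_neqAle Re_schur_quot_ge0// andbT eq_sym; apply/eqP => Re0.
have : G 0 != 0.
  by rewrite mulf_neq0 ?invr_eq0 ?aQ_zero_free// schur_zero_free// normr0.
suff Im0 : Im (G 0) = 0 by rewrite [G 0]complexE Re0 Im0 mulr0 addr0 eqxx.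
have := schur_quot_norm n0; set s := _ / _ => s1.
have sG : s = 1 - G 0 by rewrite schur_quotE// subKr.
have : normc s ^+ 2 <= 1.
  by rewrite exprn_ile1 ?normc_ge0// -normr_leR rmorph1.
rewrite normc_sqr sG cReD cReN cImD cImN Re0 /= subr0 expr1n gerDl add0r sqrrN.
by move=> Im0; apply/eqP; rewrite -sqrf_eq0 eq_le Im0 sqr_ge0.
Qed.

Section BoundaryZero.
Variable eta : C.
Hypotheses (eta1 : `|eta| = 1) (Deta : D.[eta] = 0).

(** The cofactor of [x] in [G (eta * (1 - x))] when [D = k * ('X - eta%:P)]; at [eta] it is the
    inward radial derivative of [G]. *)
Let L (k : {poly C}) z : C := - (eta * k.[z]) / (alpha *: Q).[z].

Lemma schur_quot_factor k (x : C) : D = k * ('X - eta%:P) ->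
  G (eta * (1 - x)) = x * L k (eta * (1 - x)).
Proof.
by move=> Dk; rewrite /G /L [in LHS]Dk hornerM hornerXsubC; ring.
Qed.

Lemma continuous_slope k v : {for 0%R, continuous (fun e : R =>
  Re (v * L k (eta * (1 - e%:C * v))))}.
Proof.
have cz : (fun e : R => eta * (1 - e%:C * v) : C) e @[e --> 0%R] -->
    (eta * (1 - 0%:C * v) : C).
  apply: cvgMr; apply: cvgB; first exact: cvg_cst.
  by apply: cvgMl; exact: continuous_real_complex.
apply: cvg_Re; apply: cvgMr; apply: cvgM.
  by apply: cvgN; apply: cvgMr; apply: cvg_horner; exact: cz.
apply: cvgV; last by apply: cvg_horner; exact: cz.
by rewrite aQ_zero_free// rmorph0 mul0r subr0 mulr1 eta1.
Qed.

(** For small [e > 0] the point [eta * (1 - e v)] is in the closed disc, where [Re G >= 0]; dividing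
    by [e] and letting [e] tend to 0 gives the sign. *)
Lemma slope_halfplane k v : D = k * ('X - eta%:P) -> 0 < Re v ->
  0 <= Re (v * L k eta).
Proof.
move=> Dk v0; have v2 : 0 < Re v ^+ 2 + Im v ^+ 2.
  by rewrite ltr_wpDr ?sqr_ge0// exprn_gt0.
pose f e := Re (v * L k (eta * (1 - e%:C * v))).
have -> : Re (v * L k eta) = f 0 by rewrite /f rmorph0 mul0r subr0 mulr1.
apply: ge_right_limit; first exact: continuous_slope.
near=> e; rewrite /f.
have e0 : 0 < e by near: e; exact: nbhs_right_gt.
rewrite -(pmulr_rge0 _ e0) -cReMr mulrA -schur_quot_factor//.
apply: Re_schur_quot_ge0; rewrite normrM eta1 mul1r -(rmorph1 (real_complex R)).
rewrite normr_leR -(@ler_pXn2r _ 2)// ?nnegrE ?normc_ge0// normc_sqr.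
rewrite cReD cImD cReN cImN cReMr cImMr /= expr1n.
(* This amounts to [|1 - e v| <= 1], since [1 - |1 - e v|^2 = e (2 Re v - e |v|^2)]. *)
have e2 : e * (Re v ^+ 2 + Im v ^+ 2) <= 2 * Re v.
  rewrite -ler_pdivlMr//; near: e; apply: nbhs_right_le.
  by rewrite divr_gt0// mulr_gt0.
rewrite -subr_ge0.
have -> : 1 - ((1 - e * Re v) ^+ 2 + (0 - e * Im v) ^+ 2) =
  e * (2 * Re v - e * (Re v ^+ 2 + Im v ^+ 2)) by ring.
by rewrite mulr_ge0 ?subr_ge0// ltW.
Unshelve. all: by end_near. Qed.

(** Hopf's boundary lemma: at [eta * (1 - e)] the Poisson kernel is at least [e / 2], so [Re G]
    there is at least [e / 2] times its mean [Re (G 0)]; division by [e] leaves the constant. *)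
Lemma slope_hopf k : D = k * ('X - eta%:P) -> Re (G 0) / 2 <= Re (L k eta).
Proof.
move=> Dk; pose f e := Re (1 * L k (eta * (1 - e%:C * 1))).
have -> : Re (L k eta) = f 0 by rewrite /f rmorph0 mul0r subr0 mulr1 mul1r.
apply: ge_right_limit; first exact: continuous_slope.
near=> e; rewrite /f.
have e0 : 0 < e by near: e; exact: nbhs_right_gt.
have e1 : e < 1 by near: e; apply: nbhs_right_lt.
rewrite mul1r mulr1 -(ler_pM2l e0) -cReMr -schur_quot_factor//.
set z := eta * _.
have nz : normc z = 1 - e.
  rewrite normcM (normc_eq1 eta1) mul1r normc_Re -(rmorph1 (real_complex R)).
  by rewrite -rmorphB norm_normc /= expr0n addr0 sqrtr_sqr ger0_norm// subr_ge0 ltW.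
have z1 : `|z| < 1 by rewrite -(rmorph1 (real_complex R)) normr_ltR nz gtrBl.
have n0 : `|0 : C| < 1 by rewrite normr0.
have cG : continuous (fun t => Re (D.[expi t] / (alpha *: Q).[expi t])).
  move=> t; apply: cvg_Re; apply: circle_continuous_ratio => x x1.
  by rewrite aQ_zero_free// x1.
have cP := continuous_poisson z1.
have cPG : continuous (fun t => poisson z (expi t) *
    Re (D.[expi t] / (alpha *: Q).[expi t])).
  by move=> t; exact: (cvgM (cP t) (cG t)).
have ceG : continuous (fun t => e / 2 * Re (D.[expi t] / (alpha *: Q).[expi t])).
  by move=> t; exact: (cvgM (cvg_cst _) (cG t)).
have avgG : avg (fun t => e / 2 * Re (D.[expi t] / (alpha *: Q).[expi t])) =
    e * (Re (G 0) / 2).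
  rewrite avgZ; last exact: continuous_avg_integrable.
  rewrite -(Re_circle_integral (fun z => D.[z] / (alpha *: Q).[z])).
  rewrite (mean_value _ aQ_zero_free).
  by rewrite mulrAC mulrA.
rewrite -avgG -(poisson_formula_Re D aQ_zero_free z1).
apply: le_avg; [exact: continuous_avg_integrable..|] => t.
apply: ler_wpM2r; first by rewrite Re_schur_quot_ge0// normr_expi.
by rewrite (le_trans _ (poisson_lower z1 (normr_expi t)))// nz subKr.
Unshelve. all: by end_near. Qed.

(* Julia-Caratheodory: approaching [eta] from every direction [v] of the half plane
   forces the slope to be real, and the Poisson lower bound forces it positive. *)
Lemma boundary_slope_gt0 (b := - (eta * D^`().[eta]) / (alpha * Q.[eta])) :
  Im b = 0 /\ 0 < Re b.
Proof.
have /factor_theorem[k Dk] : root D eta by apply/rootP.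
have bE : b = L k eta.
  rewrite /b /L hornerZ; do 3 congr (_ _); rewrite [in LHS]Dk derivM derivXsubC.
  by rewrite mulr1 hornerD hornerM hornerXsubC subrr mulr0 add0r.
rewrite bE; split; last first.
  by apply: lt_le_trans (slope_hopf Dk); rewrite divr_gt0// Re_schur_quot0_gt0.
apply/eqP; apply: contraT => Im0.
(* Chosen so that [Re (v * L k eta) = -1], against [slope_halfplane]. *)
pose v : C := 1 +i* ((Re (L k eta) + 1) / Im (L k eta)).
have := @slope_halfplane k v Dk ltr01.
by rewrite cReM /= mul1r divfK// opprD addrA subrr sub0r oppr_ge0 ler10.
Qed.

End BoundaryZero.

End SchurFunction.

(** * Partial fractions at boundary poles *)

Section HerglotzFractions.
Variable R : realType.
Local Notation C := (C R).
Implicit Types (z w zeta : C).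

Lemma factor_distinct_roots (l : nat) (eta : 'I_l -> C) (p : {poly C}) :
  injective eta -> (forall k, p.[eta k] = 0) ->
  exists q, p = q * \prod_(k < l) ('X - (eta k)%:P).
Proof.
move=> eta_inj p0.
have [||q qE] := @uniq_roots_prod_XsubC _ p [seq eta k | k <- enum 'I_l].
- by apply/allP => _ /mapP[k _ ->]; apply/rootP.
- by rewrite uniq_rootsE map_inj_uniq ?enum_uniq.
by exists q; rewrite [LHS]qE big_map big_enum.
Qed.

Variables (Q S : {poly C}) (alpha : C).
Hypotheses (zfQ : zero_free_cdisc Q) (alpha1 : `|alpha| = 1).
Hypothesis SQ : forall z, `|z| = 1 -> `|S.[z]| <= `|Q.[z]|.
Hypothesis S_alphaQ : S <> alpha *: Q.

Let D := alpha *: Q - S.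

(** At a root of [D] on the circle this is [z f'(z) / f(z)] for [f = S / Q], the speed of the
    argument of [f] along the circle. It is positive, whereas [f'] itself carries a unimodular
    factor. *)
Definition slope z : C := - (z * D^`().[z]) / (alpha * Q.[z]).

Variables (l : nat) (eta : 'I_l -> C).
Hypotheses (eta_inj : injective eta) (eta1 : forall k, `|eta k| = 1).
Hypotheses (Deta : forall k, D.[eta k] = 0).
Hypothesis etaP : forall z, `|z| = 1 -> D.[z] = 0 -> exists k, z = eta k.

(** [E] is [D] without its circle roots, and [N] is the numerator left once the Herglotz kernels are
    subtracted. The weights [1 / slope] are the ones that cancel the poles, so [N] vanishes at the
    circle roots too. *)
Lemma herglotz_fractions : exists M E : {poly C}, zero_free_cdisc E /\
  forall z, D.[z] != 0 -> (alpha *: Q + S).[z] / D.[z] =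
    M.[z] / E.[z] + \sum_(k < l) (slope (eta k))^-1 * ((eta k + z) / (eta k - z)).
Proof.
have slope_neq0 k : slope (eta k) != 0.
  have [_] := boundary_slope_gt0 zfQ alpha1 SQ S_alphaQ (eta1 k) (Deta k).
  by rewrite -/D -/(slope _); apply: contraTneq => ->; rewrite ltxx.
have [E DE] := factor_distinct_roots eta_inj Deta.
pose V k := \prod_(j < l | j != k) ('X - (eta j)%:P).
have DV k : D = E * V k * ('X - (eta k)%:P).
  by rewrite [LHS]DE (bigD1 k)//= [(_ - _) * _]mulrC mulrA.
have dD k : D^`().[eta k] = (E * V k).[eta k].
  rewrite [in LHS](DV k) derivM derivXsubC mulr1 hornerD [X in X + _]hornerM.
  by rewrite hornerXsubC subrr mulr0 add0r.
have dD_neq0 k : D^`().[eta k] != 0.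
  by apply: contraNneq (slope_neq0 k) => dD0; rewrite /slope dD0 mulr0 oppr0 mul0r.
(* A circle root of [E] would be a double root of [D], which a nonzero slope excludes. *)
have zfE : zero_free_cdisc E.
  move=> z; rewrite le_eqVlt => /orP[/eqP z1|z1]; apply/eqP => Ez.
    have [|k zk] := etaP z1; first by rewrite DE hornerM Ez mul0r.
    by have := dD_neq0 k; rewrite dD hornerM -zk Ez mul0r eqxx.
  have := schur_zero_free zfQ alpha1 SQ S_alphaQ z1.
  by rewrite -/D DE hornerM Ez mul0r eqxx.
pose N := alpha *: Q + S +
  \sum_(k < l) (slope (eta k))^-1 *: (('X + (eta k)%:P) * (E * V k)).
have alpha0 : alpha != 0 by exact: circle_neq0.
have Sk k : S.[eta k] = alpha * Q.[eta k].
  by have /eqP := Deta k; rewrite hornerD hornerN hornerZ subr_eq0 => /eqP.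
have N0 k : N.[eta k] = 0.
  rewrite hornerD horner_sum (bigD1 k)//= [X in _ + (_ + X)]big1 => [|j jk].
    rewrite addr0 hornerZ hornerM -dD !hornerD hornerX hornerC hornerZ Sk.
    have Qk : Q.[eta k] != 0 by rewrite zfQ ?eta1.
    have ek : eta k != 0 by rewrite circle_neq0.
    have dk := dD_neq0 k.
    by rewrite /slope; field; rewrite dk ek Qk alpha0.
  rewrite !(hornerZ, hornerM) /V (bigD1 k) 1?eq_sym//= hornerM hornerXsubC subrr.
  by rewrite mul0r !mulr0.
have [M NM] := factor_distinct_roots eta_inj N0.
exists M, E; split=> // z Dz.
have [Ez Wz] : E.[z] != 0 /\ (\prod_(k < l) ('X - (eta k)%:P)).[z] != 0.
  by apply/andP; rewrite -negb_or -mulf_eq0 -hornerM -DE.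
have -> : M.[z] / E.[z] = N.[z] / D.[z].
  by rewrite NM DE !hornerM; field; rewrite Ez Wz.
rewrite [N.[z]]hornerD mulrDl -addrA horner_sum mulr_suml -big_split /=.
rewrite big1 ?addr0// => k _.
have -> : D.[z] = (E * V k).[z] * (z - eta k).
  by rewrite [in LHS](DV k) hornerM hornerXsubC.
rewrite hornerZ hornerM.
have [EVz zk] : (E * V k).[z] != 0 /\ z - eta k != 0.
  by apply/andP; rewrite -negb_or -mulf_eq0 -hornerXsubC -hornerM -DV.
have zk' : eta k - z != 0 by rewrite -opprB oppr_eq0.
rewrite hornerD hornerX hornerC.
move: (slope_neq0 k); move: (slope (eta k)) => s s0.
by field; rewrite zk' s0 zk EVz.
Qed.

Lemma slopeE k : slope (eta k) = (normc (slope (eta k)))%:C /\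
  0 < normc (slope (eta k)).
Proof.
have := boundary_slope_gt0 zfQ alpha1 SQ S_alphaQ (eta1 k) (Deta k).
rewrite -/D -/(slope _) => -[Im0 Re0].
have E : slope (eta k) = (Re (slope (eta k)))%:C.
  by rewrite [LHS]complexE Im0 mulr0 addr0.
have nE : normc (slope (eta k)) = Re (slope (eta k)).
  by rewrite {1}E normc_Re /= expr0n addr0 sqrtr_sqr ger0_norm// ltW.
by rewrite nE.
Qed.

Lemma schur_poissonE z : D.[z] != 0 -> Q.[z] != 0 ->
  poisson (S.[z] / Q.[z]) alpha = Re ((alpha *: Q + S).[z] / D.[z]).
Proof.
move=> Dz Qz; rewrite poisson_herglotz//; congr Re.
move: Dz; rewrite /D !hornerD !hornerN !hornerZ => Dz.
by field; rewrite Dz Qz.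
Qed.

(** Herglotz kernels have real part 0 on the circle off their poles, so [Re (M / E)] has the
    boundary values of the left side, and [M] never has to be computed. *)
Lemma schur_herglotz : exists M E : {poly C}, [/\ zero_free_cdisc E,
  forall z, `|z| < 1 -> poisson (S.[z] / Q.[z]) alpha = Re (M.[z] / E.[z]) +
    \sum_(k < l) (normc (slope (eta k)))^-1 * poisson z (eta k) &
  forall z, `|z| = 1 -> D.[z] != 0 ->
    poisson (S.[z] / Q.[z]) alpha = Re (M.[z] / E.[z])].
Proof.
have [M [E [zfE ME]]] := herglotz_fractions; exists M, E.
have term k z : Re ((slope (eta k))^-1 * ((eta k + z) / (eta k - z))) =
    (normc (slope (eta k)))^-1 * poisson z (eta k).
  by rewrite [X in Re (X^-1 * _)](slopeE k).1 -fmorphV cReMr poisson_herglotz.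
split=> // z z1.
  have Dz : D.[z] != 0 by exact: (schur_zero_free zfQ alpha1 SQ S_alphaQ).
  rewrite schur_poissonE ?zfQ ?(ltW z1)// ME// cReD Re_sum; congr (_ + _).
  by apply: eq_bigr => k _.
move=> Dz; rewrite schur_poissonE ?zfQ ?z1// ME// cReD Re_sum big1 ?addr0// => k _.
by rewrite term poisson_circle ?mulr0.
Qed.

End HerglotzFractions.

(** * Integrands controlled off finitely many angles *)

Section FiniteExceptions.
Variable R : realType.
Local Notation C := (C R).
Implicit Types (h k : R -> R) (F : set R).

Lemma finite_circle_roots (r : {poly C}) : r != 0 ->
  finite_set [set t | t \in `[0, 2 * pi] /\ r.[expi t] = 0].
Proof.
move=> r_neq0; have [rs [r_rs _]] := poly_split r.
have fB : finite_set [set` rs] by exact: finite_seq.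
(* [cos] is injective on each half turn, so a root comes from at most one angle in [[0, pi]] and one
   in [[pi, 2 pi]]. *)
apply: (@sub_finite_set _ _ ((fun z : C => acos (Re z)) @` [set` rs] `|`
    (fun z : C => 2 * pi - acos (Re z)) @` [set` rs])); last first.
  by rewrite finite_setU; split; exact: finite_image.
move=> t /= [t2pi rt].
have trs : expi t \in rs.
  have : root r (expi t) by apply/rootP.
  by rewrite r_rs rootZ ?lead_coef_eq0// root_prod_XsubC.
move: t2pi; rewrite in_itv /= => /andP[t0 t2].
have [tpi|pit] := leP t pi; [left|right]; exists (expi t) => //=.
  by rewrite cosK// in_itv /= t0.
rewrite -[cos t]cosN -(cosD2pi (- t)) cosK ?in_itv /=; first by ring.
apply/andP; split; first by rewrite addrC -mulr_natl subr_ge0.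
by rewrite addrC lerBlDr mulr2n lerD2l ltW.
Qed.

Lemma finite_measurable F : finite_set F -> measurable F.
Proof.
move=> /finite_set_countable; apply: countable_measurable => t.
exact: measurable_set1.
Qed.

Lemma measurable_off_finite h F : finite_set F ->
  (forall t, t \in `[0, 2 * pi] -> ~ F t -> {for t, continuous h}) ->
  measurable_fun (`[0, 2 * pi]%classic : set R) h.
Proof.
(* Removing the endpoints as well leaves an open set, on which continuity gives measurability. *)
move=> fF ch; pose F' := F `|` [set 0; 2 * pi].
have fF' : finite_set F' by rewrite finite_setU; split.
have -> : `[0, 2 * pi]%classic =
    (`]0, 2 * pi[%classic `\` F') `|` (`[0, 2 * pi]%classic `&` F').
  apply/seteqP; split=> t /=.
    move=> t02; have [F't|F't] := pselect (F' t); first by right.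
    left; split=> //; move: t02; rewrite !in_itv /= => /andP[t0 t2].
    rewrite !lt_neqAle t0 t2 !andbT.
    apply/andP; split; apply/eqP => E; apply: F't; right; first by left.
    by right.
  by move=> [[+ _]|[]//]; rewrite !in_itv /= => /andP[/ltW-> /ltW->].
have mF'' : measurable (`[0, 2 * pi]%classic `&` F').
  by apply: finite_measurable; apply: finite_setIr.
apply/measurable_funU => //.
  by apply: measurableD => //; exact: finite_measurable.
split.
  apply: open_continuous_measurable_fun.
    apply: openI; first exact: interval_open.
    apply: closed_openC; apply accessible_finite_set_closed => //.
    exact/hausdorff_accessible/Rhausdorff.
  move=> t /set_mem[/= t02 F't]; apply: ch.
    by move: t02; rewrite !in_itv /= => /andP[/ltW-> /ltW->].
  by move=> Ft; apply: F't; left.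
move=> _ Y mY; apply: finite_measurable.
by apply: finite_setIl; exact: finite_setIr.
Qed.

Lemma integrable_off_finite h F M : finite_set F ->
  (forall t, t \in `[0, 2 * pi] -> ~ F t -> {for t, continuous h}) ->
  (forall t, t \in `[0, 2 * pi] -> ~ F t -> `|h t| <= M) ->
  avg_integrable h.
Proof.
move=> fF ch hM; apply: measurable_bounded_integrable => //.
- by rewrite /= lebesgue_measure_itv /=; case: ifP => // _; rewrite -EFinD ltry.
- exact: measurable_off_finite fF ch.
have [M' FM'] : exists M', forall t, F t -> `|h t| <= M'.
  have /finite_seqP[s ->] := fF; exists (\sum_(t <- s) `|h t|) => t /= ts.
  by rewrite (big_rem t)//= lerDl sumr_ge0.
exists (Num.max M M'); split; first exact: num_real.
move=> x Mx t /= t02; have [Ft|Ft] := pselect (F t).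
  by rewrite (le_trans (FM' _ Ft))// (le_trans _ (ltW Mx))// le_max lexx orbT.
by rewrite (le_trans (hM _ t02 Ft))// (le_trans _ (ltW Mx))// le_max lexx.
Qed.

Lemma eq_avg_off_finite h k F : finite_set F ->
  measurable_fun (`[0, 2 * pi]%classic : set R) h ->
  measurable_fun (`[0, 2 * pi]%classic : set R) k ->
  (forall t, t \in `[0, 2 * pi] -> ~ F t -> h t = k t) ->
  avg h = avg k.
Proof.
move=> fF mh mk hk; congr (_ * _); congr fine; apply: ae_eq_integral => //.
- exact/measurable_EFinP.
- exact/measurable_EFinP.
exists F; split; first exact: finite_measurable.
  by apply: countable_lebesgue_measure0; exact: finite_set_countable.
move=> t /= /not_implyP[t02 /eqP tk]; apply: contrapT => Ft.
by move: tk; rewrite hk// eqxx.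
Qed.

End FiniteExceptions.

(** * Continuity on the torus *)

Section TorusContinuity.
Variable R : realType.
Local Notation C := (C R).
Local Notation T2 := (T2 R).
Implicit Types (h k : C * C -> R) (x y : C * C).

Lemma near_normc_lt (T : Type) (F : set_system T) {FF : Filter F} (f : T -> C) z e :
  f @ F --> z -> 0 < e -> \forall t \near F, normc (z - f t) < e.
Proof.
move=> fz e0; have eC : 0 < e%:C :> C by rewrite -(rmorph0 (real_complex R)) ltcR.
have /cvgrPdist_lt/(_ _ eC) := fz; apply: filterS => t.
by rewrite normr_ltR.
Qed.

Definition torus_continuous h :=
  forall x, T2 x -> h @ within T2 (nbhs x) --> h x.

Lemma torus_continuousP h : {within T2, continuous h} <-> torus_continuous h.
Proof. exact: subspace_continuousP. Qed.

#[global] Instance nbhs_C2_filter x : ProperFilter (nbhs x).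
Proof. exact: nbhs_pfilter. Qed.

Lemma torus_continuous_lincomb a b h k : torus_continuous h ->
  torus_continuous k -> torus_continuous (fun x => a * h x + b * k x).
Proof.
move=> ch ck x Tx; have := ch x Tx; have := ck x Tx => kx hx.
exact: (cvgD (cvgM (cvg_cst a) hx) (cvgM (cvg_cst b) kx)).
Qed.

Lemma torus_continuous_cst a : torus_continuous (fun=> a).
Proof. by move=> x Tx; exact: cvg_cst. Qed.

Lemma torus_eps h x e : torus_continuous h -> T2 x -> 0 < e ->
  exists2 r : R, 0 < r & forall y, T2 y -> normc (x.1 - y.1) < r ->
    normc (x.2 - y.2) < r -> `|h x - h y| < e.
Proof.
move=> ch Tx e0; have /cvgrPdist_lt/(_ _ e0) := ch x Tx.
rewrite near_withinE => /nbhs_ballP[d d0 dP].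
have [dE Rd0] := gt0_RRe d0; exists (Re d) => // y Ty y1 y2.
by apply: dP Ty; split; rewrite /ball /= dE normr_ltR.
Qed.

Lemma torus_continuous_comp h (u v : R -> C) (t : R) : torus_continuous h ->
  (forall s, T2 (u s, v s)) -> {for t, continuous u} -> {for t, continuous v} ->
  {for t, continuous (fun s => h (u s, v s))}.
Proof.
move=> ch Tuv cu cv; apply/cvgrPdist_lt => e e0.
have [r r0 rP] := torus_eps ch (Tuv t) e0; near=> s.
apply: rP; first exact: Tuv; rewrite /=; near: s.
  exact: near_normc_lt cu r0.
exact: near_normc_lt cv r0.
Unshelve. all: by end_near. Qed.

Lemma T2_expi (s t : R) : T2 (expi s, expi t).
Proof. by split; rewrite normr_expi. Qed.

Lemma torus_unif_continuous h e : torus_continuous h -> 0 < e ->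
  exists2 d : R, 0 < d & forall x y, T2 x -> T2 y -> normc (x.1 - y.1) < d ->
    normc (x.2 - y.2) < d -> `|h x - h y| <= e.
Proof.
move=> ch e0; pose K : set (R * R) := `[0, 2 * pi]%classic `*` `[0, 2 * pi]%classic.
have cK : compact K by apply: compact_setX; exact: segment_compact.
pose P (d : R) (s : R * R) := forall y, T2 y -> normc (expi s.1 - y.1) < d ->
  normc (expi s.2 - y.2) < d -> `|h (expi s.1, expi s.2) - h y| <= e.
have : \forall d \near (0 : R)^'+, K `<=` P d.
  (* Compactness of the square of angles turns the pointwise radii into a single [d]. *)
  move/compact_near_coveringP : cK; apply => -[s t] _.
  have e20 : 0 < e / 2 by rewrite divr_gt0.
  have [r r0 rP] := torus_eps ch (T2_expi s t) e20.
  have r20 : 0 < r / 2 by rewrite divr_gt0.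
  near=> s' d => y Ty /= y1 y2.
  have d2 : d <= r / 2 by near: d; exact: nbhs_right_le.
  have s1 : normc (expi s - expi s'.1) < r / 2.
    near: s'; apply: near_normc_lt => //.
    by apply: continuous_cvg; [exact: continuous_expi|exact: cvg_fst].
  have s2 : normc (expi t - expi s'.2) < r / 2.
    near: s'; apply: near_normc_lt => //.
    by apply: continuous_cvg; [exact: continuous_expi|exact: cvg_snd].
  have tri (a b c : C) : normc (a - b) < r / 2 -> normc (b - c) < d ->
      normc (a - c) < r.
    move=> ab bc; rewrite -(subrK b a) -addrA (le_lt_trans (normcD_le _ _))//.
    by rewrite [r]splitr ltrD// (lt_le_trans bc).
  rewrite (_ : _ - _ = (h (expi s, expi t) - h y) -
    (h (expi s, expi t) - h (expi s'.1, expi s'.2))); last by ring.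
  rewrite (le_trans (ler_normB _ _))// [e]splitr lerD// ltW//.
    by apply: rP => //=; [exact: tri s1 y1|exact: tri s2 y2].
  apply: rP; first exact: T2_expi.
    by rewrite /= (lt_le_trans s1)// ler_pdivrMr// ler_peMr ?ltW// ltr1n.
  by rewrite /= (lt_le_trans s2)// ler_pdivrMr// ler_peMr ?ltW// ltr1n.
move=> near_d; near (0 : R)^'+ => d; exists d.
  by near: d; exact: nbhs_right_gt.
move=> [x1 x2] y [/= /expi_surj[s s02 ->] /expi_surj[t t02 ->]] Ty y1 y2.
have KP : K `<=` P d by near: d.
exact: (KP (s, t) (conj s02 t02) y Ty y1 y2).
Unshelve. all: by end_near. Qed.

Lemma torus_bounded h : torus_continuous h ->
  exists2 B : R, 0 < B & forall x, T2 x -> `|h x| <= B.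
Proof.
move=> ch; pose K : set (R * R) := `[0, 2 * pi]%classic `*` `[0, 2 * pi]%classic.
have cK : compact K by apply: compact_setX; exact: segment_compact.
have : \forall B \near +oo%R, K `<=` (fun s => `|h (expi s.1, expi s.2)| <= B).
  move/compact_near_coveringP : cK; apply => -[s t] _.
  have [r r0 rP] := torus_eps ch (T2_expi s t) ltr01.
  near=> s' B => /=.
  have s1 : normc (expi s - expi s'.1) < r.
    near: s'; apply: near_normc_lt => //.
    by apply: continuous_cvg; [exact: continuous_expi|exact: cvg_fst].
  have s2 : normc (expi t - expi s'.2) < r.
    near: s'; apply: near_normc_lt => //.
    by apply: continuous_cvg; [exact: continuous_expi|exact: cvg_snd].
  have hb := rP _ (T2_expi s'.1 s'.2) s1 s2.
  apply: (@le_trans _ _ (`|h (expi s, expi t)| + 1)).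
    rewrite -[h (expi s'.1, _)](subKr (h (expi s, expi t))).
    by rewrite (le_trans (ler_normB _ _))// lerD2l ltW.
  by near: B; apply: nbhs_pinfty_ge; exact: num_real.
move=> near_B; near (pinfty_nbhs R) => B; exists B.
  by near: B; exact: nbhs_pinfty_gt.
move=> [x1 x2] [/= /expi_surj[s s02 ->] /expi_surj[t t02 ->]].
have : K `<=` (fun s => `|h (expi s.1, expi s.2)| <= B) by near: B.
by move=> KB; exact: (KB (s, t) (conj s02 t02)).
Unshelve. all: by end_near. Qed.

End TorusContinuity.

(** * Sums of Poisson kernels over roots of unity *)

Section RootsOfUnityKernel.
Variable R : realType.
Local Notation C := (C R).
Implicit Types (z w zeta y : C).

Lemma expi_neq1 (s : R) : 0 < s < 2 * pi -> expi s != 1.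
Proof.
move=> /andP[s0 s2]; apply/eqP => /(congr1 Re) /= coss.
have [spi|pis] := leP s pi.
  have : s = 0 by apply: cos_inj; rewrite ?in_itv /= ?lexx ?pi_ge0 ?(ltW s0) ?cos0.
  by move=> s00; rewrite s00 ltxx in s0.
have : 2 * pi - s = 0.
  have s2i : 2 * pi - s \in `[0, pi].
    by rewrite in_itv /=; apply/andP; split; move: s2 pis; lra.
  have i0 : 0 \in `[0, pi : R] by rewrite in_itv /= lexx pi_ge0.
  by apply: cos_inj => //; rewrite addrC mulr_natl cosD2pi cosN coss cos0.
by move=> /eqP; rewrite subr_eq0 => /eqP s2pi; rewrite s2pi ltxx in s2.
Qed.

Variable N : nat.
Hypothesis N0 : (0 < N)%N.

Definition unity_root (j : nat) : C := expi (j%:R * (2 * pi / N%:R)).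

Let NR0 : 0 < N%:R :> R. Proof. by rewrite ltr0n. Qed.

(** Exchanging index and exponent turns a sum of [k]-th powers over all roots into a geometric
    sum. *)
Lemma unity_rootX j k : unity_root j ^+ k = unity_root k ^+ j.
Proof. by rewrite /unity_root !expi_pow mulrCA. Qed.

Lemma unity_root_expN j : unity_root j ^+ N = 1.
Proof.
rewrite /unity_root expi_pow mulrCA [N%:R * _]mulrC divfK ?gt_eqF//.
by rewrite /expi sin_2pi_nat cos_2pi_nat.
Qed.

Lemma normr_unity_root j : `|unity_root j| = 1.
Proof. exact: normr_expi. Qed.

Lemma sum_unity_roots k : (k < N)%N ->
  \sum_(j < N) unity_root j ^+ k = if k == 0%N then N%:R else 0.
Proof.
case: k => [|k] kN /=.
  under eq_bigr do rewrite expr0.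
  by rewrite sumr_const card_ord.
under eq_bigr do rewrite unity_rootX.
have u1 : unity_root k.+1 - 1 != 0.
  rewrite subr_eq0 expi_neq1// mulr_gt0 ?divr_gt0 ?pi2_gt0 ?ltr0Sn//=.
  by rewrite mulrCA gtr_pMr ?pi2_gt0// ltr_pdivrMr// mul1r ltr_nat.
by apply: (mulfI u1); rewrite -subrX1 unity_root_expN subrr mulr0.
Qed.

(** Since [u ^+ N = 1] for each root [u], each term is a geometric sum of length [N] over
    [1 - y ^+ N]; summing over the roots kills every power but the one of exponent 0. *)
Lemma sum_unity_geom y : `|y| < 1 ->
  \sum_(j < N) (1 - unity_root j * y)^-1 = N%:R / (1 - y ^+ N).
Proof.
move=> y1.
have yN0 : 1 - y ^+ N != 0.
  rewrite subr_eq0; apply: contraTneq y1 => /(congr1 Num.norm).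
  rewrite normr1 normrX => /esym/eqP; rewrite pexpr_eq1// => /eqP ->.
  by rewrite ltxx.
have term (j : 'I_N) : (1 - unity_root j * y)^-1 =
    (\sum_(k < N) y ^+ k * unity_root j ^+ k) / (1 - y ^+ N).
  have u0 : 1 - unity_root j * y != 0.
    rewrite subr_eq0; apply: contraTneq y1 => /(congr1 Num.norm).
    by rewrite normr1 normrM normr_unity_root mul1r => <-; rewrite ltxx.
  under eq_bigr do rewrite -exprMn mulrC.
  apply: (mulfI u0); rewrite divff// mulrA -[1 - _ * y]opprB mulNr -subrX1.
  by rewrite exprMn unity_root_expN mul1r opprB divff.
under eq_bigr do rewrite term.
rewrite -mulr_suml exchange_big /=; congr (_ / _).
under eq_bigr => k _ do rewrite -mulr_sumr sum_unity_roots//.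
rewrite (bigD1 (Ordinal N0))//= mul1r big1 ?addr0// => k k0.
by rewrite (_ : (k == 0 :> nat) = false) ?mulr0//; apply/negbTE.
Qed.

Lemma poisson_inv z zeta : `|zeta| = 1 -> `|z| < 1 ->
  poisson z zeta = 2 * Re (1 - z * zeta^-1)^-1 - 1.
Proof.
move=> zeta1 z1; rewrite poisson_herglotz//.
have h1 := circle_neq0 zeta1; have h2 := circle_sub_neq0 z1 zeta1.
have -> : (zeta + z) / (zeta - z) = 2%:C * (1 - z * zeta^-1)^-1 + (- 1)%:C.
  rewrite rmorphN rmorph1 rmorph_nat; field; rewrite h1 h2 /=.
  by move: h2.
by rewrite cReD cReMr.
Qed.

(** A Riemann sum, over equally spaced points of the circle of radius [r], of a mean equal to 1. *)
Definition kernel_sum (r : R) zeta : R :=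
  N%:R^-1 * \sum_(j < N) poisson (r%:C * unity_root j) zeta.

(** The deviation is exactly [2 Re (y^N / (1 - y^N))] with [y = r / zeta]. From
    [r^N <= e / 4 <= 1 / 4] the denominator has modulus at least [3 / 4], and
    [2 (e / 4) / (3 / 4) <= e]. *)
Lemma kernel_sum_near1 (r e : R) zeta : 0 < r < 1 -> `|zeta| = 1 -> 0 < e <= 1 ->
  r ^+ N <= e / 4 -> `|kernel_sum r zeta - 1| <= e.
Proof.
move=> /andP[r0 r1] zeta1 /andP[e0 e1] rN.
pose y : C := r%:C * zeta^-1.
have rC : `|r%:C : C| = r%:C.
  by rewrite norm_normc /= expr0n addr0 sqrtr_sqr ger0_norm// ltW.
have ny : `|y| = r%:C by rewrite normrM normfV zeta1 invr1 mulr1 rC.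
have y1 : `|y| < 1 by rewrite ny -(rmorph1 (real_complex R)) ltcR.
have z1 (j : 'I_N) : `|r%:C * unity_root j : C| < 1.
  by rewrite normrM normr_unity_root mulr1 rC -(rmorph1 (real_complex R)) ltcR.
have N00 : N%:R != 0 :> R by rewrite gt_eqF.
have -> : kernel_sum r zeta - 1 = 2 * Re (y ^+ N / (1 - y ^+ N)).
  rewrite /kernel_sum.
  under eq_bigr => j _ do rewrite poisson_inv// mulrAC [_ * unity_root j]mulrC.
  rewrite big_split /= sumr_const card_ord -mulr_sumr -Re_sum sum_unity_geom//.
  have yN0 : 1 - y ^+ N != 0.
    rewrite subr_eq0; apply: contraTneq y1 => /(congr1 Num.norm).
    rewrite normr1 normrX => /esym/eqP; rewrite pexpr_eq1// => /eqP ->.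
    by rewrite ltxx.
  have -> : N%:R / (1 - y ^+ N) = N%:R%:C * (1 + y ^+ N / (1 - y ^+ N)).
    by rewrite rmorph_nat; field.
  by rewrite cReMr cReD -mulr_natr /=; field.
rewrite normrM ger0_norm//.
have yN : normc (y ^+ N) = r ^+ N.
  by rewrite normc_Re normrX ny -rmorphXn.
have d0 : 3 / 4 <= normc (1 - y ^+ N).
  have := normcD_le (1 - y ^+ N) (y ^+ N); rewrite subrK normc_Re normr1 yN /=.
  by move: rN e1; lra.
rewrite (le_trans (ler_wpM2l _ (Re_ge_normc _)))// normcM normcV yN.
have rN0 : 0 <= r ^+ N by rewrite exprn_ge0// ltW.
rewrite mulrA ler_pdivrMr; last by rewrite (lt_le_trans _ d0)// divr_gt0.
by move: rN d0 e0; nra.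
Qed.

End RootsOfUnityKernel.

(** * Density of products of Poisson kernels *)

Section PoissonDensity.
Variable R : realType.
Local Notation C := (C R).
Local Notation T2 := (T2 R).
Implicit Types (h : C * C -> R) (x y : C * C) (z w zeta : C).

Lemma torus_continuous_poisson z w : `|z| < 1 -> `|w| < 1 ->
  torus_continuous (fun x => poisson z x.1 * poisson w x.2).
Proof.
move=> z1 w1 x [x1 x2]; have x1z : x.1 != z.
  by apply: contraTneq z1 => <-; rewrite x1 ltxx.
have x2w : x.2 != w by apply: contraTneq w1 => <-; rewrite x2 ltxx.
apply: cvgM; apply: cvg_poisson => //; apply: cvg_within_filter.
  exact: cvg_fst.
exact: cvg_snd.
Qed.

(** The denominator is at least [(d / 2)^2] and the numerator [1 - r^2] at most [2 (1 - r)], which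
    gives the constant 8. *)
Lemma poisson_far (r d : R) (a zeta : C) : `|zeta| = 1 -> `|a| = 1 -> 0 < r < 1 ->
  0 < d -> d <= normc (zeta - a) -> 1 - r <= d / 2 ->
  poisson (r%:C * a) zeta <= 8 * (1 - r) / d ^+ 2.
Proof.
move=> zeta1 a1 /andP[r0 r1] d0 dz rd.
have nra : normc (r%:C * a) = r.
  by rewrite normcM (normc_eq1 a1) mulr1 normc_Re /= expr0n addr0 sqrtr_sqr
    /= ger0_norm// ltW.
have n1r : normc (r%:C * a - a) = 1 - r.
  have -> : r%:C * a - a = - (1 - r)%:C * a by rewrite rmorphB rmorph1; ring.
  rewrite normcM (normc_eq1 a1) mulr1 -rmorphN normc_Re /= expr0n addr0 sqrtr_sqr.
  by rewrite normrN /= ger0_norm// subr_ge0 ltW.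
have d2 : d / 2 <= normc (zeta - r%:C * a).
  have := normcD_le (zeta - r%:C * a) (r%:C * a - a).
  by rewrite addrA subrK n1r; lra.
have d20 : 0 < d / 2 by rewrite divr_gt0.
have n0 : 0 < normc (zeta - r%:C * a) by rewrite (lt_le_trans d20).
rewrite /poisson nra ler_pdivrMr ?exprn_gt0//.
apply: (@le_trans _ _ (8 * (1 - r) / d ^+ 2 * (d / 2) ^+ 2)).
  have -> : 8 * (1 - r) / d ^+ 2 * (d / 2) ^+ 2 = 2 * (1 - r).
    by field; rewrite gt_eqF.
  nra.
rewrite ler_wpM2l//.
  by rewrite divr_ge0 ?exprn_ge0 ?mulr_ge0 ?subr_ge0// ltW.
by rewrite ler_pXn2r// nnegrE ltW.
Qed.

Lemma near1_mul (u v t : R) : `|u - 1| <= t -> `|v - 1| <= t -> t <= 1 ->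
  [/\ `|1 - u * v| <= 3 * t, u + v <= 4 & u * v <= 4].
Proof.
rewrite !ler_norml => /andP[u1 u2] /andP[v1 v2] t1.
by split; [apply/andP; split; nra|lra|nra].
Qed.

(** [J] stands for the difference of the two sides of the formula, on real functions. *)
Variables (J : (C * C -> R) -> R) (K0 : R).
Hypothesis J_lincomb : forall (a b : R) (h k : C * C -> R),
  torus_continuous h -> torus_continuous k ->
  J (fun x => a * h x + b * k x) = a * J h + b * J k.
Hypothesis J_bound : forall h (e : R), torus_continuous h ->
  (forall x, T2 x -> `|h x| <= e) -> `|J h| <= K0 * e.
Hypothesis J_poisson : forall z w, `|z| < 1 -> `|w| < 1 ->
  J (fun x => poisson z x.1 * poisson w x.2) = 0.

Lemma functional_sum n (F : 'I_n -> C * C -> R) (a : 'I_n -> R) :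
  (forall i, torus_continuous (F i) /\ J (F i) = 0) ->
  torus_continuous (fun x => \sum_(i < n) a i * F i x) /\
  J (fun x => \sum_(i < n) a i * F i x) = 0.
Proof.
elim: n F a => [|n IH] F a FJ.
  rewrite (_ : (fun x => _) = (fun x => 0 * (fun=> 0) x + 0 * (fun=> 0) x)).
    have c0 : torus_continuous (fun=> 0 : R) by exact: torus_continuous_cst.
    by split; [exact: torus_continuous_lincomb|rewrite J_lincomb// !mul0r addr0].
  by apply/funext => x; rewrite big_ord0 !mul0r addr0.
have [cS S0] := IH _ (fun i => a (widen_ord (leqnSn n) i))
  (fun i => FJ (widen_ord (leqnSn n) i)).
have [cF F0] := FJ ord_max.
rewrite (_ : (fun x => _) = (fun x =>
  1 * (fun y => \sum_(i < n) a (widen_ord (leqnSn n) i) *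
    F (widen_ord (leqnSn n) i) y) x + a ord_max * F ord_max x)).
  split; first exact: torus_continuous_lincomb.
  by rewrite J_lincomb// S0 F0 !mulr0 addr0.
by apply/funext => x; rewrite big_ord_recr mul1r.
Qed.

(* The approximant is a Riemann sum, over the N-th roots of unity in each variable,
   of the Poisson integral of [h] at the radius [r]. *)
Lemma poisson_approx h e : torus_continuous h -> 0 < e -> exists S,
  [/\ torus_continuous S, J S = 0 & forall x, T2 x -> `|h x - S x| <= e].
Proof.
move=> ch e0; have [B B0 hB] := torus_bounded ch.
have e1 : 0 < e / 12 by rewrite divr_gt0.
have [d d0 hd] := torus_unif_continuous ch e1.
(* Error budget, [e / 3] each: the defect of total mass costs [B * 3 kappa], the near nodes [e / 12]
   times [W1 * W2 <= 4], the far nodes [2 B eta = e / 12] times [W1 + W2 <= 4]. *)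
pose eta := e / (24 * B); have eta0 : 0 < eta by rewrite divr_gt0// mulr_gt0.
pose kappa := Num.min 1 (e / (9 * B)).
have kappa0 : 0 < kappa by rewrite lt_min ltr01 divr_gt0// mulr_gt0.
have kappa1 : kappa <= 1 by rewrite ge_min lexx.
have kappaB : 3 * B * kappa <= e / 3.
  apply: (@le_trans _ _ (3 * B * (e / (9 * B)))).
    by rewrite ler_wpM2l ?mulr_ge0 ?(ltW B0)// ge_min lexx orbT.
  have -> : 3 * B * (e / (9 * B)) = e / 3 by field; rewrite gt_eqF.
  exact: lexx.
pose s := Num.min (1 / 2) (Num.min (d / 2) (eta * d ^+ 2 / 8)).
have s0 : 0 < s.
  by rewrite !lt_min !divr_gt0// mulr_gt0// exprn_gt0.
have s12 : s <= 1 / 2 by rewrite ge_min lexx.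
have sd : s <= d / 2 by rewrite !ge_min lexx orbT.
have seta : s <= eta * d ^+ 2 / 8 by rewrite !ge_min lexx !orbT.
pose r := 1 - s.
have r01 : 0 < r < 1 by rewrite /r; apply/andP; split; lra.
have /andP[r0 r1] := r01.
have rs : 1 - r = s by rewrite subKr.
have rd : 1 - r <= d / 2 by rewrite rs.
have rC : `|r%:C : C| = r%:C.
  by rewrite norm_normc /= expr0n addr0 sqrtr_sqr ger0_norm// ltW.
have [n rn] : exists n, r ^+ n <= kappa / 4.
  have [||n rn] := @geometric_small R r%:C (kappa / 4)%:C.
  - by rewrite rC -(rmorph1 (real_complex R)) ltcR.
  - by rewrite -(rmorph0 (real_complex R)) ltcR divr_gt0.
  by exists n; move: rn; rewrite rC -rmorphXn lecR.
pose N := n.+1; have N0 : (0 < N)%N by [].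
have rN : r ^+ N <= kappa / 4.
  by rewrite exprS (le_trans _ rn)// ler_piMl ?exprn_ge0// ltW.
pose z (j : 'I_N) : C := r%:C * unity_root R N j.
have z1 j : `|z j| < 1.
  by rewrite normrM normr_unity_root mulr1 rC -(rmorph1 (real_complex R)) ltcR.
pose P (j k : 'I_N) x := poisson (z j) x.1 * poisson (z k) x.2.
pose hh (j k : 'I_N) := h (unity_root R N j, unity_root R N k).
have row j := @functional_sum N (P j) (fun k => N%:R^-1 * N%:R^-1 * hh j k)
  (fun k => conj (torus_continuous_poisson (z1 j) (z1 k)) (J_poisson (z1 j) (z1 k))).
have [cS S0] := @functional_sum N _ (fun=> 1) row.
exists (fun x => \sum_(j < N) 1 * \sum_(k < N) N%:R^-1 * N%:R^-1 * hh j k * P j k x).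
split=> // x Tx; have [x1 x2] := Tx.
pose p (j : 'I_N) := poisson (z j) x.1; pose q (k : 'I_N) := poisson (z k) x.2.
have p0 j : 0 <= p j by exact: poisson_ge0.
have q0 k : 0 <= q k by exact: poisson_ge0.
pose W1 := N%:R^-1 * \sum_j p j; pose W2 := N%:R^-1 * \sum_k q k.
have kk : 0 < kappa <= 1 by rewrite kappa0.
have W1k : `|W1 - 1| <= kappa := kernel_sum_near1 N0 r01 x1 kk rN.
have W2k : `|W2 - 1| <= kappa := kernel_sum_near1 N0 r01 x2 kk rN.
have Tjk (j k : 'I_N) : T2 (unity_root R N j, unity_root R N k).
  by split; rewrite normr_unity_root.
have NN0 : 0 < N%:R^-1 :> R by rewrite invr_gt0 ltr0n.
(* Near nodes use uniform continuity; otherwise one of the two kernels is at most [eta], and a bound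
   on [h] is enough. *)
have term j k : `|h x - hh j k| * (p j * q k) <=
    e / 12 * (p j * q k) + 2 * B * eta * (p j + q k).
  have h2B : `|h x - hh j k| <= 2 * B.
    by rewrite (le_trans (ler_normB _ _))// mulr_natl mulr2n lerD ?hB//; exact: Tjk.
  have far1 : d <= normc (x.1 - unity_root R N j) -> p j <= eta.
    move=> dx; have pf := poisson_far x1 (normr_unity_root _ _ _) r01 d0 dx rd.
    by rewrite (le_trans pf)// rs ler_pdivrMr ?exprn_gt0//; move: seta; lra.
  have far2 : d <= normc (x.2 - unity_root R N k) -> q k <= eta.
    move=> dx; have pf := poisson_far x2 (normr_unity_root _ _ _) r01 d0 dx rd.
    by rewrite (le_trans pf)// rs ler_pdivrMr ?exprn_gt0//; move: seta; lra.
  have hp0 : 0 <= `|h x - hh j k| by [].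
  have Be : 0 <= 2 * B * eta by rewrite mulr_ge0 ?(ltW eta0)// mulr_ge0// ltW.
  have pj := p0 j; have qk := q0 k.
  have pq : 0 <= p j * q k by rewrite mulr_ge0.
  have e12 : 0 <= e / 12 * (p j * q k) by rewrite mulr_ge0// ltW.
  have [dx1|/far1 pe] := ltP (normc (x.1 - unity_root R N j)) d.
    have [dx2|/far2 qe] := ltP (normc (x.2 - unity_root R N k)) d.
      rewrite (le_trans (ler_wpM2r pq (hd _ _ Tx (Tjk j k) dx1 dx2)))//.
      by rewrite lerDl mulr_ge0// addr_ge0.
    rewrite (le_trans (ler_wpM2r pq h2B))//.
    have : 2 * B * (p j * q k) <= 2 * B * (p j * eta).
      by rewrite ler_wpM2l ?mulr_ge0 ?(ltW B0)// ler_wpM2l.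
    have : 0 <= 2 * B * eta * q k by rewrite mulr_ge0.
    by move: e12; clear; lra.
  rewrite (le_trans (ler_wpM2r pq h2B))//.
  have : 2 * B * (p j * q k) <= 2 * B * (eta * q k).
    by rewrite ler_wpM2l ?mulr_ge0 ?(ltW B0)// ler_wpM2r.
  have : 0 <= 2 * B * eta * p j by rewrite mulr_ge0.
  by move: e12; clear; lra.
have N00 : N%:R != 0 :> R by rewrite pnatr_eq0.
have sumpq : \sum_j \sum_k N%:R^-1 * N%:R^-1 * (p j * q k) = W1 * W2.
  rewrite /W1 /W2 mulrACA big_distrlr /= mulr_sumr; apply: eq_bigr => j _.
  by rewrite mulr_sumr.
have sumpDq : \sum_j \sum_k N%:R^-1 * N%:R^-1 * (p j + q k) = W1 + W2.
  under eq_bigr do rewrite -mulr_sumr big_split /= sumr_const card_ord.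
  rewrite -mulr_sumr big_split /= sumr_const card_ord sumrMnl.
  rewrite -[(\sum_i p i) *+ N]mulr_natl -[(\sum_i q i) *+ N]mulr_natl /W1 /W2.
  by move: N00; move: (N%:R : R) => c c0; field.
(* Separates the defect of total mass from the oscillation of [h]. *)
have -> : h x - \sum_(j < N) 1 * \sum_(k < N) N%:R^-1 * N%:R^-1 * hh j k * P j k x =
    h x * (1 - W1 * W2) +
    \sum_j \sum_k N%:R^-1 * N%:R^-1 * ((h x - hh j k) * (p j * q k)).
  rewrite mulrBr mulr1 -addrA; congr (_ + _).
  rewrite -sumpq mulr_sumr -sumrN -sumrN -big_split; apply: eq_bigr => j _ /=.
  rewrite mul1r mulr_sumr -sumrN -sumrN -big_split; apply: eq_bigr => k _ /=.
  by rewrite /P /p /q; ring.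
rewrite (le_trans (ler_normD _ _))//.
have sum_le : `|\sum_j \sum_k N%:R^-1 * N%:R^-1 * ((h x - hh j k) * (p j * q k))| <=
    e / 12 * (W1 * W2) + 2 * B * eta * (W1 + W2).
  rewrite -sumpq -sumpDq !mulr_sumr -big_split /=.
  rewrite (le_trans (ler_norm_sum _ _ _))// ler_sum// => j _.
  rewrite !mulr_sumr -big_split /= (le_trans (ler_norm_sum _ _ _))// ler_sum// => k _.
  rewrite normrM ger0_norm; last by rewrite mulr_ge0// ltW.
  rewrite [e / 12 * _]mulrCA [2 * B * eta * _]mulrCA -mulrDr.
  rewrite ler_wpM2l; [by []|by rewrite mulr_ge0// ltW|].
  by rewrite normrM [X in _ * X]ger0_norm ?term// mulr_ge0.
have first_le : `|h x * (1 - W1 * W2)| <= e / 3.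
  rewrite normrM (le_trans _ kappaB)//.
  have -> : 3 * B * kappa = B * (3 * kappa) by ring.
  apply: ler_pM => //; first exact: (hB x Tx).
  by have [] := near1_mul W1k W2k kappa1.
have [_ W12 W1W2] := near1_mul W1k W2k kappa1.
have eB : 2 * B * eta = e / 12 by rewrite /eta; field; rewrite gt_eqF.
rewrite eB in sum_le.
have e12 := ltW e1.
have fin (c1 c2 c3 c4 : R) : c1 <= e / 3 -> c2 <= e / 12 * c3 + e / 12 * c4 ->
  e / 12 * c4 <= e / 12 * 4 -> e / 12 * c3 <= e / 12 * 4 -> c1 + c2 <= e.
  by clear; lra.
exact: fin first_le sum_le (ler_wpM2l e12 W12) (ler_wpM2l e12 W1W2).
Qed.

Lemma functional_eq0 h : torus_continuous h -> J h = 0.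
Proof.
move=> ch; apply/eqP; rewrite -normr_le0; apply/ler_addgt0Pr => e e0; rewrite add0r.
(* The error is divided by [K], and [K0] is not known to be positive. *)
pose K := Num.max 1 K0; have K1 : 0 < K by rewrite lt_max ltr01.
have [|S [cS S0 hS]] := @poisson_approx h (e / K) ch; first by rewrite divr_gt0.
have cD : torus_continuous (fun x => 1 * h x + -1 * S x).
  exact: torus_continuous_lincomb.
have JD : J h = J (fun x => 1 * h x + -1 * S x).
  by rewrite J_lincomb// S0 mulr0 addr0 mul1r.
rewrite JD (le_trans (@J_bound _ (e / K) cD _))//.
  by move=> x Tx; rewrite mul1r mulN1r hS.
rewrite (@le_trans _ _ (K * (e / K)))//; last by rewrite mulrC divfK// gt_eqF.
by rewrite ler_wpM2r ?divr_ge0 ?(ltW e0) ?(ltW K1)// /K le_max lexx orbT.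
Qed.

End PoissonDensity.

(** * Fibers and slices of a rational inner function *)

Section RationalInner.
Variable R : realType.
Local Notation C := (C R).
Local Notation T2 := (T2 R).
Implicit Types (z w zeta eta t : C).

Lemma refl0 n : refl n (0 : {poly C}) = 0.
Proof. by apply/polyP => i; rewrite coef_poly !coef0 conjC0 if_same. Qed.

Lemma horner_swap (u : {poly {poly C}}) z w : (swapXY u).[w%:P].[z] = u.[z, w].
Proof. exact: horner2_swapXY. Qed.

Lemma deriv_slice1 (u : {poly {poly C}}) w :
  ((swapXY u).[w%:P])^`() = (swapXY u^`()).[w%:P].
Proof. by rewrite !horner_swapXY deriv_map. Qed.

Lemma deriv_slice2 (u : {poly {poly C}}) z :
  (u.[z%:P])^`() = (swapXY ((swapXY u)^`())).[z%:P].
Proof. by rewrite -{1}[u]swapXYK deriv_slice1. Qed.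

Lemma radial_cvg z : (fun r : R => r%:C * z : C) r @[r --> (1 : R)^'-] --> z.
Proof.
apply: cvg_at_left_filter; rewrite -[X in _ --> X]mul1r.
by apply: cvgMl; apply: cvg_real_complex; exact: cvg_id.
Qed.

Variables (m n : nat) (p : {poly {poly C}}) (alpha : C).
Hypotheses (rif_p : rif_bidegree m n p) (alpha1 : `|alpha| = 1).
Local Notation q := (reflection m n p).

Lemma size_fiber z : (size p.[z%:P] <= n.+1)%N.
Proof. by have [_ <- _ _] := rif_p; exact: max_size_evalC. Qed.

Lemma reflection_fiber zeta : `|zeta| = 1 ->
  q.[zeta%:P] = zeta ^+ m *: refl n p.[zeta%:P].
Proof.
move=> zeta1; apply: poly_eq_off0 => w w0; have [sp sYp _ _] := rif_p.
rewrite hornerZ reflE ?size_fiber//.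
by rewrite reflectionE ?sp ?sYp ?(circle_neq0 zeta1)// (invC_circle zeta1) mulrA.
Qed.

Lemma normr_reflection zeta eta : `|zeta| = 1 -> `|eta| = 1 ->
  `|q.[zeta, eta]| = `|p.[zeta, eta]|.
Proof.
move=> zeta1 eta1; rewrite reflection_fiber// hornerZ normrM normrX zeta1 expr1n.
by rewrite mul1r normr_refl_circle// size_fiber.
Qed.

(** If the fiber of [p] vanished, so would that of its reflection, making [z1 - zeta] a common
    factor. *)
Lemma fiber_neq0 zeta : `|zeta| = 1 -> p.[zeta%:P] != 0.
Proof.
move=> zeta1; apply/eqP => p0; have [_ _ _ ncf] := rif_p.
have /factor_theorem[a aE] : root p zeta%:P by apply/rootP.
have /factor_theorem[b bE] : root q zeta%:P.
  by apply/rootP; rewrite reflection_fiber// p0 refl0 scaler0.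
have := ncf ('X - zeta%:P%:P) a b; rewrite mulrC -aE [_ * b]mulrC -bE.
by move=> /(_ erefl erefl); rewrite poly_unitE size_XsubC.
Qed.

(** [zeta] is a limit of points [x] of the disc, where [p(x, .)] is zero-free, and the limit fiber
    is not 0. *)
Lemma fiber_zero_free zeta : `|zeta| = 1 -> zero_free_disc p.[zeta%:P].
Proof.
move=> zeta1 w w1; apply/eqP => pw; have := fiber_neq0 zeta1.
rewrite (@hurwitz _ p zeta w) ?eqxx//.
apply: (@closureS _ [set x : C | `|x| < 1]); last exact: closure_disc.
by move=> x /= x1 v v1; have [_ _ zf _] := rif_p; exact: zf.
Qed.

(** Circle points are covered by the fibers. With [z2] in the open disc there are no boundary
    singularities, and the results on quotients apply to the slice directly. *)
Lemma slice_zero_free w : `|w| < 1 -> zero_free_cdisc (swapXY p).[w%:P].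
Proof.
move=> w1 x; rewrite le_eqVlt horner_swap => /orP[/eqP x1|x1].
  exact: fiber_zero_free.
by have [_ _ zf _] := rif_p; exact: zf.
Qed.

Lemma slice_le w x : `|w| < 1 -> `|x| = 1 ->
  `|(swapXY q).[w%:P].[x]| <= `|(swapXY p).[w%:P].[x]|.
Proof.
move=> w1 x1; rewrite !horner_swap reflection_fiber// hornerZ normrM normrX x1.
rewrite expr1n mul1r refl_schwarz//; first exact: fiber_zero_free.
exact: size_fiber.
Qed.

Lemma fiber_touch zeta w : `|zeta| = 1 -> `|w| < 1 ->
  q.[zeta, w] = alpha * p.[zeta, w] -> q.[zeta%:P] = alpha *: p.[zeta%:P].
Proof.
move=> zeta1 w1 qp; have zf := fiber_zero_free zeta1.
have [|u uE] := refl_schwarz_eq zf (size_fiber zeta) w1.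
  have := congr1 Num.norm qp; rewrite reflection_fiber// hornerZ !normrM normrX.
  by rewrite zeta1 alpha1 expr1n !mul1r.
have qE : q.[zeta%:P] = (zeta ^+ m * u) *: p.[zeta%:P].
  by rewrite reflection_fiber// uE scalerA.
rewrite qE; congr (_ *: _); apply: (mulIf (zf w w1)).
by rewrite -qp qE hornerZ.
Qed.

(** The equation without division is a closed condition, so it passes to the closure, even to points
    where [p] and its reflection both vanish. *)
Lemma level_set_sub (z : C * C) : level_set m n p alpha z ->
  T2 z /\ q.[z.1, z.2] = alpha * p.[z.1, z.2].
Proof.
move=> Lz.
have c1 : (fun y : C * C => y.1) y @[y --> z] --> z.1 by exact: cvg_fst.
have c2 : (fun y : C * C => y.2) y @[y --> z] --> z.2 by exact: cvg_snd.
have n_eq (g : C * C -> C) : {for z, continuous g} -> (forall y, T2 y ->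
    (fun r : R => rif m n p (r%:C * y.1) (r%:C * y.2)) @ 1^'- --> alpha -> g y = 0) ->
    g z = 0.
  move=> cg g0; apply/eqP; rewrite -normc_eq0 eq_le normc_ge0 andbT -oppr_ge0.
  apply: (@ge0_closure _ _ _ (fun y => - normc (g y)) z Lz).
    by apply: cvgN; exact: cvg_normc.
  by move=> y [Ty ylim]; rewrite g0// normc_Re normr0 /= oppr0.
have T2z : T2 z.
  have n1 (g : C * C -> C) : {for z, continuous g} ->
      (forall y, T2 y -> `|g y| = 1) -> `|g z| = 1.
    move=> cg g1; have : `|g z| - 1 = 0.
      apply: (n_eq (fun y => `|g y| - 1)) => [|y Ty _]; last by rewrite g1// subrr.
      exact: (cvgB (cvg_norm cg) (cvg_cst _)).
    by move/eqP; rewrite subr_eq0 => /eqP.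
  split; first by apply: (n1 (fun y => y.1) c1) => y [].
  by apply: (n1 (fun y => y.2) c2) => y [].
split=> //; apply/eqP; rewrite -subr_eq0; apply/eqP.
apply: (n_eq (fun y => q.[y.1, y.2] - alpha * p.[y.1, y.2])).
  exact: (cvgB (cvg_horner2 (P := q) c1 c2)
    (cvgM (cvg_cst alpha) (cvg_horner2 (P := p) c1 c2))).
move=> y [y1 y2] ylim; apply/eqP; rewrite subr_eq0; apply/eqP.
have ry1 := @radial_cvg y.1; have ry2 := @radial_cvg y.2.
have pc : p.[r%:C * y.1, r%:C * y.2] @[r --> (1 : R)^'-] --> p.[y.1, y.2].
  exact: cvg_horner2 ry1 ry2.
have qc : q.[r%:C * y.1, r%:C * y.2] @[r --> (1 : R)^'-] --> q.[y.1, y.2].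
  exact: cvg_horner2 ry1 ry2.
apply: (cvg_unique _ qc); first exact: norm_hausdorff.
apply: cvg_trans (cvgM ylim pc); apply: near_eq_cvg; near=> r.
have r1 : r < 1 by near: r; exact: nbhs_left_lt.
have r0 : 0 < r by near: r; apply: nbhs_left_gt.
have rz (x : C) : `|x| = 1 -> `|r%:C * x| < 1.
  move=> x1; rewrite normrM x1 mulr1 -(rmorph1 (real_complex R)) normr_ltR normc_Re.
  by rewrite /= expr0n addr0 sqrtr_sqr /= ger0_norm// ltW.
have [_ _ zf _] := rif_p.
by rewrite /rif /= divfK// zf// rz.
Unshelve. all: by end_near. Qed.

Lemma level_set_point zeta eta : `|zeta| = 1 -> `|eta| = 1 ->
  p.[zeta, eta] != 0 -> q.[zeta, eta] = alpha * p.[zeta, eta] ->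
  level_set m n p alpha (zeta, eta).
Proof.
move=> zeta1 eta1 p0 qp; apply: subset_closure; split=> //=.
have c1 := @radial_cvg zeta; have c2 := @radial_cvg eta.
have -> : alpha = q.[zeta, eta] / p.[zeta, eta] by rewrite qp mulfK.
exact: (cvgM (cvg_horner2 (P := q) c1 c2) (cvgV p0 (cvg_horner2 (P := p) c1 c2))).
Qed.

End RationalInner.

(** * Vertical lines in the level set *)

Section VerticalLines.
Variable R : realType.
Local Notation C := (C R).
Implicit Types (z w zeta eta t : C).

Lemma near_right_finite (F : set R) (a : R) : finite_set F ->
  \forall e \near a^'+, ~ F e.
Proof.
move=> /finite_seqP[s ->]; elim: s => [|b s IH]; first by near=> e => /=.
have nb : \forall e \near a^'+, e != b.
  have [ab|ba] := ltP a b.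
    by near=> e; rewrite lt_eqF//; near: e; exact: nbhs_right_lt.
  by near=> e; rewrite gt_eqF// (le_lt_trans ba)//; near: e; exact: nbhs_right_gt.
near=> e => /=; rewrite inE => /orP[/eqP eb|es].
  have : e != b by near: e.
  by rewrite eb eqxx.
have : ~ [set` s] e by near: e.
exact.
Unshelve. all: by end_near. Qed.

Variables (m n : nat) (p : {poly {poly C}}) (alpha : C).
Hypotheses (rif_p : rif_bidegree m n p) (alpha1 : `|alpha| = 1).
Local Notation q := (reflection m n p).

(** The points of the line where [p] vanishes are finitely many, and they are reached along the arc
    [eta * expi e], as [level_set] is closed. *)
Lemma vertical_line t eta : `|t| = 1 -> q.[t%:P] = alpha *: p.[t%:P] ->
  `|eta| = 1 -> level_set m n p alpha (t, eta).
Proof.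
move=> t1 qp eta1.
have /closure_id -> : closed (level_set m n p alpha) by exact: closed_closure.
pose r := p.[t%:P] \Po (eta *: 'X) : {poly C}.
have rE x : r.[x] = p.[t, eta * x] by rewrite horner_comp hornerZ hornerX.
have r_neq0 : r != 0.
  apply: contraNneq (fiber_neq0 rif_p t1) => r0; apply/eqP/poly_eq0_circle => x x1.
  have -> : x = eta * (eta^-1 * x) by rewrite mulrA divff ?mul1r// circle_neq0.
  by rewrite -rE r0 horner0.
have f0 : {for 0%R, continuous (fun e : R => (t, eta * expi e) : C * C)}.
  exact: (cvg_pair (cvg_cst t) (cvgM (cvg_cst eta) (@continuous_expi R 0))).
have := @closure_path _ _ (level_set m n p alpha) _ _ f0.
rewrite /= expi0 mulr1; apply; near=> e.
have e0 : 0 < e by near: e; exact: nbhs_right_gt.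
have e2 : e < 2 * pi by near: e; apply: nbhs_right_lt; exact: pi2_gt0.
have re : ~ (e \in `[0, 2 * pi] /\ r.[expi e] = 0).
  by near: e; apply: near_right_finite; exact: finite_circle_roots.
apply: level_set_point => //.
- by rewrite normrM eta1 normr_expi mulr1.
- rewrite -rE; apply/eqP => re0; apply: re; split=> //.
  by rewrite in_itv /= !ltW.
- by rewrite qp hornerZ.
Unshelve. all: by end_near. Qed.

Variables (l : nat) (tau : 'I_l -> C).
Hypotheses (tau_inj : injective tau)
  (tauP : forall t, `|t| = 1 /\
    [set z | z.1 = t /\ `|z.2| = 1] `<=` level_set m n p alpha <->
    exists k, t = tau k).

Lemma tau_circle k : `|tau k| = 1.
Proof. by have [] : _ /\ _ := (tauP (tau k)).2 (ex_intro _ k erefl). Qed.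

Lemma tau_fiber k : q.[(tau k)%:P] = alpha *: p.[(tau k)%:P].
Proof.
have [t1 line] := (tauP (tau k)).2 (ex_intro _ k erefl).
apply/eqP; rewrite -subr_eq0; apply/eqP/poly_eq0_circle => x x1.
have /(level_set_sub rif_p)[_ /= E] : level_set m n p alpha (tau k, x).
  by apply: line.
by rewrite hornerD hornerN hornerZ E subrr.
Qed.

Lemma fiber_tau t : `|t| = 1 -> q.[t%:P] = alpha *: p.[t%:P] -> exists k, t = tau k.
Proof.
move=> t1 qp; apply/tauP; split=> // -[x y] [/= -> y1].
exact: vertical_line.
Qed.

Section Slice.
Variable w : C.
Hypothesis w1 : `|w| < 1.
Let Q := (swapXY p).[w%:P].
Let S := (swapXY q).[w%:P].

Lemma slice_touch t : `|t| = 1 -> (alpha *: Q - S).[t] = 0 -> exists k, t = tau k.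
Proof.
move=> t1 /eqP; rewrite hornerD hornerN hornerZ subr_eq0 !horner_swap => /eqP E.
by apply: fiber_tau => //; apply: fiber_touch w1 _ => //.
Qed.

Lemma slice_tau k : (alpha *: Q - S).[tau k] = 0.
Proof.
rewrite hornerD hornerN hornerZ !horner_swap tau_fiber hornerZ.
by rewrite subrr.
Qed.

(** Otherwise every point of the circle would be one of the finitely many [tau k]. *)
Lemma slice_neq : S <> alpha *: Q.
Proof.
move=> SQ; pose r : {poly C} := \prod_(k < l) ('X - (tau k)%:P).
have : r = 0.
  apply: poly_eq0_circle => x x1.
  have [|k ->] := slice_touch x1; first by rewrite SQ subrr horner0.
  by rewrite horner_prod (bigD1 k)//= hornerXsubC subrr mul0r.
by apply/eqP/prodf_neq0 => k _; rewrite polyXsubC_eq0.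
Qed.

Lemma slice_herglotz : exists M E : {poly C}, [/\ zero_free_cdisc E,
  forall z, `|z| < 1 -> poisson (rif m n p z w) alpha = Re (M.[z] / E.[z]) +
    \sum_(k < l) (normc (slope Q S alpha (tau k)))^-1 * poisson z (tau k) &
  forall z, `|z| = 1 -> (forall k, z != tau k) ->
    poisson (rif m n p z w) alpha = Re (M.[z] / E.[z])].
Proof.
have [M [E [zfE ME1 ME2]]] := schur_herglotz (slice_zero_free rif_p w1) alpha1
  (fun z => slice_le rif_p w1) slice_neq tau_inj tau_circle slice_tau slice_touch.
exists M, E; split=> // z z1.
  by rewrite -ME1// !horner_swap.
move=> ztau; rewrite -ME2 ?horner_swap//.
by apply/eqP => /(slice_touch z1)[k zk]; have := ztau k; rewrite zk eqxx.
Qed.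

End Slice.
End VerticalLines.

(** * Slopes as derivatives, and real quotients *)

Section Slopes.
Variable R : realType.
Local Notation C := (C R).

(** Where the quotient takes the value [alpha], its derivative is the slope times the unimodular
    factor [alpha / eta]. *)
Lemma normc_slope (Q S : {poly C}) (alpha eta : C) : `|alpha| = 1 ->
  `|eta| = 1 -> Q.[eta] != 0 -> (alpha *: Q - S).[eta] = 0 ->
  normc (derive1 (fun x => S.[x] / Q.[x]) eta) = normc (slope Q S alpha eta).
Proof.
move=> alpha1 eta1 Qe; rewrite hornerD hornerN hornerZ => /eqP.
rewrite subr_eq0 => /eqP SQ; rewrite derive1_ratio// -SQ /slope.
have a0 := circle_neq0 alpha1; have e0 := circle_neq0 eta1.
rewrite derivD derivN derivZ hornerD hornerN hornerZ.
have -> : (S^`().[eta] * Q.[eta] - alpha * Q.[eta] * Q^`().[eta]) / Q.[eta] ^+ 2 =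
  (- (eta * (alpha * Q^`().[eta] - S^`().[eta])) / (alpha * Q.[eta])) * (alpha / eta).
  by field; rewrite a0 e0 Qe.
rewrite normcM [normc (alpha / eta)]normc_Re normf_div alpha1 eta1 divr1 /=.
by rewrite mulr1.
Qed.

(* A quotient that is real on the disc is constant: shifting it by [i e] makes it
   zero free, so Hurwitz applies as [e] tends to 0. *)
Lemma real_quotient_const (A B : {poly C}) : zero_free_disc B ->
  (forall w, `|w| < 1 -> Im (A.[w] / B.[w]) = 0) ->
  forall w, `|w| < 1 -> A.[w] / B.[w] = A.[0] / B.[0].
Proof.
move=> zfB AB w w1; set x0 := A.[0] / B.[0].
have n0 : `|0 : C| < 1 by rewrite normr0.
have Im0 : Im x0 = 0 by exact: AB.
pose P : {poly {poly C}} := A%:P - B%:P * 'X.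
have PE (x : C) : P.[x%:P] = A - x *: B.
  by rewrite hornerD hornerN hornerM !hornerC hornerX mulrC mul_polyC.
have f0 : {for 0%R, continuous (fun e : R => x0 + 'i%C * (e%:C : C) : C)}.
  apply: cvgD; first exact: cvg_cst.
  by apply: cvgMr; exact: continuous_real_complex.
have P0 : P.[x0%:P] = 0.
  have Px0 : P.[x0, 0] = 0.
    by rewrite PE hornerD hornerN hornerZ divfK ?subrr//; exact: zfB.
  apply: hurwitz n0 Px0.
  have := @closure_path _ _ [set x : C | zero_free_disc P.[x%:P]] _ _ f0.
  rewrite rmorph0 mulr0 addr0; apply; near=> e => v v1 /=.
  have e0 : 0 < e by near: e; exact: nbhs_right_gt.
  rewrite PE hornerD hornerN hornerZ subr_eq0; apply/eqP => E.
  have := AB v v1; rewrite E mulfK ?zfB// cImD Im0 cImM /= mul1r mul0r.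
  by rewrite !add0r => /eqP; rewrite gt_eqF.
have := congr1 (fun r : {poly C} => r.[w]) P0.
rewrite /= PE hornerD hornerN hornerZ horner0 => /eqP; rewrite subr_eq0 => /eqP ->.
by rewrite mulfK// zfB.
Unshelve. all: by end_near. Qed.

End Slopes.

(** * Masses of the lines, and fibers over generic points of the circle *)

Section Fibers.
Variable R : realType.
Local Notation C := (C R).
Implicit Types (z w zeta eta t : C).

Variables (m n : nat) (p : {poly {poly C}}) (alpha : C).
Hypotheses (rif_p : rif_bidegree m n p) (alpha1 : `|alpha| = 1).
Local Notation q := (reflection m n p).
Variables (tau0 : C) (g : 'I_n -> C -> C) (l : nat) (tau : 'I_l -> C).
Hypothesis param : parametrization m n p alpha tau0 g tau.

Let tau_inj : injective tau. Proof. by have [] := param. Qed.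
Let tauP t : `|t| = 1 /\
    [set z | z.1 = t /\ `|z.2| = 1] `<=` level_set m n p alpha <->
    exists k, t = tau k.
Proof. by have [] := param. Qed.
Let tau1 k : `|tau k| = 1. Proof. exact: (tau_circle tauP). Qed.

Lemma slice_slopeE k w : `|w| < 1 ->
  [/\ normc (drif1 m n p (tau k) w) =
      normc (slope (swapXY p).[w%:P] (swapXY q).[w%:P] alpha (tau k)),
    slope (swapXY p).[w%:P] (swapXY q).[w%:P] alpha (tau k) =
      (normc (drif1 m n p (tau k) w))%:C &
    0 < normc (drif1 m n p (tau k) w)].
Proof.
move=> w1; have zfQ := slice_zero_free rif_p w1.
have Dtau := slice_tau rif_p tauP.
have [sE s0] := slopeE zfQ alpha1 (fun z => slice_le rif_p w1)
  (slice_neq rif_p alpha1 tauP w1) tau1 (fun k => Dtau w k) k.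
have nE : normc (drif1 m n p (tau k) w) =
    normc (slope (swapXY p).[w%:P] (swapXY q).[w%:P] alpha (tau k)).
  have Qtau : (swapXY p).[w%:P].[tau k] != 0 by apply: zfQ; rewrite tau1.
  rewrite -(normc_slope alpha1 (tau1 k) Qtau (Dtau w k)).
  rewrite (_ : (fun x => _) = (fun x : C => rif m n p x w))//.
  by apply/funext => x; rewrite !horner_swap.
by rewrite nE.
Qed.

Lemma drif1_const k w : `|w| < 1 ->
  normc (drif1 m n p (tau k) w) = normc (drif1 m n p (tau k) 0).
Proof.
move=> w1; have n0 : `|0 : C| < 1 by rewrite normr0.
(* Denominator, then numerator, of the slope at [tau k] as polynomials in [z2]. *)
pose B := alpha *: p.[(tau k)%:P].
pose A := - tau k *: (alpha *: p^`().[(tau k)%:P] - q^`().[(tau k)%:P]).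
have sAB v : `|v| < 1 -> (normc (drif1 m n p (tau k) v))%:C = A.[v] / B.[v].
  move=> v1; have [_ <- _] := slice_slopeE k v1.
  rewrite /slope derivD derivN derivZ !deriv_slice1 /A /B.
  rewrite !(hornerZ, hornerD, hornerN) !horner_swap.
  by rewrite -mulNr.
have zfB : zero_free_disc B.
  move=> v v1; rewrite hornerZ mulf_neq0 ?(circle_neq0 alpha1)//.
  exact: (fiber_zero_free rif_p).
have AB : A.[w] / B.[w] = A.[0] / B.[0].
  apply: (real_quotient_const zfB _ w1) => v v1.
  by rewrite -(sAB v v1).
by have := sAB w w1; rewrite AB -(sAB 0 n0) => /(congr1 Re).
Qed.

Section GoodFiber.
Variable zeta : C.
Hypotheses (zeta1 : `|zeta| = 1) (zeta_tau : forall k, zeta != tau k).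
Hypothesis no_common : forall eta, p.[zeta, eta] = 0 -> q.[zeta, eta] = 0 -> False.
Let Q := p.[zeta%:P].
Let S := q.[zeta%:P].

Lemma good_zero_free : zero_free_cdisc Q.
Proof.
move=> w; rewrite le_eqVlt => /orP[/eqP w1|w1]; last first.
  exact: (fiber_zero_free rif_p).
apply/eqP => pw; apply: (no_common pw); apply/eqP.
by rewrite -normr_eq0 (normr_reflection rif_p)// pw normr0.
Qed.

Lemma good_neq : S <> alpha *: Q.
Proof.
move=> /(fiber_tau rif_p tauP zeta1)[k zk].
by have := zeta_tau k; rewrite zk eqxx.
Qed.

(** The unimodular factor [zeta ^+ m] is absorbed into [alpha], after which [boundary_roots] applies
    to the fiber. *)
Lemma good_roots : (forall z, (alpha *: Q - S).[z] = 0 -> `|z| = 1) /\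
  size (alpha *: Q - S) = n.+1.
Proof.
have zm0 : zeta ^+ m != 0 by rewrite expf_neq0// circle_neq0.
have zm1 : `|zeta ^+ m| = 1 by rewrite normrX zeta1 expr1n.
pose alpha' := alpha / zeta ^+ m.
have alpha'1 : `|alpha'| = 1 by rewrite normf_div alpha1 zm1 divr1.
have SE : S = zeta ^+ m *: refl n Q by exact: reflection_fiber.
have DE : alpha *: Q - S = zeta ^+ m *: (alpha' *: Q - refl n Q).
  by rewrite SE scalerBr scalerA mulrCA divff// mulr1.
have [|_ roots sz] := boundary_roots (fiber_zero_free rif_p zeta1)
  (size_fiber rif_p zeta) alpha'1.
  move=> rQ; apply: good_neq; rewrite SE -/Q rQ scalerA mulrCA divff//.
  by rewrite mulr1.
split=> [z|]; last by rewrite DE size_scale.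
rewrite DE hornerZ => /eqP; rewrite mulf_eq0 (negPf zm0) /= => /eqP.
exact: roots.
Qed.

Lemma good_level eta : `|eta| = 1 ->
  (alpha *: Q - S).[eta] = 0 <-> exists j, eta = g j zeta.
Proof.
move=> eta1; have [_ _ _ _ LE] := param.
have inL : level_set m n p alpha (zeta, eta) <-> exists j, eta = g j zeta.
  rewrite LE /=; split=> [[_ [//|[k zk]]]|[j ej]].
    by have := zeta_tau k; rewrite zk eqxx.
  by split=> //; left; exists j.
rewrite -inL; split=> [|/(level_set_sub rif_p)[_ /= E]]; last first.
  by rewrite hornerD hornerN hornerZ /S E subrr.
move=> /eqP; rewrite hornerD hornerN hornerZ subr_eq0 => /eqP E.
apply: (level_set_point (m := m)) => //.
by have := @good_zero_free eta; rewrite eta1; apply.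
Qed.

Lemma g_circle j : `|g j zeta| = 1.
Proof. by have [g1 _ _ _ _] := param; exact: g1. Qed.

Lemma good_root j : (alpha *: Q - S).[g j zeta] = 0.
Proof. by apply/(good_level (g_circle j)); exists j. Qed.

Lemma good_norm z : `|z| = 1 -> `|S.[z]| = `|Q.[z]|.
Proof. by move=> z1; rewrite (normr_reflection rif_p). Qed.

Lemma good_le z : `|z| = 1 -> `|S.[z]| <= `|Q.[z]|.
Proof. by move=> /good_norm ->. Qed.

(** Positive slopes make the [n] roots of [alpha *: Q - S] simple. All of them are values
    [g j zeta], and [n] values that cover [n] distinct roots are distinct. *)
Lemma good_inj : injective (fun j => g j zeta).
Proof.
have [roots1 szD] := good_roots.
have [rs [D_rs [rs_root]]] := poly_split (alpha *: Q - S).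
have D_neq0 : alpha *: Q - S != 0 by rewrite -size_poly_eq0 szD.
move=> /(_ D_neq0); rewrite szD => -[szrs].
have lc0 : lead_coef (alpha *: Q - S) != 0 by rewrite lead_coef_eq0.
have rs_uniq : uniq rs.
  apply: uniq_simple_roots => r /rs_root/rootP Dr.
  have [_] := boundary_slope_gt0 good_zero_free alpha1 good_le good_neq
    (roots1 _ Dr) Dr.
  have -> : (alpha *: Q - S)^`().[r] =
      lead_coef (alpha *: Q - S) * (\prod_(x <- rs) ('X - x%:P))^`().[r].
    by rewrite [in LHS]D_rs derivZ hornerZ.
  by apply: contraTneq => ->; rewrite !mulr0 oppr0 mul0r ltxx.
apply/injectiveP; rewrite /injectiveb /dinjectiveb.
apply: (@leq_size_uniq _ rs) => //.
  move=> r /rs_root/rootP Dr; have [j ->] := (good_level (roots1 _ Dr)).1 Dr.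
  exact: map_f (mem_enum _ _).
by rewrite size_map size_enum_ord szrs.
Qed.

Lemma good_touch z : `|z| = 1 -> (alpha *: Q - S).[z] = 0 -> exists j, z = g j zeta.
Proof. by move=> z1 Dz; apply/good_level. Qed.

Lemma drif2_slope j : normc (drif2 m n p zeta (g j zeta)) =
  normc (slope Q S alpha (g j zeta)).
Proof.
have Qg : Q.[g j zeta] != 0 by apply: good_zero_free; rewrite g_circle.
by rewrite -(normc_slope alpha1 (g_circle j) Qg (good_root j)).
Qed.

Lemma drif2_gt0 j : 0 < normc (drif2 m n p zeta (g j zeta)).
Proof.
rewrite drif2_slope.
by have [] := slopeE good_zero_free alpha1 good_le good_neq g_circle good_root j.
Qed.

(** On such a fiber the quotient has modulus 1 on the circle, so [Re (M / E)] vanishes there off the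
    roots and its Poisson integral is 0: only the pole terms remain. *)
Lemma fiber_formula w : `|w| < 1 -> poisson (rif m n p zeta w) alpha =
  \sum_(j < n) (normc (drif2 m n p zeta (g j zeta)))^-1 * poisson w (g j zeta).
Proof.
move=> w1; have [M [E [zfE ME1 ME2]]] := schur_herglotz good_zero_free alpha1 good_le
  good_neq good_inj g_circle good_root good_touch.
rewrite [LHS]ME1//; under eq_bigr do rewrite -drif2_slope.
rewrite -[RHS]add0r; congr (_ + _).
rewrite -(poisson_formula_Re M zfE w1).
have cP := continuous_poisson w1.
have cG : continuous (fun t : R => Re (M.[expi t] / E.[expi t])).
  move=> t; apply: cvg_Re; apply: circle_continuous_ratio => x x1.
  by rewrite zfE ?x1.
have D_neq0 : alpha *: Q - S != 0 by rewrite -size_poly_eq0 good_roots.2.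
rewrite (@eq_avg_off_finite _ _ (fun=> 0) _ (finite_circle_roots D_neq0)).
- exact: avg_cst.
- apply: measurable_funTS; apply: continuous_measurable_fun => t.
  exact: (cvgM (cP t) (cG t)).
- exact: measurable_cst.
move=> t t02 Ft; have Dt : (alpha *: Q - S).[expi t] != 0.
  by apply/eqP => Dt; apply: Ft.
have e1 : `|expi t : C| = 1 by exact: normr_expi.
have Qe : `|Q.[expi t]| != 0 by rewrite normr_eq0 good_zero_free// e1.
rewrite -(ME2 _ e1 Dt) (poisson_circle alpha1) ?mulr0//.
by rewrite normf_div (good_norm e1) divff.
Qed.

End GoodFiber.
End Fibers.

(** * The right-hand side as a positive functional *)

Section DisintegrationFormula.
Variable R : realType.
Local Notation C := (C R).
Local Notation T2 := (T2 R).
Implicit Types (z w zeta eta : C) (t s : R).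

Lemma avg_sum n (f : 'I_n -> R -> R) : (forall i, avg_integrable (f i)) ->
  avg_integrable (fun t => \sum_(i < n) f i t) /\
  avg (fun t => \sum_(i < n) f i t) = \sum_(i < n) avg (f i).
Proof.
elim: n f => [|n IH] f fi.
  rewrite (_ : (fun t => _) = (fun=> 0)); last by apply/funext => t; rewrite big_ord0.
  by rewrite big_ord0 avg_cst; split=> //; exact: avg_integrable_cst.
have [iS aS] := IH (fun i => f (widen_ord (leqnSn n) i))
  (fun i => fi (widen_ord (leqnSn n) i)).
rewrite (_ : (fun t => _) = (fun t => 1 *
    (fun t => \sum_(i < n) f (widen_ord (leqnSn n) i) t) t + 1 * f ord_max t)).
  split; first exact: avg_integrable_lincomb.
  by rewrite avg_lincomb// aS big_ord_recr !mul1r.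
by apply/funext => t; rewrite big_ord_recr !mul1r.
Qed.

Lemma poisson0 zeta : `|zeta| = 1 -> poisson 0 zeta = 1.
Proof.
move=> zeta1; rewrite /poisson subr0 (normc_eq1 zeta1) normc_Re normr0 /=.
by rewrite expr0n expr1n subr0 divr1.
Qed.

Lemma ratio_bounded (M E : {poly C}) : zero_free_cdisc E ->
  exists2 B : R, 0 <= B & forall z, `|z| <= 1 -> normc (M.[z] / E.[z]) <= B.
Proof.
move=> zfE; have [P PP] := approx_ratio M zfE (@ltr01 C).
have [B [B0 PB]] := horner_bounded P.
have BE : B = (Re B)%:C by rewrite RRe_real// ger0_real.
exists (Re B + 1).
  by rewrite addr_ge0// -ler0c -BE.
move=> z z1; rewrite -normr_leR rmorphD rmorph1 /= -BE.
rewrite -[M.[z] / E.[z]](subrK P.[z]) (le_trans (ler_normD _ _))// addrC lerD//.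
  exact: PB.
exact: PP.
Qed.

Variables (m n : nat) (p : {poly {poly C}}) (alpha : C).
Hypotheses (rif_p : rif_bidegree m n p) (alpha1 : `|alpha| = 1).
Local Notation q := (reflection m n p).
Variables (tau0 : C) (g : 'I_n -> C -> C) (l : nat) (tau : 'I_l -> C).
Hypothesis param : parametrization m n p alpha tau0 g tau.

(** All bad base points are roots of one polynomial, so they make up finitely many angles: first
    coordinates of common zeros, the point [tau0], where the branches may jump, and the vertical
    lines. *)
Lemma exceptional_poly : exists2 r : {poly C}, r != 0 &
  forall zeta, r.[zeta] != 0 -> [/\ zeta <> tau0, forall k, zeta != tau k &
    forall eta, p.[zeta, eta] = 0 -> q.[zeta, eta] = 0 -> False].
Proof.
have [sp _ _ ncf] := rif_p.
have p_neq0 : p != 0 by rewrite -size_poly_eq0 sp.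
have [r r_neq0 rP] := common_zeros_finite p_neq0 ncf.
exists (r * ('X - tau0%:P) * \prod_(k < l) ('X - (tau k)%:P)).
  rewrite !mulf_neq0 ?polyXsubC_eq0//.
  by apply/prodf_neq0 => k _; rewrite polyXsubC_eq0.
move=> zeta; rewrite !hornerM !mulf_eq0 !negb_or hornerXsubC subr_eq0.
move=> /andP[/andP[rz /eqP z0] zk]; split=> // [k|eta p0 q0].
  apply: contraNneq zk => ->.
  by rewrite horner_prod (bigD1 k)//= hornerXsubC subrr mul0r.
by move: rz; rewrite (rP _ _ p0 q0) eqxx.
Qed.

Definition weight j t : R := (normc (drif2 m n p (expi t) (g j (expi t))))^-1.

Variable r : {poly C}.
Hypotheses (r_neq0 : r != 0) (rP : forall zeta, r.[zeta] != 0 ->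
  [/\ zeta <> tau0, forall k, zeta != tau k &
    forall eta, p.[zeta, eta] = 0 -> q.[zeta, eta] = 0 -> False]).

Let F : set R := [set t | t \in `[0, 2 * pi] /\ r.[expi t] = 0].

Let finF : finite_set F. Proof. exact: finite_circle_roots. Qed.

Let goodF t : t \in `[0, 2 * pi] -> ~ F t -> r.[expi t] != 0.
Proof. by move=> t02 Ft; apply/eqP => rt; apply: Ft. Qed.

(** [g j] is analytic only as a function on the circle, so its local extension [h] is followed along
    [expi] instead. *)
Lemma continuous_branch j t : r.[expi t] != 0 ->
  {for t, continuous (fun s => g j (expi s))}.
Proof.
move=> rt; have [nt0 _ _] := rP rt; have [_ ga _ _ _] := param.
have [h [dh gh]] := ga j (expi t) (normr_expi t) nt0.
have ch : {for expi t, continuous h}.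
  apply/differentiable_continuous/derivable1_diffP; exact: nbhs_singleton dh.
have ght : g j (expi t) = h (expi t).
  by have := nbhs_singleton gh; apply; exact: normr_expi.
have cht : h (expi s) @[s --> t] --> h (expi t).
  exact: (cvg_comp _ _ (@continuous_expi R t) ch).
rewrite -ght in cht; apply: cvg_trans cht; apply: near_eq_cvg.
have ne : \forall s \near t, `|expi s : C| = 1 -> g j (expi s) = h (expi s).
  exact: (@continuous_expi R t _ gh).
near=> s.
have gs : `|expi s : C| = 1 -> g j (expi s) = h (expi s) by near: s.
by rewrite gs// normr_expi.
Unshelve. all: by end_near. Qed.

Lemma g_expi j t : `|g j (expi t)| = 1.
Proof. by have [g1 _ _ _ _] := param; apply: g1; exact: normr_expi. Qed.

Lemma p_branch_neq0 j t : r.[expi t] != 0 -> p.[expi t, g j (expi t)] != 0.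
Proof.
move=> rt; have [_ nk nc] := rP rt.
by apply: (good_zero_free rif_p (normr_expi t) nc); rewrite g_expi.
Qed.

Let p2 := swapXY ((swapXY p)^`()).
Let q2 := swapXY ((swapXY q)^`()).
(** Closed form of [drif2], from which continuity along a branch can be read off. *)
Let d2 z w := (q2.[z, w] * p.[z, w] - q.[z, w] * p2.[z, w]) / p.[z, w] ^+ 2.

Lemma drif2E z w : p.[z, w] != 0 -> drif2 m n p z w = d2 z w.
Proof. by move=> pzw; rewrite /drif2 /rif derive1_ratio// !deriv_slice2. Qed.

Lemma continuous_weight j t : r.[expi t] != 0 -> {for t, continuous (weight j)}.
Proof.
move=> rt; have [_ nk nc] := rP rt.
have ce := @continuous_expi R t; have cg := @continuous_branch j t rt.
have h2 (P : {poly {poly C}}) :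
    P.[expi s, g j (expi s)] @[s --> t] --> P.[expi t, g j (expi t)].
  exact: cvg_horner2 ce cg.
have p0 := p_branch_neq0 j rt.
have cd : d2 (expi s) (g j (expi s)) @[s --> t] --> d2 (expi t) (g j (expi t)).
  have cp2 : p.[expi s, g j (expi s)] ^+ 2 @[s --> t] -->
      p.[expi t, g j (expi t)] ^+ 2.
    by under eq_fun do rewrite expr2; rewrite expr2; exact: (cvgM (h2 p) (h2 p)).
  have p20 : p.[expi t, g j (expi t)] ^+ 2 != 0 by rewrite expf_neq0.
  exact: (cvgM (cvgB (cvgM (h2 q2) (h2 p)) (cvgM (h2 q) (h2 p2))) (cvgV p20 cp2)).
have dt0 : normc (d2 (expi t) (g j (expi t))) != 0.
  rewrite -drif2E// gt_eqF//.
  exact: (drif2_gt0 rif_p alpha1 param (normr_expi t) nk nc).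
have cw : (normc (d2 (expi s) (g j (expi s))))^-1 @[s --> t] --> weight j t.
  by rewrite /weight drif2E//; exact: (cvgV dt0 (cvg_normc cd)).
apply: cvg_trans cw; apply: near_eq_cvg; rewrite /weight.
near=> s; rewrite drif2E//; near: s.
have np : \forall s \near t, normc (p.[expi s, g j (expi s)]) > 0.
  have np0 : 0 < normc p.[expi t, g j (expi t)].
    by rewrite lt_neqAle normc_ge0 eq_sym normc_eq0 p0.
  exact: (cvgr_gt _ (cvg_normc (h2 p))).
by apply: filterS np => s; rewrite lt_neqAle eq_sym normc_eq0 => /andP[].
Unshelve. all: by end_near. Qed.

Lemma weight_ge0 j t : 0 <= weight j t.
Proof. by rewrite invr_ge0 normc_ge0. Qed.

Let param_tau : injective tau /\ forall t : C, `|t| = 1 /\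
    [set z | z.1 = t /\ `|z.2| = 1] `<=` level_set m n p alpha <->
    exists k, t = tau k.
Proof. by have [] := param. Qed.

(** The weights are nonnegative, and [fiber_formula] at [z2 = 0] gives their sum as [Re (M / E)],
    where [E] is zero-free on the closed disc. *)
Lemma weight_bounded : exists2 B : R, 0 <= B &
  forall j t, r.[expi t] != 0 -> weight j t <= B.
Proof.
have n0 : `|0 : C| < 1 by rewrite normr0.
have [M [E [zfE _ ME]]] := slice_herglotz rif_p alpha1 param_tau.1 param_tau.2 n0.
have [B B0 BP] := ratio_bounded M zfE; exists B => // j t rt.
have [_ nk nc] := rP rt; have e1 : `|expi t : C| = 1 by exact: normr_expi.
have := fiber_formula rif_p alpha1 param e1 nk nc n0.
rewrite (ME _ e1 nk) => sum_w.
apply: (@le_trans _ _ (Re (M.[expi t] / E.[expi t]))).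
  have -> : Re (M.[expi t] / E.[expi t]) = \sum_(i < n) weight i t.
    rewrite sum_w; apply: eq_bigr => i _.
    by rewrite (poisson0 (g_expi i t)) mulr1.
  by rewrite (bigD1 j)//= lerDl sumr_ge0// => i _; exact: weight_ge0.
rewrite (le_trans (ler_norm _))// (le_trans (Re_ge_normc _))// BP// e1.
exact: lexx.
Qed.

Lemma branch_integrable (h : C * C -> R) j : torus_continuous h ->
  avg_integrable (fun t => h (expi t, g j (expi t)) * weight j t).
Proof.
move=> ch; have [B B0 BP] := weight_bounded; have [A A0 hA] := torus_bounded ch.
have Tg s : T2 (expi s, g j (expi s)) by split; [exact: normr_expi|exact: g_expi].
apply: (@integrable_off_finite _ _ F (A * B) finF) => t t02 /(goodF t02) rt.
  apply: cvgM; last exact: continuous_weight.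
  apply: torus_continuous_comp ch Tg _ _; first exact: continuous_expi.
  exact: continuous_branch.
by rewrite normrM ler_pM// ?hA// ger0_norm ?weight_ge0// BP.
Qed.

Lemma vertical_integrable (h : C * C -> R) k : torus_continuous h ->
  avg_integrable (fun t => h (tau k, expi t)).
Proof.
move=> ch; apply: continuous_avg_integrable => t.
have Tt s : T2 (tau k, expi s).
  by split; [exact: (tau_circle param_tau.2)|exact: normr_expi].
apply: torus_continuous_comp ch Tt _ _; first exact: cvg_cst.
exact: continuous_expi.
Qed.

(** By [drif1_const], any point of the disc in place of 0 gives the same mass. *)
Definition vertical_mass k : R := (normc (drif1 m n p (tau k) 0))^-1.

Definition clark_functional (h : C * C -> R) : R :=
  \sum_(j < n) avg (fun t => h (expi t, g j (expi t)) * weight j t) +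
  \sum_(k < l) vertical_mass k * avg (fun t => h (tau k, expi t)).

(** For fixed [z2], [fiber_formula] identifies the weighted sum over the branches with [Re (M / E)]
    at all but finitely many angles. The Poisson formula in [z1] then recovers the regular part, and
    the lines, on which the kernel in [z2] has mean 1, recover the poles. *)
Lemma clark_functional_poisson z1 z2 : `|z1| < 1 -> `|z2| < 1 ->
  clark_functional (fun x => poisson z1 x.1 * poisson z2 x.2) =
  poisson (rif m n p z1 z2) alpha.
Proof.
move=> z11 z21.
have [M [E [zfE ME1 ME2]]] :=
  slice_herglotz rif_p alpha1 param_tau.1 param_tau.2 z21.
have ch := torus_continuous_poisson z11 z21.
have [iS aS] := avg_sum (fun j => branch_integrable j ch).
rewrite (ME1 _ z11) /clark_functional -aS; congr (_ + _).
  rewrite -(poisson_formula_Re M zfE z11).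
  have cP := continuous_poisson z11.
  have cG : continuous (fun t => Re (M.[expi t] / E.[expi t])).
    move=> t; apply: cvg_Re; apply: circle_continuous_ratio => x x1.
    by rewrite zfE ?x1.
  apply: (eq_avg_off_finite finF).
  - by apply/measurable_EFinP; case/integrableP: iS.
  - apply: measurable_funTS; apply: continuous_measurable_fun => t.
    exact: (cvgM (cP t) (cG t)).
  move=> t t02 /(goodF t02) rt; have [_ nk nc] := rP rt.
  have e1 : `|expi t : C| = 1 by exact: normr_expi.
  rewrite -(ME2 _ e1 nk) (fiber_formula rif_p alpha1 param e1 nk nc z21).
  rewrite mulr_sumr; apply: eq_bigr => j _.
  by rewrite -mulrA [_ * weight j t]mulrC.
apply: eq_bigr => k _; rewrite /=.
have [sE _ _] := slice_slopeE rif_p alpha1 param k z21.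
rewrite -sE (drif1_const rif_p alpha1 param k z21); congr (_ * _).
rewrite avgZ; last exact/continuous_avg_integrable/continuous_poisson.
by rewrite avg_poisson// mulr1.
Qed.

Lemma clark_functional_lincomb a b (h k : C * C -> R) : torus_continuous h ->
  torus_continuous k -> clark_functional (fun x => a * h x + b * k x) =
  a * clark_functional h + b * clark_functional k.
Proof.
move=> ch ck; rewrite /clark_functional.
have -> : \sum_(j < n) avg (fun t => (a * h (expi t, g j (expi t)) +
    b * k (expi t, g j (expi t))) * weight j t) =
  a * \sum_(j < n) avg (fun t => h (expi t, g j (expi t)) * weight j t) +
  b * \sum_(j < n) avg (fun t => k (expi t, g j (expi t)) * weight j t).
  rewrite !mulr_sumr -big_split; apply: eq_bigr => j _ /=.
  rewrite -avg_lincomb; [|exact: branch_integrable..].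
  by apply: eq_avg => t; rewrite mulrDl !mulrA.
have -> : \sum_(i < l) vertical_mass i * avg (fun t => a * h (tau i, expi t) +
    b * k (tau i, expi t)) =
  a * \sum_(i < l) vertical_mass i * avg (fun t => h (tau i, expi t)) +
  b * \sum_(i < l) vertical_mass i * avg (fun t => k (tau i, expi t)).
  rewrite !mulr_sumr -big_split; apply: eq_bigr => i _ /=.
  rewrite avg_lincomb; [|exact: vertical_integrable..].
  by rewrite mulrDr !mulrA ![vertical_mass i * _]mulrC.
by rewrite !mulrDr addrACA.
Qed.

Lemma clark_functional_le (h k : C * C -> R) : torus_continuous h ->
  torus_continuous k -> (forall x, T2 x -> h x <= k x) ->
  clark_functional h <= clark_functional k.
Proof.
move=> ch ck hk; apply: lerD; apply: ler_sum => i _.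
  apply: le_avg; [exact: branch_integrable..|] => t.
  rewrite ler_wpM2r ?weight_ge0// hk//.
  by split; [exact: normr_expi|exact: g_expi].
rewrite ler_wpM2l ?invr_ge0 ?normc_ge0//.
apply: le_avg; [exact: vertical_integrable..|] => t; apply: hk.
by split; [exact: (tau_circle param_tau.2)|exact: normr_expi].
Qed.

(** Positivity bounds the functional by its total mass, the value at the constant 1. *)
Lemma clark_functional_bound (h : C * C -> R) e : torus_continuous h ->
  (forall x, T2 x -> `|h x| <= e) ->
  `|clark_functional h| <= clark_functional (fun=> 1) * e.
Proof.
move=> ch he; have c1 : torus_continuous (fun=> 1 : R) by exact: torus_continuous_cst.
have Le a : clark_functional (fun=> a) = clark_functional (fun=> 1) * a.
  rewrite mulrC -[RHS]addr0 -(mul0r (clark_functional (fun=> 1))).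
  rewrite -clark_functional_lincomb//; congr clark_functional.
  by apply/funext => x; rewrite mulr1 mulr1 addr0.
rewrite ler_norml -mulrN -!Le; apply/andP; split;
  apply: clark_functional_le => //; try exact: torus_continuous_cst;
  by move=> x /he; rewrite ler_norml => /andP[].
Qed.

End DisintegrationFormula.

(** * Measurability on the torus and the final comparison *)

Section TorusMeasure.
Variable R : realType.
Local Notation C := (C R).
Local Notation T2 := (T2 R).

Lemma closed_T2 : closed T2.
Proof.
have -> : T2 = [set z | normc z.1 = 1] `&` [set z | normc z.2 = 1].
  apply/seteqP; split=> z [z1 z2]; split; try exact: normc_eq1;
    by rewrite norm_normc (z1, z2).
apply: closedI.
  apply: (@closed_comp _ _ (fun z : C * C => normc z.1) [set 1]) => [z _|].
    by apply: cvg_normc; exact: cvg_fst.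
  exact: closed_eq.
apply: (@closed_comp _ _ (fun z : C * C => normc z.2) [set 1]) => [z _|].
  by apply: cvg_normc; exact: cvg_snd.
exact: closed_eq.
Qed.

Lemma open_measurable_C2 (U : set (C * C)) :
  open U -> measurable (U : set (borelC2 R)).
Proof. by move=> oU; exact: sub_sigma_algebra. Qed.

Lemma measurable_T2 : measurable (T2 : set (borelC2 R)).
Proof.
rewrite -[T2]setCK; apply: measurableC; apply: open_measurable_C2.
exact/closed_openC/closed_T2.
Qed.

Lemma torus_measurable (h : C * C -> R) : torus_continuous h ->
  measurable_fun (T2 : set (borelC2 R)) h.
Proof.
move=> /torus_continuousP /continuousP ch.
apply: (measurability _ (RGenOpens.measurableE R)) => _ [_ [a [b ->] <-]].
have oI : open (`]a, b[%classic : set R) by exact: interval_open.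
have /open_subspaceP[V oV VE] := ch _ oI.
rewrite setIC -VE; apply: measurableI; first exact: open_measurable_C2.
exact: measurable_T2.
Qed.

Lemma torus_integrable (sigma : {measure set (borelC2 R) -> \bar R})
    (h : C * C -> R) : (sigma T2 < +oo)%E -> torus_continuous h ->
  sigma.-integrable T2 (EFin \o h).
Proof.
move=> sT ch; apply: measurable_bounded_integrable => //.
- exact: measurable_T2.
- exact: torus_measurable.
have [B B0 hB] := torus_bounded ch.
exists B; split; first exact: num_real.
by move=> x Bx y Ty; exact: (le_trans (hB _ Ty) (ltW Bx)).
Qed.

Lemma Re_div_norm (z w : C) : Re (z / `|w|) = Re z * (normc w)^-1.
Proof. by rewrite norm_normc -fmorphV mulrC cReMr mulrC. Qed.

Lemma Im_div_norm (z w : C) : Im (z / `|w|) = Im z * (normc w)^-1.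
Proof. by rewrite norm_normc -fmorphV mulrC cImMr mulrC. Qed.

End TorusMeasure.

Theorem theorem3p8 (R : realType) (m n : nat) (p : {poly {poly C R}})
    (alpha : C R) (sigma : {measure set (borelC2 R) -> \bar R})
    (tau0 : C R) (g : 'I_n -> C R -> C R) (l : nat) (tau : 'I_l -> C R) :
  (0 < m)%N -> (0 < n)%N -> rif_bidegree m n p ->
  `|alpha| = 1 -> exceptional m n p alpha ->
  clark_measure m n p alpha sigma ->
  `|tau0| = 1 -> parametrization m n p alpha tau0 g tau ->
  exists c : 'I_l -> R,
    (forall k, 0 < c k) /\
    (forall k (z2 : C R), `|z2| < 1 ->
       c k = (ComplexField.Normc.normc (drif1 m n p (tau k) z2))^-1) /\
    forall f : C R * C R -> C R, {within T2 R, continuous f} ->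
      (forall j, circle_integrable
         (fun zeta => f (zeta, g j zeta) / `|drif2 m n p zeta (g j zeta)|)) /\
      cintegral sigma (T2 R) f =
        \sum_(j < n) circle_integral
          (fun zeta => f (zeta, g j zeta) / `|drif2 m n p zeta (g j zeta)|)
        + \sum_(k < l) (c k)%:C * circle_integral (fun zeta => f (tau k, zeta)).
Proof.
move=> _ _ rif_p alpha1 _ [sigma0 sigmaP] _ param.
have [r r_neq0 rP] := exceptional_poly rif_p tau0 tau.
pose L := clark_functional m p g tau.
have n0 : `|0 : C R| < 1 by rewrite normr0.
(* At the origin both Poisson kernels are 1, so the Clark identity there computes the total mass. *)
have sT : (sigma (T2 R) < +oo)%E.
  have := sigmaP 0 0 n0 n0.
  rewrite (@eq_integral _ _ _ sigma (T2 R) (cst 1%E)).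
    rewrite integral_cst; last exact: measurable_T2.
    by rewrite mul1e => <-; rewrite ltry.
  by move=> x /set_mem[x1 x2]; rewrite !poisson0// mulr1.
pose J h := \int[sigma]_(x in T2 R) h x - L h.
have J0 h : torus_continuous h -> J h = 0.
  apply: (@functional_eq0 _ J (fine (sigma (T2 R)) + L (fun=> 1))).
  - move=> a b h1 h2 c1 c2; rewrite /J.
    rewrite Rintegral_lincomb; [|exact: measurable_T2|exact: torus_integrable..].
    by rewrite /L (clark_functional_lincomb rif_p alpha1 param r_neq0 rP)//; ring.
  - move=> h1 e c1 he; rewrite /J (le_trans (ler_normB _ _))// mulrDl lerD//.
      have mT : measurable (T2 R : set (borelC2 R)) by exact: measurable_T2.
      rewrite (le_trans (le_normr_Rintegral mT (torus_integrable sT c1)))//.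
      rewrite mulrC -(Rintegral_cst sigma mT e); apply: le_Rintegral => //.
      + by apply: integrable_norm; exact: torus_integrable.
      + by apply: torus_integrable => //; exact: torus_continuous_cst.
    exact: (clark_functional_bound rif_p alpha1 param r_neq0 rP).
  move=> z w z1 w1; rewrite /J /L.
  rewrite (clark_functional_poisson rif_p alpha1 param r_neq0 rP)//.
  (* [poisson (rif m n p z w) alpha] is by definition the left side of the Clark identity. *)
  by rewrite /Rintegral -sigmaP//= subrr.
have IL h : torus_continuous h -> \int[sigma]_(x in T2 R) h x = L h.
  by move=> ch; apply/eqP; rewrite -subr_eq0; apply/eqP/J0.
exists (vertical_mass m n p tau); split.
  move=> k; rewrite invr_gt0.
  by have [_ _] := slice_slopeE rif_p alpha1 param k n0.
split=> [k z2 z21|f cf].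
  by rewrite (drif1_const rif_p alpha1 param k z21).
have cRe : torus_continuous (fun x => Re (f x)).
  by move=> x Tx; apply: cvg_Re; move/subspace_continuousP : cf; apply.
have cIm : torus_continuous (fun x => Im (f x)).
  by move=> x Tx; apply: cvg_Im; move/subspace_continuousP : cf; apply.
have intRe j := branch_integrable rif_p alpha1 param r_neq0 rP j cRe.
have intIm j := branch_integrable rif_p alpha1 param r_neq0 rP j cIm.
split=> [j|].
  split; [move: (intRe j)|move: (intIm j)]; rewrite /avg_integrable;
    congr (_.-integrable _ _); apply/funext => t;
    by [rewrite /= Re_div_norm|rewrite /= Im_div_norm].
(* The densities and masses are real, so the complex formula splits into [IL] for the real and for
   the imaginary part of [f]. *)
apply/eqP; rewrite eq_complex; apply/andP; split; apply/eqP.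
  rewrite [LHS]IL// cReD !Re_sum; congr (_ + _); apply: eq_bigr => i _.
    by rewrite Re_circle_integral; apply: eq_avg => t; rewrite Re_div_norm.
  by rewrite cReMr Re_circle_integral.
rewrite [LHS]IL// cImD !Im_sum; congr (_ + _); apply: eq_bigr => i _.
  by rewrite Im_circle_integral; apply: eq_avg => t; rewrite Im_div_norm.
by rewrite cImMr Im_circle_integral.
Qed.
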